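(* Let $0\le\beta<1$ and let $K_1\subset\mathbb R^{d_1}$, $K_2\subset\mathbb R^{d_2}$ be closed cones ($d_1,d_2\ge1$). The spaces $S^\beta(K_1\times K_2)$ and $S^\beta(K_1,K_2)$ coincide only if $K_1=\mathbb R^{d_1}$ and $K_2=\mathbb R^{d_2}$ or if both these cones are degenerate (equal to $\{0\}$). In all other cases, these spaces are distinct and have different dual spaces (the duals being regarded as subspaces of $S^{\prime\,\beta}(\mathbb R^{d_1+d_2})$).
   Context: Put $p=1/(1-\beta)$. A cone in $\mathbb R^d$ is a nonempty set invariant under multiplication by positive numbers (so a closed cone contains $0$; $\{0\}$ is a closed cone, called degenerate). For cones $V_1,V_2$, the notation $V_1\Subset V_2$ means $\bar V_1\setminus\{0\}\subset V_2$. $|\cdot|$ is a fixed norm on $\mathbb R^d$ and $d(x,U)=\inf_{\xi\in U}|x-\xi|$. For an open cone $U\subset\mathbb R^d$, $B>0$ and $N=0,1,2,\dots$, let $H^{\beta,B}_N(U)$ be the Hilbert space of entire functions on $\mathbb C^d$ with finite norm for the inner product $$\langle f,g\rangle_{U,B,N}=\int_{\mathbb C^d}\overline{f(z)}\,g(z)\prod_{j=1}^d(1+|x_j|)^{2N}\exp\{-2d(Bx,U)^{p}-2|By|^{p}\}\,d\lambda,\qquad z=x+iy,$$ where $d\lambda=dx\,dy$ is Lebesgue measure. For $b>0$, $S^{\beta,b}(U)=\bigcap_{B>b,\,N\ge0}H^{\beta,B}_N(U)$ with the projective limit topology (a Fréchet space), and $S^\beta(U)=\bigcup_{b>0}S^{\beta,b}(U)$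 with the locally convex inductive limit topology (independent of the choice of norm). $S^{\prime\,\beta}(\cdot)$ denotes the dual of $S^\beta(\cdot)$. $S^\beta(\{0\})$ is defined by the same formulas with $U=\{0\}$, $d(x,\{0\})=|x|$. For a closed cone $K\ne\{0\}$, $S^\beta(K)$ is the union of the spaces $S^\beta(U)$ over all open cones $U$ with $K\Subset U$, with the locally convex inductive limit topology. In particular $S^\beta(K_1\times K_2)$ is the space so associated with the closed cone $K_1\times K_2\subset\mathbb R^{d_1+d_2}$. $S^\beta(K_1,K_2)=\varinjlim_{U_1,U_2}S^\beta(U_1\times U_2)$, where $U_i$ ranges over the open cones in $\mathbb R^{d_i}$ with $K_i\Subset U_i$; all these spaces are subspaces of $S^\beta(\{0\})$ over $\mathbb R^{d_1+d_2}$, and the inductive limit is their linear span with the finest locally convex topology making all the inclusions continuous. (If $K_i=\{0\}$, one obtains the same space with the same topology by also allowing $U_i=\{0\}$, with $S^\beta(U_1\times U_2)$ defined by the same formulas; the family is then directed.) The space $S^\beta(\mathbb R^{d_1+d_2})$ is dense in both spaces, so their duals are identified, by restriction, with subspaces of $S^{\prime\,\beta}(\mathbb R^{d_1+d_2})$. *)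

(* Defs.v *)
From HB Require Import structures.
From mathcomp Require Import all_boot all_order all_algebra.
From mathcomp Require Import complex.
From mathcomp Require Import all_classical all_reals all_analysis.

Set Implicit Arguments.
Unset Strict Implicit.
Unset Printing Implicit Defensive.

Import Order.TTheory GRing.Theory Num.Theory.
Import numFieldNormedType.Exports.

Local Open Scope classical_set_scope.
Local Open Scope complex_scope.
Local Open Scope ring_scope.

(* The n-th power of a sigma-finite measure m, on n-tuples with the product
   sigma-algebra: recursively, the image of m \x m^n under (x, t) |-> x :: t. *)
Section TupleMeasure.
Context d (T : measurableType d) (R : realType).
Variable m : {sigma_finite_measure set T -> \bar R}.

Definition cons_pair (n : nat) (u : T * n.-tuple T) : n.+1.-tuple T :=
  [the n.+1.-tuple T of u.1 :: u.2].

Definition uncons_pair (n : nat) (t : n.+1.-tuple T) : T * n.-tuple T :=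
  (tnth t ord0, [tuple of behead t]).

Lemma cons_pairK n : cancel (@cons_pair n) (@uncons_pair n).
Proof. by case=> x t; congr (_, _); exact: val_inj. Qed.

Lemma measurable_cons_pair n : measurable_fun setT (@cons_pair n).
Proof. exact: measurable_cons measurable_fst measurable_snd. Qed.

Lemma measurable_uncons_pair n : measurable_fun setT (@uncons_pair n).
Proof.
apply/measurable_fun_pairP; split; first exact: measurable_tnth.
exact: measurable_behead.
Qed.

Section Step.
Variables (n : nat) (mu : {sigma_finite_measure set (n.-tuple T) -> \bar R}).

Definition tuple_measure_step : set (n.+1.-tuple T) -> \bar R :=
  pushforward (m \x mu)%E (@cons_pair n).

Let step0 : tuple_measure_step set0 = 0%E.
Proof. by rewrite /tuple_measure_step /pushforward preimage_set0 measure0. Qed.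

Let step_ge0 A : (0 <= tuple_measure_step A)%E.
Proof. exact: (measure_ge0 (m \x mu)%E). Qed.

Let step_sigma_additive : semi_sigma_additive tuple_measure_step.
Proof.
exact: (@measure_semi_sigma_additive _ _ _
  (measure_function_pushforward__canonical__measure_function_Measure
     (m \x mu)%E (measurable_cons_pair (n := n)))).
Qed.

HB.instance Definition _ := isMeasure.Build _ _ _ tuple_measure_step
  step0 step_ge0 step_sigma_additive.

Let step_sigma_finite : sigma_finite setT tuple_measure_step.
Proof.
have [F FT Foo] : sigma_finite setT (m \x mu)%E.
  have /sigma_finiteP[F [TF ndF Foo]] := sigma_finiteT m.
  have /sigma_finiteP[G [TG ndG Goo]] := sigma_finiteT mu.
  exists (fun k => F k `*` G k).
    rewrite -setXTT TF TG predeqE => -[x y]; split.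
      move=> [/= [i _ Fix] [j _ Gjy]]; exists (maxn i j) => //; split.
        by move: x Fix; exact/subsetPset/ndF/leq_maxl.
      by move: y Gjy; exact/subsetPset/ndG/leq_maxr.
    by move=> [k _ []/= ? ?]; split; exists k.
  move=> k; have [? ?] := Foo k; have [? ?] := Goo k.
  split; first exact: measurableX.
  by rewrite product_measure1E// lte_mul_pinfty// ge0_fin_numE.
exists (fun k => @uncons_pair n @^-1` F k).
  by rewrite -preimage_bigcup -FT preimage_setT.
move=> k; have [mF Fk] := Foo k; split.
  by rewrite -[X in measurable X]setTI; exact: measurable_uncons_pair.
rewrite /tuple_measure_step /pushforward -comp_preimage.
rewrite (_ : _ @^-1` _ = F k)//.
by apply/seteqP; split=> u; rewrite /preimage/= cons_pairK.
Qed.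

HB.instance Definition _ :=
  Measure_isSigmaFinite.Build _ _ _ tuple_measure_step step_sigma_finite.
End Step.

Fixpoint tuple_measure (n : nat) :
    {sigma_finite_measure set (n.-tuple T) -> \bar R} :=
  if n is k.+1 then tuple_measure_step (tuple_measure k)
  else \d_([tuple] : 0.-tuple T).

End TupleMeasure.

(* The complex numbers, as a [numClosedFieldType] in order to get the topology
   and the normed module structure of a numeric field. *)
Definition CC (R : realType) : numClosedFieldType := R[i].

Section Spaces.
Variable R : realType.

Section Cones.
Variable n : nat.
Implicit Types V U : set 'rV[R]_n.

Definition is_norm (nrm : 'rV[R]_n -> R) : Prop :=
  [/\ forall x, nrm x = 0 -> x = 0,
      forall a x, nrm (a *: x) = `|a| * nrm x
    & forall x y, nrm (x + y) <= nrm x + nrm y].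

Definition cone V : Prop :=
  V !=set0 /\ forall (t : R) x, 0 < t -> V x -> V (t *: x).

(* The relation V \Subset U between cones. *)
Definition compact_sub V U : Prop := closure V `\ 0 `<=` U.

Definition dist_set (nrm : 'rV[R]_n -> R) (x : 'rV[R]_n) U : R :=
  inf [set nrm (x - xi) | xi in U].

End Cones.

Definition prod_set (d1 d2 : nat) (A1 : set 'rV[R]_d1) (A2 : set 'rV[R]_d2) :
    set 'rV[R]_(d1 + d2) :=
  [set x | A1 (lsubmx x) /\ A2 (rsubmx x)].

Section LocallyConvex.
Variable V : lmodType (CC R).

(* A linear subspace of V together with a locally convex topology of its own,
   given by the neighbourhoods of 0: [lcs_nbhs0 E W] means that W contains a
   neighbourhood of 0 in E (W itself need not be included in E). *)
Record lcs := Lcs { lcs_car :> set V ; lcs_nbhs0 : set (set V) }.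

Definition lin_span (A : set V) : set V :=
  [set f | exists (n : nat) (a : 'I_n -> CC R) (g : 'I_n -> V),
     (forall i, A (g i)) /\ f = \sum_(i < n) a i *: g i].

Definition absconvex (A : set V) : Prop :=
  forall (a b : CC R) (f g : V),
    A f -> A g -> `|a| + `|b| <= 1 -> A (a *: f + b *: g).

(* D with the finest locally convex topology making continuous the inclusions
   of all the members of the family T; D is meant to be the span of T. *)
Definition ind_lim (D : set V) (T : set lcs) : lcs :=
  Lcs D [set W | exists A : set V, [/\ absconvex A, A `<=` W
                   & forall E, T E -> lcs_nbhs0 E A]].

(* Continuous linear functionals; for a linear functional, continuity is
   continuity at 0. *)
Definition dual (E : lcs) : set (E -> CC R) :=
  [set l | (forall (a b : CC R) (f g h : E),
              val h = a *: val f + b *: val g -> l h = a * l f + b * l g)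
        /\ forall e : R, 0 < e -> exists2 W, lcs_nbhs0 E W &
              forall f : E, W (val f) -> Normc.normc (l f) < e].

Arguments dual : clear implicits.

(* The dual of E as a subset of the dual of a subspace E0 of E, by
   restriction. *)
Definition dual_restr (E0 E : lcs) : set (E0 -> CC R) :=
  [set l | dual E0 l /\ exists2 L : E -> CC R, dual E L &
     forall (f : E0) (g : E), val f = val g -> l f = L g].

Arguments dual_restr : clear implicits.

End LocallyConvex.

Section Sbeta.
Variables (d : nat) (beta : R) (nrm : 'rV[R]_d -> R).
Implicit Types (U K : set 'rV[R]_d) (f : 'rV[CC R]_d -> CC R).

Definition entire f : Prop := forall z, differentiable f z.

Definition rvec (t : d.-tuple (measurableTypeR R)) : 'rV[R]_d :=
  \row_j tnth t j.

Definition zvec (x y : 'rV[R]_d) : 'rV[CC R]_d :=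
  \row_j (x ord0 j +i* y ord0 j).

Definition weight U (B : R) (N : nat) (x y : 'rV[R]_d) : R :=
  let p := (1 - beta)^-1 in
  (\prod_(j < d) (1 + `|x ord0 j|) ^+ (2 * N)) *
  expR (- 2 * dist_set nrm (B *: x) U `^ p - 2 * nrm (B *: y) `^ p).

(* The squared norm <f, f>_{U,B,N}, the integral being over C^d = R^d x R^d *)
Definition sqnorm U (B : R) (N : nat) f : \bar R :=
  let leb := tuple_measure (@lebesgue_measure R) d in
  (\int[leb \x leb]_u
     ((Normc.normc (f (zvec (rvec u.1) (rvec u.2)))) ^+ 2 *
        weight U B N (rvec u.1) (rvec u.2))%:E)%E.

Definition Hnorm U (B : R) (N : nat) f : R := Num.sqrt (fine (sqnorm U B N f)).

Definition Hspace U (B : R) (N : nat) : set ('rV[CC R]_d -> CC R) :=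
  [set f | entire f /\ (sqnorm U B N f < +oo)%E].

(* Projective limit: a basic neighbourhood of 0 bounds finitely many of the
   norms. *)
Definition S_b U (b : R) : lcs ('rV[CC R]_d -> CC R) :=
  let D := [set f | forall B N, b < B -> Hspace U B N f] in
  Lcs D [set W | exists (s : seq (R * nat)) (e : R),
    [/\ 0 < e, forall i, i \in s -> b < i.1 &
       forall f, D f -> (forall i, i \in s -> Hnorm U i.1 i.2 f < e) -> W f]].

Definition S_U U : lcs ('rV[CC R]_d -> CC R) :=
  ind_lim (\bigcup_(b in [set b : R | 0 < b]) S_b U b)
          [set S_b U b | b in [set b : R | 0 < b]].

Definition open_cone_nbhd K : set (set 'rV[R]_d) :=
  [set U | [/\ open U, cone U & compact_sub K U]].

(* For K = {0} every open cone U satisfies K \Subset U, so the union over U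
   would be the wrong space: the defining formulas are used with U = {0}. *)
Definition S_K K : lcs ('rV[CC R]_d -> CC R) :=
  if `[< K = [set 0] >] then S_U [set 0]
  else ind_lim (\bigcup_(U in open_cone_nbhd K) S_U U)
               [set S_U U | U in open_cone_nbhd K].

End Sbeta.

(* The prod_set U1 U2 need not form a directed family (K1 or K2 may be {0}),
   hence the linear span rather than the union. *)
Definition S_KK (d1 d2 : nat) (beta : R) (nrm : 'rV[R]_(d1 + d2) -> R)
    (K1 : set 'rV[R]_d1) (K2 : set 'rV[R]_d2) :
    lcs ('rV[CC R]_(d1 + d2) -> CC R) :=
  let T := [set E | exists U1 U2, [/\ open_cone_nbhd K1 U1, open_cone_nbhd K2 U2
                       & E = S_U beta nrm (prod_set U1 U2)]] in
  ind_lim (lin_span (\bigcup_(E in T) lcs_car E)) T.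

End Spaces.

Arguments dual {R V} E _.
Arguments dual_restr {R V} E0 E _.

(* Main.v *)
Require Import Defs.
From HB Require Import structures.
From mathcomp Require Import all_boot all_order all_algebra.
From mathcomp Require Import complex.
From mathcomp Require Import separable cyclic cyclotomic.
From mathcomp Require Import ring lra.
From mathcomp Require Import all_classical all_reals all_analysis.
From mathcomp Require Import measurable_realfun.

Set Implicit Arguments.
Unset Strict Implicit.
Unset Printing Implicit Defensive.

Import Order.TTheory GRing.Theory Num.Theory.
Import numFieldNormedType.Exports.

Local Open Scope classical_set_scope.
Local Open Scope complex_scope.
Local Open Scope ring_scope.

(** Why the theorem is true.

    Up to exchanging the factors, a non-exceptional pair has a nonzero vector [x1]
    in [K1] and a vector [x2] outside [K2].  Put [v = (x1, 0)] and [w = (0, x2)].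
    Every open cone surrounding [K1 * K2] contains a neighbourhood of [v], hence
    every sequence of points tending to infinity in the direction of [v], even if
    its distance to the ray of [v] tends to infinity as well.  Such a sequence can
    however drift along [w] and so stay outside a product cone [Us = setT * U2]
    surrounding [K1 * K2], at a distance [dist] of [Us] that tends to infinity
    ([avoiding_cone]).  Functions of [S(Us)] may be as large as [expR dist] on it,
    whereas all functions of [S(K1 * K2)] decrease along it.

    Explicit functions do this.  For a center [p] and a radius [L], let
    [bump L p z = g (z - p) * cosh (sqrt (L ^ 2 - (z - p) ^ 2))], where [(.) ^ 2]
    is the sum of the squares of the coordinates and [g] is a product of entire
    functions of exponential type that are rapidly decreasing on the real axis.
    The identity [Re (sqrt w) ^ 2 = (|w| + Re w) / 2] shows that the second factor
    is bounded by [expR (L + |y|)] everywhere and by [expR (2 * |y|)] as soon as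
    [|x - p| >= 2 * L], while it is about [expR L] at [p]: see [bump_le] and
    [bump_center].  If the ball of radius [2 * L] around [p] is at distance [L] of
    [Us], then [bump L p] is bounded in [S(Us)] up to a power of [1 + |p|].
    Choosing centers [p_k] at distance about [k ^ 2] in the direction of [v] and
    radii [L_k] proportional to [k], the functions [f_k = expR (- c * L_k) * bump
    L_k p_k] ([runaway]) belong to [S(R ^ d)], tend to [0] in [S(Us)], and take
    values about [expR (c' * L_k)] near [p_k].

    The functional [Qfun] integrates over the union of small boxes of [C ^ d]
    around the points [p_k].  It is continuous on [S(U)] for every open cone [U]
    that contains [v], by the Cauchy-Schwarz inequality, but not on [S(Us)],
    because [Qfun f_k] is unbounded.  This separates the dual spaces, and the sum
    of the [f_k], which lies in [S(Us)] but is not square integrable with any of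
    the weights of [S(K1 * K2)], separates the spaces themselves ([separation]).

    Everything is of exponential type, which is the case [beta = 0]; as
    [t <= 1 + t `^ p] for [p >= 1], the same functions serve for all [beta]
    ([sqnorm_bound]).

    Holomorphy of the infinite products and sums involved is obtained from the
    class [approx] of uniform limits on polydiscs of polynomials.  That its members
    are complex differentiable ([approx_entire]) follows from Cauchy's estimates,
    which for polynomials are an averaging over roots of unity ([cauchy_estimate]).
    For the arbitrary entire functions of the spaces, only continuity is used. *)

(** * Modulus of complex numbers and geometric limits *)

Section ComplexModulus.
Variable R : realType.
Local Notation C := (CC R).
Local Notation nc := (@Normc.normc R).
Local Notation Re := (@complex.Re R).
Local Notation Im := (@complex.Im R).
Implicit Types z w : C.

Lemma normcCM z w : nc (z * w) = nc z * nc w.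
Proof. exact: Normc.normcM. Qed.

Lemma normcCD z w : nc (z + w) <= nc z + nc w.
Proof. exact: le_normcD. Qed.

Lemma normcCN z : nc (- z) = nc z.
Proof. exact: normcN. Qed.

Lemma normcC_ge0 z : 0 <= nc z.
Proof. by case: z => a b; rewrite /= sqrtr_ge0. Qed.

Lemma normcC0 : nc 0 = 0. Proof. exact: Normc.normc0. Qed.
Lemma normcC1 : nc 1 = 1. Proof. exact: Normc.normc1. Qed.

Lemma normcCV z : nc z^-1 = (nc z)^-1.
Proof. exact: Normc.normcV. Qed.

Lemma normcCX z n : nc (z ^+ n) = nc z ^+ n.
Proof.
elim: n => [|n IH]; first by rewrite !expr0 normcC1.
by rewrite !exprS normcCM IH.
Qed.

Lemma normcC_eq0 z : nc z = 0 -> z = 0.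
Proof. exact: Normc.eq0_normc. Qed.

Lemma normcCB z w : nc (z - w) <= nc z + nc w.
Proof. by rewrite (le_trans (normcCD _ _))// normcCN. Qed.

Lemma normcC_distC z w : nc (z - w) = nc (w - z).
Proof. by rewrite -normcCN opprB. Qed.

Lemma normcC_sum (I : Type) (r : seq I) (P : pred I) (F : I -> C) :
  nc (\sum_(i <- r | P i) F i) <= \sum_(i <- r | P i) nc (F i).
Proof.
elim/big_ind2: _ => [|x1 x2 y1 y2 h1 h2|//]; first by rewrite normcC0.
by rewrite (le_trans (normcCD _ _))// lerD.
Qed.

Lemma normcC_prod (I : Type) (r : seq I) (P : pred I) (F : I -> C) :
  nc (\prod_(i <- r | P i) F i) = \prod_(i <- r | P i) nc (F i).
Proof.
elim/big_ind2: _ => [|x1 x2 y1 y2 h1 h2|//]; first by rewrite normcC1.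
by rewrite normcCM h1 h2.
Qed.

Lemma normC_normc z : `|z| = real_complex R (nc z).
Proof. by case: z. Qed.

Lemma sqr_normcC (a b : R) : nc (a +i* b) ^+ 2 = a ^+ 2 + b ^+ 2.
Proof. by rewrite /= sqr_sqrtr// addr_ge0// sqr_ge0. Qed.

Lemma normc_real (a : R) : nc (a%:C : C) = `|a|.
Proof. by rewrite /= expr0n addr0 sqrtr_sqr. Qed.

Lemma normc_ge_absRe z : `|Re z| <= nc z.
Proof.
case: z => a b; rewrite -ler_sqr ?nnegrE ?normcC_ge0//.
by rewrite sqr_normcC /= real_normK ?num_real// lerDl sqr_ge0.
Qed.

Lemma normc_ge_absIm z : `|Im z| <= nc z.
Proof.
case: z => a b; rewrite -ler_sqr ?nnegrE ?normcC_ge0//.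
by rewrite sqr_normcC /= real_normK ?num_real// lerDr sqr_ge0.
Qed.

Lemma normc_le_ReIm z : nc z <= `|Re z| + `|Im z|.
Proof.
case: z => a b /=; rewrite -ler_sqr ?nnegrE ?addr_ge0// (sqr_normcC a b).
rewrite sqrrD !real_normK ?num_real// -addrA lerD2l addrC lerDl.
by rewrite mulrn_wge0// mulr_ge0.
Qed.

Lemma normc_natr n : nc n%:R = n%:R.
Proof.
have -> : (n%:R : C) = (n%:R : R)%:C by rewrite rmorph_nat.
by rewrite normc_real ger0_norm.
Qed.

End ComplexModulus.

Section GeometricLimit.
Variable R : realType.
Local Notation C := (CC R).
Local Notation nc := (@Normc.normc R).
Local Notation Re := (@complex.Re R).
Local Notation Im := (@complex.Im R).

Lemma geometric_tail (M : R) (n : nat) :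
  2 * M / 2 ^+ n.+1 = M / 2 ^+ n.
Proof. by rewrite exprS; field; rewrite expf_neq0. Qed.

Lemma geometric_limit_real (u : nat -> R) (M : R) :
  (forall n, `|u n.+1 - u n| <= M / 2 ^+ n) ->
  exists l, forall n, `|l - u n| <= 2 * M / 2 ^+ n.
Proof.
move=> h.
have M0 : 0 <= M by have := h 0; rewrite expr0 divr1; exact: le_trans.
pose lo n := u n - 2 * M / 2 ^+ n; pose hi n := u n + 2 * M / 2 ^+ n.
have loS n : lo n <= lo n.+1.
  rewrite /lo geometric_tail; have := h n; rewrite ler_norml => /andP[h1 h2].
  by rewrite -mulrA; lra.
have hiS n : hi n.+1 <= hi n.
  rewrite /hi geometric_tail; have := h n; rewrite ler_norml => /andP[h1 h2].
  by rewrite -mulrA; lra.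
have loh n : lo n <= hi n.
  by rewrite /lo /hi lerD2l ge0_cp// divr_ge0// ?exprn_ge0// mulr_ge0.
have lomon m k : lo m <= lo (m + k)%N.
  by elim: k => [|k IH]; rewrite ?addn0// addnS (le_trans IH).
have himon m k : hi (m + k)%N <= hi m.
  by elim: k => [|k IH]; rewrite ?addn0// addnS; apply: le_trans IH.
have lohi m n : lo m <= hi n.
  apply: (le_trans (lomon m n)); apply: (le_trans (loh _)).
  by rewrite addnC himon.
exists (sup (range lo)) => n.
rewrite ler_norml; apply/andP; split.
  rewrite lerBrDl -[_ + _]/(lo n); apply: ub_le_sup; last by exists n.
  by exists (hi 0) => _ [m _ <-].
rewrite lerBlDl; apply: ge_sup; first by exists (lo 0), 0.
by move=> _ [m _ <-]; exact: lohi.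
Qed.

Lemma geometric_limit (u : nat -> C) (M : R) :
  (forall n, nc (u n.+1 - u n) <= M / 2 ^+ n) ->
  exists l, forall n, nc (l - u n) <= 4 * M / 2 ^+ n.
Proof.
move=> h.
have ReB z w : Re (z - w) = Re z - Re w by case: z; case: w.
have ImB z w : Im (z - w) = Im z - Im w by case: z; case: w.
have [a ha] : exists a, forall n, `|a - Re (u n)| <= 2 * M / 2 ^+ n.
  apply: geometric_limit_real => n.
  by rewrite -ReB (le_trans (normc_ge_absRe _))// h.
have [b hb] : exists b, forall n, `|b - Im (u n)| <= 2 * M / 2 ^+ n.
  apply: geometric_limit_real => n.
  by rewrite -ImB (le_trans (normc_ge_absIm _))// h.
exists (a +i* b) => n; apply: (le_trans (normc_le_ReIm _)).
have -> : 4 * M / 2 ^+ n = 2 * M / 2 ^+ n + 2 * M / 2 ^+ n by field; rewrite expf_neq0.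
move: (ha n) (hb n); case: (u n) => x y /= *; exact: lerD.
Qed.

End GeometricLimit.

(** * Uniform limits of polynomials *)

Section PolynomialApproximation.
Variables (R : realType) (T I : Type) (crd : I -> T -> CC R).
Local Notation C := (CC R).
Local Notation nc := (@Normc.normc R).

Inductive polyfun : (T -> C) -> Prop :=
| polyfun_cst c : polyfun (fun=> c)
| polyfun_crd i : polyfun (crd i)
| polyfun_add P Q : polyfun P -> polyfun Q -> polyfun (fun z => P z + Q z)
| polyfun_mul P Q : polyfun P -> polyfun Q -> polyfun (fun z => P z * Q z).

Definition polydisc (r : R) (z : T) := forall i, nc (crd i z) <= r.

(** On a complex vector space, with [crd] the coordinate functions, these are the
    entire functions; this form of the definition makes stability under sums,
    products and limits immediate. *)
Definition approx (f : T -> C) := forall r e : R, 0 < e ->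
  exists2 P, polyfun P & forall z, polydisc r z -> nc (f z - P z) <= e.

Lemma polyfun_opp P : polyfun P -> polyfun (fun z => - P z).
Proof.
move=> hP; rewrite (_ : (fun z => _) = fun z => -1 * P z); last first.
  by apply/funext => z; rewrite mulN1r.
exact: polyfun_mul (polyfun_cst _) hP.
Qed.

Lemma polyfun_sum (J : Type) (s : seq J) (F : J -> T -> C) :
  (forall j, polyfun (F j)) -> polyfun (fun z => \sum_(j <- s) F j z).
Proof.
move=> hF; elim: s => [|j s IH].
  rewrite (_ : (fun z => _) = fun=> 0); first exact: polyfun_cst.
  by apply/funext => z; rewrite big_nil.
rewrite (_ : (fun z => _) = fun z => F j z + \sum_(j <- s) F j z).
  exact: polyfun_add.
by apply/funext => z; rewrite big_cons.
Qed.

Lemma polyfun_bounded P : polyfun P ->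
  forall r, exists2 M, 0 <= M & forall z, polydisc r z -> nc (P z) <= M.
Proof.
move=> hP r; elim: hP => [c|i|{}P Q _ [M M0 hM] _ [N N0 hN]|{}P Q _ [M M0 hM] _ [N N0 hN]].
- by exists (nc c) => //; exact: normcC_ge0.
- exists (Num.max 0 r) => [|z hz]; first by rewrite le_max lexx.
  by rewrite le_max (hz i) orbT.
- exists (M + N) => [|z hz]; first exact: addr_ge0.
  by rewrite (le_trans (normcCD _ _))// lerD ?hM ?hN.
- exists (M * N) => [|z hz]; first exact: mulr_ge0.
  by rewrite normcCM ler_pM ?normcC_ge0 ?hM ?hN.
Qed.

Lemma approx_polyfun P : polyfun P -> approx P.
Proof.
by move=> hP r e e0; exists P => // z _; rewrite subrr normcC0 ltW.
Qed.

Lemma approx_bounded f : approx f ->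
  forall r, exists2 M, 0 <= M & forall z, polydisc r z -> nc (f z) <= M.
Proof.
move=> hf r; have [P hP hfP] := hf r 1 ltr01.
have [M M0 hM] := polyfun_bounded hP r; exists (1 + M) => [|z hz].
  by rewrite addr_ge0.
by rewrite -[f z](subrK (P z)) (le_trans (normcCD _ _))// lerD ?hfP ?hM.
Qed.

Lemma approx_add f g : approx f -> approx g -> approx (fun z => f z + g z).
Proof.
move=> hf hg r e e0; have e20 : 0 < e / 2 by rewrite divr_gt0.
have [P hP hfP] := hf r _ e20; have [Q hQ hgQ] := hg r _ e20.
exists (fun z => P z + Q z); first exact: polyfun_add.
move=> z hz; rewrite opprD addrACA (le_trans (normcCD _ _))//.
by rewrite [leRHS]splitr lerD ?hfP ?hgQ.
Qed.

Lemma approx_mul f g : approx f -> approx g -> approx (fun z => f z * g z).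
Proof.
move=> hf hg r e e0.
have [M M0 hM] := approx_bounded hf r; have [N N0 hN] := approx_bounded hg r.
pose d := Num.min 1 (e / (M + N + 1)).
have MN : 0 < M + N + 1 by rewrite ltr_wpDl// addr_ge0.
have d0 : 0 < d by rewrite lt_min ltr01 divr_gt0.
have [P hP hfP] := hf r _ d0; have [Q hQ hgQ] := hg r _ d0.
exists (fun z => P z * Q z); first exact: polyfun_mul.
move=> z hz.
have -> : f z * g z - P z * Q z =
    f z * (g z - Q z) + (f z - P z) * (g z - (g z - Q z)) by ring.
have dMN : d * (M + N + 1) <= e by rewrite -ler_pdivlMr// ge_min lexx orbT.
apply: le_trans dMN; rewrite (le_trans (normcCD _ _))// !normcCM.
have hQ' : nc (g z - (g z - Q z)) <= N + 1.
  rewrite (le_trans (normcCB _ _))// lerD ?hN// (le_trans (hgQ _ hz))//.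
  by rewrite ge_min lexx.
rewrite (_ : d * _ = M * d + d * (N + 1)); last by ring.
by rewrite lerD// ler_pM ?normcC_ge0 ?hM ?hgQ ?hfP.
Qed.

Lemma approx_prod (J : Type) (s : seq J) (F : J -> T -> C) :
  (forall j, approx (F j)) -> approx (fun z => \prod_(j <- s) F j z).
Proof.
move=> hF; elim: s => [|j s IH].
  rewrite (_ : (fun z => _) = fun=> 1); first exact/approx_polyfun/polyfun_cst.
  by apply/funext => z; rewrite big_nil.
rewrite (_ : (fun z => _) = fun z => F j z * \prod_(j <- s) F j z).
  exact: approx_mul.
by apply/funext => z; rewrite big_cons.
Qed.

Lemma approx_sum (J : Type) (s : seq J) (F : J -> T -> C) :
  (forall j, approx (F j)) -> approx (fun z => \sum_(j <- s) F j z).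
Proof.
move=> hF; elim: s => [|j s IH].
  rewrite (_ : (fun z => _) = fun=> 0); first exact/approx_polyfun/polyfun_cst.
  by apply/funext => z; rewrite big_nil.
rewrite (_ : (fun z => _) = fun z => F j z + \sum_(j <- s) F j z).
  exact: approx_add.
by apply/funext => z; rewrite big_cons.
Qed.

Lemma exp2_ge (n : nat) : n%:R <= 2 ^+ n :> R.
Proof. by rewrite -natrX ler_nat ltnW// ltn_expl. Qed.

Lemma approx_limit (f : nat -> T -> C) (g : T -> C) :
  (forall n, approx (f n)) ->
  (forall r, exists M, forall z n, polydisc r z -> nc (g z - f n z) <= M / 2 ^+ n) ->
  approx g.
Proof.
move=> hf hg r e e0; have [M hM] := hg r.
have e20 : 0 < e / 2 by rewrite divr_gt0.
pose n := (Num.truncn (`|M| / (e / 2))).+1.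
have hn : `|M| / 2 ^+ n <= e / 2.
  rewrite ler_pdivrMr ?exprn_gt0// -ler_pdivrMl// mulrC.
  by apply: (le_trans (ltW (truncnS_gt _))); exact: exp2_ge.
have [P hP hfP] := hf n r _ e20; exists P => // z hz.
rewrite -[g z](subrK (f n z)) -addrA (le_trans (normcCD _ _))//.
rewrite [leRHS]splitr lerD ?hfP// (le_trans (hM _ _ hz))//.
by apply: le_trans hn; rewrite ler_pM2r ?ler_norm// invr_gt0 exprn_gt0.
Qed.

(** Besides membership of the limit, the rate of convergence at each point is
    kept, with whatever constant is available there: the bounds on the partial
    products and sums pass to the limit through it. *)
Lemma approx_geometric_limit (f : nat -> T -> C) :
  (forall n, approx (f n)) ->
  (forall z, exists i, forall n, nc (f n.+1 z - f n z) <= i / 2 ^+ n) ->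
  (forall r, exists M, forall z n, polydisc r z ->
     nc (f n.+1 z - f n z) <= M / 2 ^+ n) ->
  exists2 g, approx g & forall z M,
    (forall n, nc (f n.+1 z - f n z) <= M / 2 ^+ n) ->
    forall n, nc (g z - f n z) <= 4 * M / 2 ^+ n.
Proof.
move=> hf hz hr.
have lim z : exists l, forall M, (forall n, nc (f n.+1 z - f n z) <= M / 2 ^+ n) ->
    forall n, nc (l - f n z) <= 4 * M / 2 ^+ n.
  have [M0 hM0] := hz z; have [l hl] := geometric_limit hM0.
  exists l => M hM n; have [l' hl'] := geometric_limit hM.
  suff -> : l = l' by [].
  apply/subr0_eq/normcC_eq0/eqP; rewrite eq_le normcC_ge0 andbT.
  apply/ler_addgt0Pl => e e0; rewrite addr0.
  pose K := `|4 * M0 + 4 * M|.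
  pose m := (Num.truncn (K / e)).+1.
  have hm : K / 2 ^+ m <= e.
    rewrite ler_pdivrMr ?exprn_gt0// -ler_pdivrMl// mulrC.
    by apply: (le_trans (ltW (truncnS_gt _))); exact: exp2_ge.
  apply: le_trans hm.
  rewrite (_ : l - l' = (l - f m z) - (l' - f m z)); last by ring.
  rewrite (le_trans (normcCB _ _))// (le_trans (lerD (hl m) (hl' m)))//.
  by rewrite -mulrDl ler_pM2r ?ler_norm// invr_gt0 exprn_gt0.
pose g z := sval (cid (lim z)); exists g; last first.
  by move=> z M hM; exact: (svalP (cid (lim z))).
apply: (approx_limit hf) => r; have [M hM] := hr r; exists (4 * M) => z n hzr.
by apply: (svalP (cid (lim z))) => k; exact: hM.
Qed.

End PolynomialApproximation.

Section ApproxComp.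
Variables (R : realType) (T I : Type) (crd : I -> T -> CC R).
Local Notation C := (CC R).

Definition coord1 : unit -> C -> C := fun=> id.

Lemma polyfun_comp (p : C -> C) (P : T -> C) :
  polyfun coord1 p -> polyfun crd P -> polyfun crd (fun z => p (P z)).
Proof.
move=> hp hP; elim: hp => [c|i|p1 p2 _ h1 _ h2|p1 p2 _ h1 _ h2].
- exact: polyfun_cst.
- by [].
- exact: polyfun_add h1 h2.
- exact: polyfun_mul h1 h2.
Qed.

Lemma approx_comp (f : C -> C) (P : T -> C) :
  approx coord1 f -> polyfun crd P -> approx crd (fun z => f (P z)).
Proof.
move=> hf hP r e e0; have [M M0 hM] := polyfun_bounded hP r.
have [p hp hfp] := hf M _ e0; exists (fun z => p (P z)); first exact: polyfun_comp.
by move=> z hz; apply: hfp => i; exact: hM.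
Qed.

Lemma polyfun_horner (p : {poly C}) (P : T -> C) :
  polyfun crd P -> polyfun crd (fun z => p.[P z]).
Proof.
move=> hP; elim/poly_ind: p => [|p c IH].
  rewrite (_ : (fun z => _) = fun=> 0); first exact: polyfun_cst.
  by apply/funext => z; rewrite horner0.
rewrite (_ : (fun z => _) = fun z => p.[P z] * P z + c).
  by apply: polyfun_add (polyfun_cst _ _); exact: polyfun_mul.
by apply/funext => z; rewrite hornerMXaddC.
Qed.

End ApproxComp.

(** * Cauchy estimates for polynomials *)

Section CauchyEstimate.
Variable R : realType.
Local Notation C := (CC R).
Local Notation nc := (@Normc.normc R).

Lemma prim_root_exists (n : nat) : (0 < n)%N -> exists z : C, n.-primitive_root z.
Proof.
move=> n0; pose p : {poly C} := 'X^n - 1.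
have [r Dp] := closed_field_poly_normal p.
rewrite (monicP _) ?monicXnsubC // scale1r in Dp.
have rn1 : all n.-unity_root r by apply/allP => z; rewrite -root_prod_XsubC -Dp.
have sz_r : (n < (size r).+1)%N.
  by rewrite -(size_prod_XsubC r id) -Dp size_XnsubC.
have [|z] := hasP (has_prim_root n0 rn1 _ sz_r); last by exists z.
by rewrite -separable_prod_XsubC -Dp separable_Xn_sub_1// pnatr_eq0 -lt0n.
Qed.

(** Orthogonality of the characters of a finite cyclic group. *)
Lemma sum_prim_root (n : nat) (w : C) (j k : nat) : n.-primitive_root w ->
  (j < n)%N -> (k < n)%N ->
  \sum_(i < n) w ^+ (i * j) * (w ^+ (i * k))^-1 = if j == k then n%:R else 0.
Proof.
move=> hw jn kn; have w0 : w != 0.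
  apply/eqP => w0; have := prim_expr_order hw.
  by rewrite w0 expr0n gtn_eqF ?(prim_order_gt0 hw)// => /eqP; rewrite eq_sym oner_eq0.
have [->|jk] := eqVneq j k.
  under eq_bigr do rewrite divff ?expf_neq0//.
  by rewrite sumr_const card_ord.
pose u := w ^+ j / w ^+ k.
have u1 : u != 1.
  apply: contra jk => /eqP h; have /eqP : w ^+ j = w ^+ k.
    by rewrite -[LHS](divfK (expf_neq0 k w0)) -/u h mul1r.
  by rewrite (eq_prim_root_expr hw) !modn_small.
have un : u ^+ n = 1.
  by rewrite exprMn exprVn -!exprM mulnC exprM [(k * n)%N]mulnC exprM (prim_expr_order hw) !expr1n invr1 mulr1.
have : (u - 1) * \sum_(i < n) u ^+ i = 0 by rewrite -subrX1 un subrr.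
move/eqP; rewrite mulf_eq0 subr_eq0 (negbTE u1) /= => /eqP su.
by rewrite -[RHS]su; apply: eq_bigr => i _; rewrite exprMn exprVn -!exprM mulnC [(k * i)%N]mulnC.
Qed.

(** Averaging [p.[w ^+ i] / w ^+ (i * k)] over the powers of a root of unity [w] of
    order larger than the degree isolates the coefficient of index [k]; this
    replaces the Cauchy integral over the unit circle. *)
Lemma cauchy_estimate (p : {poly C}) (M : R) :
  (forall t, nc t <= 1 -> nc p.[t] <= M) -> forall k, nc p`_k <= M.
Proof.
move=> hM k.
pose n := (size p + k).+1.
have [w hw] := @prim_root_exists n isT.
have kn : (k < n)%N by rewrite ltnS leq_addl.
have n0 : (n%:R : C) != 0 by rewrite pnatr_eq0.
have w1 : nc w = 1.
  have : nc w ^+ n = 1 by rewrite -normcCX (prim_expr_order hw) normcC1.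
  by move/eqP; rewrite pexpr_eq1 ?normcC_ge0// => /eqP.
have : \sum_(i < n) p.[w ^+ i] * (w ^+ (i * k))^-1 = n%:R * p`_k.
  have np : (size p <= n)%N by rewrite /n -addnS leq_addr.
  under eq_bigr => i _.
    rewrite (horner_coef_wide _ np) mulr_suml.
    under eq_bigr do rewrite -exprM -mulrA.
    over.
  rewrite exchange_big /=.
  under eq_bigr => j _ do rewrite -mulr_sumr (sum_prim_root hw)//.
  rewrite (bigD1 (Ordinal kn))//= eqxx mulrC big1 ?addr0// => j jk.
  by rewrite (_ : (j == k :> nat) = false) ?mulr0//; apply/negbTE.
move/(congr1 nc); rewrite normcCM normc_natr => h.
rewrite -(ler_pM2l (ltr0Sn R (size p + k))) -/n -h.
rewrite (le_trans (normcC_sum _ _ _))//.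
rewrite (_ : n%:R * M = \sum_(i < n) M); last by rewrite sumr_const card_ord mulr_natl.
apply: ler_sum => i _.
rewrite normcCM normcCV !normcCX w1 expr1n invr1 mulr1.
by apply: hM; rewrite normcCX w1 expr1n.
Qed.

Lemma taylor2_poly (p : {poly C}) (M : R) :
  (forall t, nc t <= 1 -> nc p.[t] <= M) ->
  forall t, nc t <= 1 / 2 -> nc (p.[t] - p`_0 - p`_1 * t) <= 2 * M * nc t ^+ 2.
Proof.
move=> hM t ht.
have cM := cauchy_estimate hM.
have M0 : 0 <= M := le_trans (normcC_ge0 _) (cM 0).
have np : (size p <= (size p).+2)%N by rewrite ltnW.
rewrite (horner_coef_wide _ np) 2!big_ord_recl /= expr0 mulr1 expr1.
rewrite (_ : _ - _ = \sum_(i < size p) p`_(i.+2) * t ^+ i.+2); last first.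
  by rewrite /bump /=; ring.
rewrite (le_trans (normcC_sum _ _ _))//.
have sumhalf n : \sum_(i < n) (1 / 2 : R) ^+ i <= 2.
  have : (1 / 2 - 1) * \sum_(i < n) (1 / 2 : R) ^+ i <= 0.
    by rewrite mulr_le0_ge0// ?sumr_ge0//; lra.
  rewrite -subrX1 => _; have : (1 / 2 : R) ^+ n - 1 = (1 / 2 - 1) * \sum_(i < n) (1 / 2 : R) ^+ i := subrX1 _ _.
  have : 0 <= (1 / 2 : R) ^+ n by exact: exprn_ge0.
  by lra.
apply: (@le_trans _ _ (\sum_(i < size p) M * nc t ^+ 2 * (1 / 2) ^+ i)).
  apply: ler_sum => i _; rewrite normcCM normcCX -addn2 exprD mulrA.
  rewrite [leRHS]mulrAC ler_wpM2r ?exprn_ge0 ?normcC_ge0//.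
  by rewrite ler_pM ?exprn_ge0 ?normcC_ge0// lerXn2r ?nnegrE ?normcC_ge0.
rewrite -mulr_sumr (_ : 2 * M * _ = M * nc t ^+ 2 * 2); last by ring.
by rewrite ler_wpM2l// mulr_ge0// exprn_ge0// normcC_ge0.
Qed.

End CauchyEstimate.

(** * Uniform limits of polynomials are entire *)

Section QuadraticRemainder.
Variables (K : numFieldType) (V W : normedModType K).

Lemma differentiable_quadratic (f : V -> W) (df : {linear V -> W}) (x : V) (M d : K) :
  continuous df -> 0 <= M -> 0 < d ->
  (forall h, `|h| <= d -> `|f (x + h) - f x - df h| <= M * `|h| ^+ 2) ->
  differentiable f x.
Proof.
move=> cdf M0 d0 hM.
have fo : f \o shift x = cst (f x) + df +o_ 0 id.
  apply/eqaddoP => e e0; near=> h.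
  have -> : (f \o shift x - (cst (f x) + df)) h = f (x + h) - f x - df h.
    rewrite -[LHS]/(f (h + x) - (f x + df h)) opprD addrA.
    by rewrite [h + x]addrC.
  apply: (le_trans (hM _ _)); first by near: h; exact: nbhs0_le.
  rewrite expr2 mulrA ler_wpM2r//.
  apply: (@le_trans _ _ ((M + 1) * `|h|)); first by rewrite ler_wpM2r// lerDl.
  rewrite -ler_pdivlMl ?ltr_wpDl//.
  by near: h; apply: nbhs0_le; rewrite mulr_gt0// invr_gt0 ltr_wpDl.
have dE : 'd f x = df :> (V -> W) by exact: diff_unique.
by apply/diff_locallyP; rewrite dE.
Unshelve. all: by end_near. Qed.

End QuadraticRemainder.

Section ApproxEntire.
Variables (R : realType) (d : nat).
Local Notation C := (CC R).
Local Notation nc := (@Normc.normc R).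
Local Notation V := 'rV[C]_d.

Definition coordv (j : 'I_d) (z : V) : C := z ord0 j.

Definition dotc (c : 'I_d -> C) (v : V) : C := \sum_j v ord0 j * c j.

Fact dotc_linear c : linear (dotc c).
Proof.
move=> a u v; rewrite /dotc scaler_sumr -big_split; apply: eq_bigr => j _.
by rewrite !mxE mulrDl -mulrA.
Qed.

HB.instance Definition _ c :=
  @GRing.isLinear.Build C V C *%R (dotc c) (dotc_linear c).

Lemma dotc_continuous c : continuous (dotc c).
Proof.
apply: continuous_big => [|j _]; first exact: add_continuous.
move=> v.
apply: (@continuousM C V); first exact: coord_continuous.
exact: cst_continuous.
Qed.

(** The modulus of the sup norm of a complex vector, as a real number. *)
Definition rnorm (v : V) : R := complex.Re (`|v| : C).

Lemma rnormE v : (`|v| : C) = real_complex R (rnorm v).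
Proof.
have : (0 : R[i]) <= (`|v| : C) by exact: normr_ge0.
rewrite /rnorm; case: (`|v| : C) => a b.
by rewrite lecE => /andP[/eqP /= -> _].
Qed.

Lemma rnorm_ge0 v : 0 <= rnorm v.
Proof. by rewrite -lecR -rnormE; exact: normr_ge0. Qed.

Lemma rnorm_coord (v : V) j : nc (v ord0 j) <= rnorm v.
Proof.
have := le_bigmax 0%:nng (fun i : 'I_1 * 'I_d => `|v i.1 i.2|%:nng) (ord0, j).
by move=> h; rewrite -lecR -rnormE; exact: h.
Qed.

(** Besides being polynomial along each complex line, a polynomial function has a
    first order coefficient that is linear in the direction of the line: this
    is where its differential comes from. *)
Lemma polyfun_line (P : V -> C) : polyfun coordv P -> forall z, exists c : 'I_d -> C,
  forall v, exists p : {poly C}, [/\ forall t, P (z + t *: v) = p.[t],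
    p`_0 = P z & p`_1 = dotc c v].
Proof.
move=> hP z; elim: hP => [a|i|{}P Q _ [b hb] _ [c hc]|{}P Q _ [b hb] _ [c hc]].
- exists (fun=> 0) => v; exists a%:P; split => [t||]; rewrite ?hornerC ?coefC//.
  by rewrite /dotc big1// => j _; rewrite mulr0.
- exists (fun j => (j == i)%:R) => v; exists (v ord0 i *: 'X + (z ord0 i)%:P); split.
  + by move=> t; rewrite !hornerE /coordv !mxE; ring.
  + by rewrite coefD coefZ coefX coefC/= mulr0 add0r.
  + rewrite coefD coefZ coefX coefC/= mulr1 addr0 /dotc (bigD1 i)//= eqxx mulr1.
    by rewrite big1 ?addr0// => j /negbTE ->; rewrite mulr0.
- exists (fun j => b j + c j) => v; have [p [p1 p2 p3]] := hb v.
  have [q [q1 q2 q3]] := hc v; exists (p + q); split.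
  + by move=> t; rewrite hornerD p1 q1.
  + by rewrite coefD p2 q2.
  + rewrite coefD p3 q3 /dotc -big_split; apply: eq_bigr => j _.
    by rewrite mulrDr.
- exists (fun j => P z * c j + b j * Q z) => v; have [p [p1 p2 p3]] := hb v.
  have [q [q1 q2 q3]] := hc v; exists (p * q); split.
  + by move=> t; rewrite hornerM p1 q1.
  + by rewrite coefM big_ord_recl big_ord0 addr0 /= p2 q2.
  + rewrite coefM 2!big_ord_recl big_ord0 addr0 /= /bump/= subnn subn0 p2 q2 p3 q3.
    rewrite /dotc mulr_sumr mulr_suml -big_split; apply: eq_bigr => j _ /=.
    by ring.
Qed.

Lemma line_polydisc (z v : V) (t : C) (r s : R) : rnorm z <= r -> rnorm v <= 1 ->
  nc t <= s -> polydisc coordv (r + s) (z + t *: v).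
Proof.
move=> zr v1 ts i; rewrite /coordv !mxE (le_trans (normcCD _ _))// lerD//.
  exact: le_trans (rnorm_coord z i) zr.
rewrite normcCM -[s]mulr1 ler_pM ?normcC_ge0//.
exact: le_trans (rnorm_coord v i) v1.
Qed.

Lemma rnormZ (a : C) (v : V) : rnorm (a *: v) = nc a * rnorm v.
Proof.
apply: (@complexI R); rewrite -rnormE mx_normZ rnormE.
by rewrite [`|a|]normC_normc -rmorphM.
Qed.

(** Cauchy's estimates on complex lines bound the first order coefficient and
    the second order remainder of the approximating polynomials uniformly. *)
Lemma approx_entire (f : V -> C) : approx coordv f -> entire f.
Proof.
move=> hf z; pose r := rnorm z + 1.
have hP n : exists P, polyfun coordv P /\
    forall y, polydisc coordv r y -> nc (f y - P y) <= 1 / 2 ^+ n.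
  have [P P1 P2] := hf r (1 / 2 ^+ n) (divr_gt0 ltr01 (exprn_gt0 _ (ltr0Sn _ _))).
  by exists P.
pose P n := sval (cid (hP n)).
have pP n : polyfun coordv (P n) by have [] := svalP (cid (hP n)).
have PE n y : polydisc coordv r y -> nc (f y - P n y) <= 1 / 2 ^+ n.
  by have [_] := svalP (cid (hP n)); apply.
pose c n := sval (cid (polyfun_line (pP n) z)).
have cP n v : exists p : {poly C}, [/\ forall t, P n (z + t *: v) = p.[t],
    p`_0 = P n z & p`_1 = dotc (c n) v].
  exact: (svalP (cid (polyfun_line (pP n) z))).
have ball1 v t : rnorm v <= 1 -> nc t <= 1 -> polydisc coordv r (z + t *: v).
  by move=> v1 t1; exact: line_polydisc.
have rdelta j : rnorm (delta_mx ord0 j) <= 1.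
  rewrite -lecR -rnormE [leLHS](_ : _ = mx_norm (delta_mx ord0 j : V))//.
  have [->|] := eqVneq (mx_norm (delta_mx ord0 j : V)) 0; first exact: ler01.
  move=> /mx_norm_neq0[[a b] ->]; rewrite /= mxE.
  by case: (_ && _); rewrite ?normr1 ?normr0 ?ler01.
have cC j n : nc (c n.+1 j - c n j) <= 2 / 2 ^+ n.
  have [p [p1 p2 p3]] := cP n (delta_mx ord0 j).
  have [q [q1 q2 q3]] := cP n.+1 (delta_mx ord0 j).
  have dd b : dotc b (delta_mx ord0 j) = b j.
    rewrite /dotc (bigD1 j)//= mxE !eqxx mul1r big1 ?addr0// => i ij.
    by rewrite mxE (negbTE ij) mul0r.
  rewrite -!dd -p3 -q3 -coefB; apply: cauchy_estimate => t t1.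
  rewrite hornerD hornerN -p1 -q1; set y := (z + _).
  have hy : polydisc coordv r y by exact: ball1.
  rewrite (_ : _ - _ = (f y - P n y) - (f y - P n.+1 y)); last by ring.
  rewrite (le_trans (normcCB _ _))// (le_trans (lerD (PE _ _ hy) (PE _ _ hy)))//.
  rewrite (_ : 2 / _ = 1 / 2 ^+ n + 1 / 2 ^+ n); last by ring.
  rewrite lerD2l exprS invfM mulrCA.
  by rewrite ler_piMl ?divr_ge0 ?exprn_ge0// invf_le1// ler1n.
pose a j := sval (cid (geometric_limit (cC j))).
have aE j n : nc (a j - c n j) <= 8 / 2 ^+ n.
  rewrite (_ : 8 = 4 * 2); first exact: (svalP (cid (geometric_limit (cC j)))).
  by rewrite -natrM.
have [M M0 fM] := approx_bounded hf r.
have rem v : rnorm v <= 1 / 2 ->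
    nc (f (z + v) - f z - dotc a v) <= 2 * (M + 1) * rnorm v ^+ 2.
  move=> v2; have v1 : rnorm v <= 1 by apply: (le_trans v2); lra.
  apply/ler_addgt0Pr => e e0.
  pose K := 2 + d%:R * 8 : R.
  pose n := (Num.truncn (K / e)).+1.
  have hn : K / 2 ^+ n <= e.
    rewrite ler_pdivrMr ?exprn_gt0// mulrC -ler_pdivrMr//.
    by apply: (le_trans (ltW (truncnS_gt _))); exact: exp2_ge.
  have hz : polydisc coordv r z.
    by rewrite -[z]addr0 -(scale0r v); apply: ball1 => //; rewrite normcC0.
  have hzv : polydisc coordv r (z + v).
    by rewrite -[v]scale1r; apply: ball1 => //; rewrite normcC1.
  have hPn : nc (P n (z + v) - P n z - dotc (c n) v) <= 2 * (M + 1) * rnorm v ^+ 2.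
    have [v0|v0] := eqVneq (rnorm v) 0.
      have -> : v = 0.
        by apply/eqP; rewrite -normr_eq0 rnormE v0.
      rewrite addr0 subrr linear0 subr0 normcC0 mulr_ge0 ?sqr_ge0//.
      by rewrite mulr_ge0// addr_ge0.
    pose u := (real_complex R (rnorm v))^-1 *: v.
    have rv0 : real_complex R (rnorm v) != 0.
      by apply: contra v0 => /eqP[/eqP].
    have vE : v = real_complex R (rnorm v) *: u by rewrite scalerA divff// scale1r.
    have nrv : nc (real_complex R (rnorm v)) = rnorm v.
      by rewrite normc_real ger0_norm// rnorm_ge0.
    have u1 : rnorm u = 1 by rewrite rnormZ normcCV nrv mulVf.
    have [p [p1 p2 p3]] := cP n u.
    have dZ : dotc (c n) v = p`_1 * real_complex R (rnorm v).
      by rewrite {1}vE p3 mulrC; exact: linearZ.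
    rewrite dZ [in P n (z + v)]vE p1 -p2 -[X in _ * X ^+ 2]nrv.
    apply: taylor2_poly; last by rewrite nrv.
    move=> t t1; rewrite -p1; set y := (z + _).
    have hy : polydisc coordv r y by apply: ball1 => //; rewrite u1.
    rewrite -[P n y](subKr (f y)) (le_trans (normcCB _ _))// lerD ?fM//.
    rewrite (le_trans (PE _ _ hy))// ler_pdivrMr ?exprn_gt0// mul1r.
    by rewrite exprn_ege1// ler1n.
  have da : nc (dotc a v - dotc (c n) v) <= d%:R * (8 / 2 ^+ n).
    rewrite /dotc -sumrB (le_trans (normcC_sum _ _ _))//.
    rewrite -[d in d%:R]card_ord -sumr_const mulr_suml; apply: ler_sum => j _.
    rewrite -mulrBr normcCM ler_pM ?normcC_ge0//.
    exact: le_trans (rnorm_coord v j) v1.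
  rewrite (_ : _ - dotc a v = (P n (z + v) - P n z - dotc (c n) v) +
     ((f (z + v) - P n (z + v)) - (f z - P n z) - (dotc a v - dotc (c n) v))); last by ring.
  rewrite (le_trans (normcCD _ _))// lerD//; apply: le_trans hn.
  rewrite (le_trans (normcCB _ _))// /K mulrDl -mulrA lerD//.
  rewrite (le_trans (normcCB _ _))// (_ : 2 / _ = 1 / 2 ^+ n + 1 / 2 ^+ n); last by ring.
  by rewrite lerD// PE.
apply: (@differentiable_quadratic C V C f (dotc a) z
  (real_complex R (2 * (M + 1))) (real_complex R (1 / 2))).
- exact: dotc_continuous.
- by rewrite -[0]/(real_complex R 0) lecR mulr_ge0// addr_ge0.
- by rewrite -[0]/(real_complex R 0) ltcR divr_gt0.
- move=> h; rewrite rnormE lecR => /rem hh.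
  by rewrite [leLHS]normC_normc -rmorphXn -rmorphM lecR.
Qed.

End ApproxEntire.

(** * The complex exponential *)

Section RealBounds.
Variable R : realType.
Implicit Types a b : R.

Lemma norm_sin_le b : `|sin b| <= `|b|.
Proof.
wlog b0 : b / 0 <= b => [h|].
  have [/h//|/ltW b0] := leP 0 b.
  by rewrite -normrN -sinN -[leRHS]normrN h// oppr_ge0.
have [c _ h] := MVT_segment (df := cos) b0 (fun x _ => is_derive_sin x)
  (continuous_subspaceT (@continuous_sin R)).
have -> : sin b = cos c * b by move: h; rewrite sin0 !subr0.
by rewrite normrM ler_piMl// cos_max.
Qed.

Lemma one_sub_cosE b : 1 - cos b = 2 * sin (b / 2) ^+ 2.
Proof.
have -> : cos b = cos (b / 2 *+ 2) by congr cos; rewrite mulr2n -splitr.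
by rewrite cos_mulr2n cos2sin2 mulr2n; ring.
Qed.

Lemma norm_one_sub_cos b : `|1 - cos b| <= b ^+ 2.
Proof.
rewrite one_sub_cosE normrM ger0_norm// ger0_norm ?sqr_ge0//.
have := norm_sin_le (b / 2); rewrite -ler_sqr ?nnegrE// !real_normK ?num_real//.
have -> : (b / 2) ^+ 2 = b ^+ 2 / 4 by field.
by have := sqr_ge0 b; lra.
Qed.

Lemma norm_sin_sub b : `|sin b - b| <= b ^+ 2.
Proof.
wlog b0 : b / 0 <= b => [h|].
  have [/h//|/ltW b0] := leP 0 b.
  by rewrite -normrN opprB -[b ^+ 2]sqrrN addrC -sinN -[X in sin _ + X]opprK h// oppr_ge0.
have [c /andP[c0 cb] h] := MVT_segment (df := cos) b0 (fun x _ => is_derive_sin x)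
  (continuous_subspaceT (@continuous_sin R)).
move: c0 cb; rewrite !bnd_simp => c0 cb.
have -> : sin b - b = (cos c - 1) * b.
  by move: h; rewrite sin0 !subr0 => ->; ring.
rewrite normrM expr2 (ger0_norm b0) distrC ger0_norm; last first.
  by rewrite one_sub_cosE mulr_ge0// sqr_ge0.
rewrite ler_wpM2r// one_sub_cosE.
have := norm_sin_le (c / 2); rewrite [`|c / 2|]ger0_norm ?divr_ge0// => hs.
have := sin_max (c / 2); rewrite -[sin _ ^+ 2]real_normK ?num_real//.
have := normr_ge0 (sin (c / 2)); move: hs; set s := `|_| => hs s0 s1.
by rewrite expr2; nra.
Qed.

Lemma norm_expR_sub1 a : `|expR a - 1| <= `|a| * expR `|a|.
Proof.
have h1 := expR_ge1Dx a; have h2 := expR_ge1Dx (- a).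
have e0 := expR_gt0 a; have ee : expR a * expR (- a) = 1 := expRxMexpNx_1 a.
have [a0|a0] := leP 0 a.
  rewrite ger0_norm; last by lra.
  by rewrite ger0_norm//; nra.
rewrite ler0_norm; last by rewrite subr_le0 expR_le1 ltW.
by rewrite ltr0_norm//; nra.
Qed.

Lemma norm_expR_sub1D a : `|expR a - 1 - a| <= a ^+ 2 * expR `|a|.
Proof.
have h1 := expR_ge1Dx a; have h2 := expR_ge1Dx (- a).
rewrite ger0_norm; last by lra.
have e0 := expR_gt0 a; have ee : expR a * expR (- a) = 1 := expRxMexpNx_1 a.
apply: (@le_trans _ _ (a * (expR a - 1))); first by nra.
apply: (le_trans (ler_norm _)); rewrite normrM -[a ^+ 2]real_normK ?num_real//.
by rewrite expr2 -mulrA ler_wpM2l// norm_expR_sub1.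
Qed.

End RealBounds.

Section ComplexExponential.
Variable R : realType.
Local Notation C := (CC R).
Local Notation nc := (@Normc.normc R).
Local Notation Re := (@complex.Re R).
Local Notation Im := (@complex.Im R).
Implicit Types z w : C.

Definition cexp (z : C) : C :=
  (expR (Re z) * cos (Im z)) +i* (expR (Re z) * sin (Im z)).

Lemma cexpD z w : cexp (z + w) = cexp z * cexp w.
Proof.
case: z w => a b [c e]; rewrite /cexp /= expRD cosD sinD.
have mulE (x y x' y' : R) : (x +i* y : C) * (x' +i* y' : C) =
  (x * x' - y * y') +i* (x * y' + y * x') by [].
by rewrite mulE; congr (_ +i* _); ring.
Qed.

Lemma cexp0 : cexp 0 = 1.
Proof. by rewrite /cexp /= expR0 cos0 sin0 mulr1 mulr0. Qed.

Lemma normc_cexp z : nc (cexp z) = expR (Re z).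
Proof.
rewrite /cexp /= !exprMn -mulrDr cos2Dsin2 mulr1 sqrtr_sqr ger0_norm//.
Qed.

Lemma cexpX z n : cexp z ^+ n = cexp (n%:R * z).
Proof.
elim: n => [|n IH]; first by rewrite mul0r cexp0.
by rewrite exprS IH -cexpD -natr1 mulrDl mul1r addrC.
Qed.

Lemma le_expR_normc z : expR `|Re z| <= expR (nc z).
Proof. by rewrite ler_expR normc_ge_absRe. Qed.

Lemma cexp_taylor1 z : nc (cexp z - 1 - z) <= 3 * nc z ^+ 2 * expR (nc z).
Proof.
apply: (@le_trans _ _ (3 * nc z ^+ 2 * expR `|Re z|)); last first.
  by rewrite ler_wpM2l ?le_expR_normc// mulr_ge0// sqr_ge0.
apply: (le_trans (normc_le_ReIm _)).
case: z => a b; rewrite (sqr_normcC a b) /=.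
have -> : expR a * cos b - 1 - a = (expR a - 1 - a) - expR a * (1 - cos b) by ring.
have -> : expR a * sin b - 0 - b = (expR a - 1) * sin b + (sin b - b) by ring.
have e1 : 1 <= expR `|a| by rewrite -[leLHS]expR0 ler_expR.
have e2 : expR a <= expR `|a| by rewrite ler_expR ler_norm.
have h1 : `|expR a - 1 - a - expR a * (1 - cos b)| <= (a ^+ 2 + b ^+ 2) * expR `|a|.
  rewrite (le_trans (ler_normB _ _))// mulrDl lerD ?norm_expR_sub1D//.
  rewrite normrM (ger0_norm (expR_ge0 a)) mulrC.
  by rewrite ler_pM ?expR_ge0// norm_one_sub_cos.
have h2 : `|(expR a - 1) * sin b + (sin b - b)| <= (`|a| * `|b| + b ^+ 2) * expR `|a|.
  rewrite (le_trans (ler_normD _ _))// [leRHS]mulrDl lerD//.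
    by rewrite normrM mulrAC ler_pM ?norm_expR_sub1 ?norm_sin_le.
  by rewrite (le_trans (norm_sin_sub _))// ler_peMr ?sqr_ge0.
apply: (le_trans (lerD h1 h2)).
rewrite -mulrDl ler_wpM2r ?expR_ge0//.
rewrite -[a ^+ 2]real_normK ?num_real// -[b ^+ 2]real_normK ?num_real//.
by have := sqr_ge0 (`|a| - `|b|); nra.
Qed.

Lemma cexp_sub1 z : nc (cexp z - 1) <= nc z + 3 * nc z ^+ 2 * expR (nc z).
Proof.
rewrite -[cexp z - 1](subrK z) addrC (le_trans (normcCD _ _))// lerD2l.
exact: cexp_taylor1.
Qed.

Lemma normc_subX (x y : C) (m : R) n : nc x <= m -> nc y <= m ->
  nc (x ^+ n.+1 - y ^+ n.+1) <= n.+1%:R * nc (x - y) * m ^+ n.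
Proof.
move=> hx hy; rewrite subrXX normcCM [n.+1%:R * _]mulrC -mulrA.
rewrite ler_wpM2l ?normcC_ge0// (le_trans (normcC_sum _ _ _))//.
rewrite mulr_natl -[X in _ *+ X]card_ord -sumr_const ler_sum// => i _.
rewrite normcCM !normcCX (_ : m ^+ n = m ^+ (n.+1.-1 - i) * m ^+ i); last first.
  by rewrite -exprD /= subnK// -ltnS.
rewrite ler_pM ?exprn_ge0 ?normcC_ge0//; apply: lerXn2r => //;
  by rewrite ?nnegrE ?normcC_ge0// (le_trans _ hx)// normcC_ge0.
Qed.

(** [cexp z] is the [n]-th power of [cexp (z / n)], which differs from
    [1 + z / n] by a multiple of [1 / n ^+ 2]; telescoping the difference of the
    [n]-th powers costs one factor [n]. *)
Lemma cexp_approx z n :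
  nc (cexp z - (1 + z / n.+1%:R) ^+ n.+1) <= 3 * nc z ^+ 2 * expR (nc z) / n.+1%:R.
Proof.
set k := n.+1%:R : C; have k0 : k != 0 by rewrite pnatr_eq0.
set r := n.+1%:R : R; have r0 : 0 < r by rewrite ltr0Sn.
have kr : nc k = r by rewrite /k normc_natr.
have zE : cexp z = cexp (z / k) ^+ n.+1 by rewrite cexpX mulrC divfK.
have nz : nc (z / k) = nc z / r by rewrite normcCM normcCV kr.
pose m := expR (nc z / r).
have h1 : nc (cexp (z / k)) <= m.
  by rewrite normc_cexp ler_expR -nz (le_trans (ler_norm _))// normc_ge_absRe.
have h2 : nc (1 + z / k) <= m.
  by rewrite (le_trans (normcCD _ _))// normcC1 nz expR_ge1Dx.
rewrite {1}zE (le_trans (normc_subX n h1 h2))//.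
have -> : cexp (z / k) - (1 + z / k) = cexp (z / k) - 1 - z / k by ring.
apply: (@le_trans _ _ (r * (3 * nc (z / k) ^+ 2 * m) * m ^+ n)).
  rewrite ler_wpM2r ?exprn_ge0 ?expR_ge0// (ler_wpM2l (ltW r0))//.
  by rewrite /m -nz cexp_taylor1.
rewrite nz (_ : _ * m ^+ n = 3 * (nc z) ^+ 2 * m ^+ n.+1 / r); last first.
  have aux (q x y t : R) : q != 0 ->
    q * (3 * (x / q) ^+ 2 * y) * t = 3 * x ^+ 2 * (y * t) / q by move=> ?; field.
  by rewrite [m ^+ n.+1]exprS aux ?gt_eqF.
by rewrite /m -expRM_natr divfK// gt_eqF.
Qed.

(** Splitting into even and odd powers gives polynomial approximations of
    [cosh (sqrt w)] and of [sinh (sqrt w) / sqrt w]. *)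
Lemma even_odd_pow (c : C) n : exists A B : {poly C},
  [/\ forall z, (1 + c * z) ^+ n = A.[z ^+ 2] + z * B.[z ^+ 2],
    A.[0] = 1 & B.[0] = n%:R * c].
Proof.
elim: n => [|n [A [B [hAB A0 B0]]]].
  exists 1, 0; split=> [z||]; rewrite ?hornerC ?mul0r//.
  by rewrite mulr0 addr0.
exists (A + c *: ('X * B)), (c *: A + B); split=> [z||].
- by rewrite exprS hAB !(hornerD, hornerZ, hornerM, hornerX); ring.
- by rewrite !(hornerD, hornerZ, hornerM, hornerX) A0 mul0r mulr0 addr0.
- by rewrite !(hornerD, hornerZ, hornerM, hornerX) A0 B0 -natr1; ring.
Qed.

End ComplexExponential.

(** * The entire functions cosh (sqrt w) and sin u / u *)

Section CoshSqrtSinc.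
Variable R : realType.
Local Notation C := (CC R).
Local Notation nc := (@Normc.normc R).
Local Notation Re := (@complex.Re R).
Local Notation Im := (@complex.Im R).
Local Notation ii := (0 +i* 1 : C).
Implicit Types z w u : C.

Definition ccosh z : C := (cexp z + cexp (- z)) / 2.

(** Any square root will do, since [ccosh] is even ([coshsqrtE]). *)
Definition coshsqrt w : C := ccosh (sqrtC w).

Lemma ccoshN z : ccosh (- z) = ccosh z.
Proof. by rewrite /ccosh opprK addrC. Qed.

Lemma coshsqrtE w z : z ^+ 2 = w -> coshsqrt w = ccosh z.
Proof.
move=> zw; have /eqP : sqrtC w ^+ 2 = z ^+ 2 by rewrite sqrtCK zw.
by rewrite eqf_sqr /coshsqrt => /orP[/eqP ->|/eqP ->]; rewrite ?ccoshN.
Qed.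

Lemma normc_ccosh z : nc (ccosh z) <= expR `|Re z|.
Proof.
have ReN : Re (- z) = - Re z by case: z.
rewrite /ccosh normcCM normcCV normc_natr ler_pdivrMr//.
rewrite (le_trans (normcCD _ _))// !normc_cexp ReN mulr_natr mulr2n.
by rewrite lerD// ler_expR ?ler_norm// -normrN ler_norm.
Qed.

(** The even part in [z] of [(1 + z / n) ^+ n] is a polynomial in [z ^+ 2], and
    converges to [ccosh z] at the rate given by [cexp_approx]. *)
Lemma coshsqrt_approx : approx (@coord1 R) coshsqrt.
Proof.
move=> r e e0.
have [r0|r0] := ltP r 0.
  exists (fun=> 0); first exact: polyfun_cst.
  by move=> z /(_ tt) h; have := normcC_ge0 z; rewrite leNgt (le_lt_trans h).
pose K := 3 * r * expR (r + 1).
pose n := Num.truncn (K / e).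
have hn : K / n.+1%:R <= e.
  by rewrite ler_pdivrMr// mulrC -ler_pdivrMr//; exact: ltW (truncnS_gt _).
have [A [B [AB _ B0]]] := even_odd_pow (n.+1%:R^-1 : C) n.+1.
exists (fun z => A.[z]); first by apply: (@polyfun_horner R C unit (@coord1 R)); exact: (polyfun_crd _ tt).
move=> w /(_ tt); rewrite /coord1 => hw.
pose z := sqrtC w; have zw : z ^+ 2 = w by rewrite sqrtCK.
have nz : nc z ^+ 2 <= r by rewrite -normcCX zw.
have nz1 : nc z <= r + 1 by have := sqr_ge0 (nc z - 1); nra.
rewrite (coshsqrtE zw) -zw.
have hA : A.[z ^+ 2] = ((1 + z / n.+1%:R) ^+ n.+1 + (1 + (- z) / n.+1%:R) ^+ n.+1) / 2.
  by rewrite ![_ / n.+1%:R]mulrC !AB sqrrN; field.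
rewrite hA /ccosh.
rewrite (_ : _ - _ = ((cexp z - (1 + z / n.+1%:R) ^+ n.+1) +
   (cexp (- z) - (1 + (- z) / n.+1%:R) ^+ n.+1)) / 2); last by ring.
rewrite normcCM normcCV normc_natr ler_pdivrMr// mulr_natr mulr2n.
have hK : 3 * nc z ^+ 2 * expR (nc z) / n.+1%:R <= e.
  apply: le_trans hn; rewrite ler_wpM2r// ler_pM ?expR_ge0 ?ler_expR//.
    by rewrite mulr_ge0// sqr_ge0.
  by rewrite ler_wpM2l.
rewrite (le_trans (normcCD _ _))// lerD// (le_trans (cexp_approx _ _))//.
by rewrite normcCN.
Qed.

Definition csin z : C := (cexp (ii * z) - cexp (- (ii * z))) / (2 * ii).

Definition sinc u : C := if u == 0 then 1 else csin u / u.

Lemma ii_neq0 : ii != 0.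
Proof. by rewrite eq_complex /= oner_eq0 andbF. Qed.

Lemma sqr_ii : ii ^+ 2 = -1.
Proof. exact: sqr_i. Qed.

Lemma normc_ii : nc ii = 1.
Proof. by rewrite /= expr0n add0r expr1n sqrtr1. Qed.

Lemma Re_ii z : Re (ii * z) = - Im z.
Proof. by case: z => a b /=; rewrite mul0r mul1r sub0r. Qed.

Lemma normc_csin z : nc (csin z) <= expR `|Im z|.
Proof.
have ReN : Re (- (ii * z)) = Im z.
  by case: z => a b /=; rewrite mul0r mul1r sub0r opprK.
rewrite /csin normcCM normcCV normcCM normc_natr normc_ii mulr1 ler_pdivrMr//.
rewrite (le_trans (normcCB _ _))// !normc_cexp ReN Re_ii mulr_natr mulr2n.
by rewrite lerD// ler_expR ?ler_norm// -normrN ler_norm.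
Qed.

Lemma csin_double z : csin (2 * z) = 2 * csin z * ccosh (ii * z).
Proof.
rewrite /csin /ccosh (_ : ii * (2 * z) = ii * z + ii * z); last by ring.
rewrite opprD !cexpD; field.
by rewrite ii_neq0.
Qed.

(** Iterated, this duplication formula bounds [sinc] by [expR `|Im u|] without the
    constant that the bound on [csin] would cost near [0]; a constant larger than
    [1] would make the infinite product of [sinc (w / 2 ^ k)] useless. *)
Lemma sinc_double u : sinc (2 * u) = sinc u * ccosh (ii * u).
Proof.
rewrite /sinc mulf_eq0 pnatr_eq0 /=; have [->|u0] := eqVneq u 0.
  by rewrite mulr0 /ccosh oppr0 cexp0; field.
by rewrite csin_double; field.
Qed.

Lemma sinc_sub1 u : nc (sinc u - 1) <= 3 * nc u * expR (nc u).
Proof.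
rewrite /sinc; have [->|u0] := eqVneq u 0.
  by rewrite subrr normcC0 mulr0 mul0r.
have nu : 0 < nc u.
  by rewrite lt_def normcC_ge0 andbT; apply: contra u0 => /eqP/normcC_eq0 ->.
have niu : nc (ii * u) = nc u by rewrite normcCM normc_ii mul1r.
have -> : csin u / u - 1 = ((cexp (ii * u) - 1 - ii * u) -
    (cexp (- (ii * u)) - 1 - (- (ii * u)))) / (2 * ii * u).
  by rewrite /csin; field; rewrite ii_neq0 u0.
rewrite normcCM normcCV !normcCM normc_natr normc_ii mulr1.
rewrite ler_pdivrMr ?mulr_gt0// (le_trans (normcCB _ _))//.
rewrite (le_trans (lerD (cexp_taylor1 _) (cexp_taylor1 _)))// normcCN niu.
by rewrite le_eqVlt; apply/orP; left; apply/eqP; ring.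
Qed.

(** Same idea with the odd part of [(1 + z / n) ^+ n], divided by [z]; the factor
    [z ^+ 2] in [cexp_approx] absorbs the division. *)
Lemma sinc_approx : approx (@coord1 R) sinc.
Proof.
move=> r e e0.
have [r0|r0] := ltP r 0.
  exists (fun=> 0); first exact: polyfun_cst.
  by move=> z /(_ tt) h; have := normcC_ge0 z; rewrite leNgt (le_lt_trans h).
pose K := 3 * r * expR r.
pose n := Num.truncn (K / e).
have hn : K / n.+1%:R <= e.
  by rewrite ler_pdivrMr// mulrC -ler_pdivrMr//; exact: ltW (truncnS_gt _).
have [A [B [AB _ B0]]] := even_odd_pow (n.+1%:R^-1 : C) n.+1.
exists (fun z => B.[- (z * z)]).
  apply: (@polyfun_horner R C unit (@coord1 R)); apply: polyfun_opp.
  by apply: polyfun_mul; exact: (polyfun_crd _ tt).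
move=> u /(_ tt); rewrite /coord1 => hu.
have [->|u0] := eqVneq u 0.
  have B1 : B.[0] = 1 by rewrite B0 divff// pnatr_eq0.
  by rewrite /sinc eqxx mulr0 oppr0 B1 subrr normcC0 ltW.
have uu : - (u * u) = (ii * u) ^+ 2 by rewrite exprMn sqr_ii; ring.
have niu : nc (ii * u) = nc u by rewrite normcCM normc_ii mul1r.
have hB : B.[(ii * u) ^+ 2] = ((1 + (ii * u) / n.+1%:R) ^+ n.+1 -
    (1 + (- (ii * u)) / n.+1%:R) ^+ n.+1) / (2 * (ii * u)).
  by rewrite ![_ / n.+1%:R]mulrC !AB sqrrN; field; rewrite u0 ii_neq0.
rewrite uu hB /sinc (negbTE u0) /csin.
have -> : (cexp (ii * u) - cexp (- (ii * u))) / (2 * ii) / u -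
   ((1 + ii * u / n.+1%:R) ^+ n.+1 - (1 + - (ii * u) / n.+1%:R) ^+ n.+1) / (2 * (ii * u)) =
   ((cexp (ii * u) - (1 + ii * u / n.+1%:R) ^+ n.+1) -
   (cexp (- (ii * u)) - (1 + - (ii * u) / n.+1%:R) ^+ n.+1)) / (2 * (ii * u)).
  move: ((1 + _) ^+ _) ((1 + _) ^+ _) (cexp _) (cexp _) => *.
  by field; rewrite u0 ii_neq0.
have nu : 0 < nc u.
  by rewrite lt_def normcC_ge0 andbT; apply: contra u0 => /eqP/normcC_eq0 ->.
rewrite normcCM normcCV normcCM normc_natr niu ler_pdivrMr ?mulr_gt0//.
have hK : 3 * nc u ^+ 2 * expR (nc u) / n.+1%:R <= e * nc u.
  apply: (@le_trans _ _ (3 * nc u * expR (nc u) / n.+1%:R * nc u)).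
    by rewrite le_eqVlt; apply/orP; left; apply/eqP; ring.
  rewrite ler_wpM2r ?(ltW nu)//; apply: le_trans hn; rewrite ler_wpM2r//.
  rewrite ler_pM ?expR_ge0 ?ler_expR//; first by rewrite mulr_ge0// ltW.
  by rewrite ler_wpM2l.
rewrite (le_trans (normcCB _ _))// (_ : e * _ = e * nc u + e * nc u); last by ring.
by rewrite lerD// (le_trans (cexp_approx _ _))// ?normcCN niu.
Qed.

End CoshSqrtSinc.

(** * An entire function of exponential type rapidly decreasing on the real axis *)

Section RapidDecay.
Variable R : realType.
Local Notation C := (CC R).
Local Notation nc := (@Normc.normc R).
Local Notation Re := (@complex.Re R).
Local Notation Im := (@complex.Im R).
Local Notation ii := (0 +i* 1 : C).
Implicit Types w u : C.

Lemma ImZ (a : R) w : Im (real_complex R a * w) = a * Im w.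
Proof. by case: w => x y /=; rewrite mul0r addr0. Qed.

Lemma ReZ (a : R) w : Re (real_complex R a * w) = a * Re w.
Proof. by case: w => x y /=; rewrite mul0r subr0. Qed.

Lemma normc_sinc_double n u :
  nc (sinc (real_complex R (2 ^+ n) * u)) <= expR ((2 ^+ n - 1) * `|Im u|) * nc (sinc u).
Proof.
elim: n => [|n IH]; first by rewrite expr0 rmorph1 mul1r subrr mul0r expR0 mul1r.
rewrite exprS rmorphM -mulrA rmorph_nat sinc_double normcCM.
rewrite (_ : 2 * 2 ^+ n - 1 = (2 ^+ n - 1) + 2 ^+ n); last by ring.
rewrite mulrDl expRD mulrAC ler_pM ?normcC_ge0//.
rewrite (le_trans (normc_ccosh _))// Re_ii normrN ImZ normrM.
by rewrite (ger0_norm (exprn_ge0 n (ler0n R 2))).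
Qed.

Lemma normc_sinc u : nc (sinc u) <= expR `|Im u|.
Proof.
apply/ler_addgt0Pr => e e0.
pose K := expR `|Im u| * (3 * nc u * expR (nc u)).
pose n := (Num.truncn (K / e)).+1.
have hn : K / 2 ^+ n <= e.
  rewrite ler_pdivrMr ?exprn_gt0// mulrC -ler_pdivrMr//.
  by apply: (le_trans (ltW (truncnS_gt _))); exact: exp2_ge.
pose a := real_complex R (2 ^+ n); pose v := real_complex R (2 ^- n) * u.
have n0 : 0 < 2 ^+ n :> R by rewrite exprn_gt0.
have uE : u = a * v by rewrite mulrA -rmorphM divff ?gt_eqF// mul1r.
have n1 : 1 <= 2 ^+ n :> R by rewrite exprn_ege1// ler1n.
have nv : nc v = nc u / 2 ^+ n.
  by rewrite normcCM normc_real ger0_norm ?invr_ge0 ?(ltW n0)// mulrC.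
rewrite {1}uE (le_trans (normc_sinc_double _ _))//.
apply: (@le_trans _ _ (expR `|Im u| * (1 + 3 * nc u * expR (nc u) / 2 ^+ n))).
  rewrite ler_pM ?expR_ge0 ?normcC_ge0//.
    rewrite ler_expR ImZ normrM (@ger0_norm _ (2 ^- n)) ?invr_ge0 ?(ltW n0)//.
    rewrite mulrA mulrBl divff ?gt_eqF// mul1r.
    by rewrite ler_piMl// gerBl invr_ge0 ltW.
  rewrite -[sinc v](subrK 1) (le_trans (normcCD _ _))// normcC1 addrC lerD2l.
  rewrite (le_trans (sinc_sub1 _))// nv mulrA mulrAC ler_wpM2r ?invr_ge0 ?(ltW n0)//.
  rewrite ler_wpM2l ?mulr_ge0 ?normcC_ge0// ler_expR ler_piMr ?normcC_ge0//.
  by rewrite invf_le1.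
by rewrite mulrDr mulr1 lerD2l mulrA.
Qed.

Lemma normc_sinc_decay u : nc (sinc u) * (1 + `|Re u|) <= 2 * expR `|Im u|.
Proof.
rewrite mulrDr mulr1 [2 * _]mulr_natl mulr2n lerD ?normc_sinc//.
rewrite (le_trans (ler_wpM2l (normcC_ge0 _) (normc_ge_absRe u)))//.
rewrite -normcCM /sinc; have [->|u0] := eqVneq u 0.
  by rewrite mulr0 normcC0 expR_ge0.
by rewrite divfK// normc_csin.
Qed.

Definition sinc_prod n w : C := \prod_(k < n) sinc (real_complex R (2 ^- k) * w).

Lemma sum_half n : \sum_(k < n) 2 ^- k = 2 - 2 * 2 ^- n :> R.
Proof.
elim: n => [|n IH]; first by rewrite big_ord0 expr0 invr1 mulr1 subrr.
rewrite big_ord_recr /= IH exprS invfM.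
by rewrite mulrA divff ?pnatr_eq0// mul1r; ring.
Qed.

Lemma normc_sinc_prod_le n w : nc (sinc_prod n w) <= expR (2 * `|Im w|).
Proof.
apply: (@le_trans _ _ (expR ((2 - 2 * 2 ^- n) * `|Im w|))); last first.
  rewrite ler_expR ler_wpM2r// gerBl mulr_ge0// invr_ge0 exprn_ge0//.
rewrite -sum_half mulr_suml expR_sum normcC_prod; apply: ler_prod => k _.
rewrite normcC_ge0 (le_trans (normc_sinc _))// ler_expR ImZ normrM.
by rewrite ger0_norm// invr_ge0 exprn_ge0.
Qed.

(** Only the first [N] factors are used for decay, each contributing one power
    of [1 + |Re w|]; the other ones only contribute to the exponential type. *)
Lemma normc_sinc_prod_decay N : exists2 K, 0 <= K & forall n w, (N <= n)%N ->
  nc (sinc_prod n w) * (1 + `|Re w|) ^+ N <= K * expR (2 * `|Im w|).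
Proof.
pose K := \prod_(k < N) (2 ^+ k * 2) : R.
have K0 : 0 <= K by rewrite prodr_ge0// => k _; rewrite mulr_ge0// exprn_ge0.
exists K => // n w Nn.
have base : nc (sinc_prod N w) * (1 + `|Re w|) ^+ N <=
    K * expR ((\sum_(k < N) 2 ^- k) * `|Im w|).
  rewrite -[X in _ ^+ X]card_ord -prodr_const normcC_prod mulr_suml expR_sum.
  rewrite -!big_split; apply: ler_prod => k _.
  have p0 : 0 < 2 ^+ k :> R by rewrite exprn_gt0.
  rewrite mulr_ge0 ?normcC_ge0 ?addr_ge0//= -mulrA.
  have := normc_sinc_decay (real_complex R (2 ^- k) * w).
  rewrite ImZ ReZ !normrM (@ger0_norm _ (2 ^- k)) ?invr_ge0 ?(ltW p0)// => h.
  rewrite -ler_pdivrMl// (le_trans _ h)// mulrCA ler_wpM2l ?normcC_ge0//.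
  by rewrite mulrDr mulr1 lerD2r invf_le1// exprn_ege1// ler1n.
have step m : nc (sinc_prod (N + m) w) * (1 + `|Re w|) ^+ N <=
    K * expR ((\sum_(k < N + m) 2 ^- k) * `|Im w|).
  elim: m => [|m IH]; first by rewrite addn0; exact: base.
  rewrite addnS /sinc_prod !big_ord_recr /= -/(sinc_prod (N + m) w).
  rewrite mulrDl expRD normcCM mulrAC mulrA ler_pM ?normcC_ge0//.
    by rewrite mulr_ge0 ?normcC_ge0 ?exprn_ge0 ?addr_ge0.
  rewrite (le_trans (normc_sinc _))// ler_expR ImZ normrM.
  by rewrite (@ger0_norm _ (2 ^- (N + m))) ?invr_ge0 ?exprn_ge0.
have := step (n - N)%N; rewrite subnKC// => /le_trans; apply.
by rewrite ler_wpM2l// ler_expR sum_half ler_wpM2r// gerBl mulr_ge0//.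
Qed.

(** The Fourier transform of a smooth compactly supported bump, obtained as the
    infinite product of the functions [sinc (w / 2 ^ k)]. *)
Lemma rapidly_decreasing_exponential_type : exists s : C -> C,
  [/\ approx (@coord1 R) s, s 0 = 1 &
     forall N, exists2 K, 0 <= K & forall w,
       nc (s w) * (1 + `|Re w|) ^+ N <= K * expR (2 * `|Im w|)].
Proof.
have apP n : approx (@coord1 R) (sinc_prod n).
  apply: approx_prod => k; 
  apply: (@approx_comp R C unit (@coord1 R) _ (fun w => real_complex R (2 ^- k) * w)
    (@sinc_approx R)).
  apply: (@polyfun_mul _ _ _ _ (fun=> real_complex R (2 ^- k)) id).
    exact: polyfun_cst.
  exact: (polyfun_crd _ tt).
have cau w n : nc (sinc_prod n.+1 w - sinc_prod n w) <=
    expR (2 * nc w) * (3 * nc w * expR (nc w)) / 2 ^+ n.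
  rewrite /sinc_prod big_ord_recr /= -[X in _ - X]mulr1 -mulrBr normcCM -mulrA.
  rewrite ler_pM ?normcC_ge0//.
    rewrite (le_trans (normc_sinc_prod_le _ _))// ler_expR ler_wpM2l//.
    exact: normc_ge_absIm.
  have n1 : 1 <= 2 ^+ n :> R by rewrite exprn_ege1// ler1n.
  have n0 : 0 < 2 ^+ n :> R by rewrite exprn_gt0.
  rewrite (le_trans (sinc_sub1 _))// normcCM normc_real.
  rewrite (@ger0_norm _ (2 ^- n)) ?invr_ge0 ?(ltW n0)//.
  rewrite (_ : 3 * _ * _ = 3 * nc w * expR (2 ^- n * nc w) / 2 ^+ n); last by ring.
  rewrite ler_wpM2r ?invr_ge0 ?(ltW n0)// ler_wpM2l ?mulr_ge0 ?normcC_ge0//.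
  by rewrite ler_expR ler_piMl ?normcC_ge0// invf_le1.
have [|r|s sa sE] := @approx_geometric_limit R C unit (@coord1 R) sinc_prod apP.
- by move=> z; exists (expR (2 * nc z) * (3 * nc z * expR (nc z))).
- exists (expR (2 * r) * (3 * r * expR r)) => z n /(_ tt) zr.
  have r0 : 0 <= r := le_trans (normcC_ge0 _) zr.
  rewrite (le_trans (cau z n))// ler_wpM2r ?invr_ge0 ?exprn_ge0//.
  rewrite ler_pM ?expR_ge0 ?mulr_ge0 ?normcC_ge0 ?expR_ge0//.
    by rewrite ler_expR ler_wpM2l.
  by rewrite ler_pM ?mulr_ge0 ?normcC_ge0 ?expR_ge0 ?ler_expR// ler_wpM2l.
have lim w e : 0 < e -> forall m, exists2 n, (m <= n)%N & nc (s w - sinc_prod n w) <= e.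
  move=> e0 m; pose K := 4 * (expR (2 * nc w) * (3 * nc w * expR (nc w))).
  pose n := (maxn m (Num.truncn (K / e)).+1).
  exists n; first exact: leq_maxl.
  rewrite (le_trans (sE _ _ (cau w) n))// -/K.
  rewrite ler_pdivrMr ?exprn_gt0// mulrC -ler_pdivrMr//.
  apply: (le_trans (ltW (truncnS_gt _))); apply: le_trans (exp2_ge _ n).
  by rewrite ler_nat leq_maxr.
exists s; split => //.
- apply/subr0_eq/normcC_eq0/eqP; rewrite eq_le normcC_ge0 andbT.
  apply/ler_addgt0Pl => e e0; rewrite addr0.
  have [n _] := lim 0 e e0 0; rewrite /sinc_prod big1// => k _.
  by rewrite mulr0 /sinc eqxx.
- move=> N; have [K K0 hK] := normc_sinc_prod_decay N; exists K => // w.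
  apply/ler_addgt0Pr => e e0.
  pose q := (1 + `|Re w|) ^+ N; have q0 : 0 < q by rewrite exprn_gt0// ltr_pwDl.
  have [n Nn hn] := lim w (e / q) (divr_gt0 e0 q0) N.
  rewrite -[s w](subrK (sinc_prod n w)).
  rewrite (le_trans (ler_wpM2r (ltW q0) (normcCD _ _)))// mulrDl addrC lerD//.
    exact: hK.
  by rewrite -ler_pdivlMr.
Qed.

End RapidDecay.

(** * Bumps of prescribed center and radius *)

Section Bump.
Variables (R : realType) (d : nat).
Local Notation C := (CC R).
Local Notation nc := (@Normc.normc R).
Local Notation Re := (@complex.Re R).
Local Notation Im := (@complex.Im R).
Implicit Types (x y p : 'rV[R]_d) (L : R).

Lemma sum_Cauchy_Schwarz (x y : 'I_d -> R) :
  (\sum_j x j * y j) ^+ 2 <= (\sum_j x j ^+ 2) * (\sum_j y j ^+ 2).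
Proof.
set m := \sum_j x j * y j; set a := \sum_j x j ^+ 2; set b := \sum_j y j ^+ 2.
have a0 : 0 <= a by rewrite sumr_ge0// => j _; exact: sqr_ge0.
have h : 0 <= a * (a * b - m ^+ 2).
  have -> : a * (a * b - m ^+ 2) = \sum_j (a * y j - m * x j) ^+ 2.
    rewrite (eq_bigr (fun j => a ^+ 2 * y j ^+ 2 + (- 2 * a * m) * (x j * y j) +
      m ^+ 2 * x j ^+ 2)); last by move=> j _; ring.
    by rewrite !big_split /= -!mulr_sumr -/a -/b -/m; ring.
  by rewrite sumr_ge0// => j _; exact: sqr_ge0.
have [a1|a1] := ltP 0 a; first by rewrite -subr_ge0 -(pmulr_rge0 _ a1).
have x0 j : x j = 0.
  have : a == 0 by rewrite eq_le a1 a0.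
  rewrite /a psumr_eq0; last by move=> i _; exact: sqr_ge0.
  by move=> /allP/(_ j); rewrite mem_index_enum sqrf_eq0 => /(_ isT)/eqP.
rewrite /m big1 ?expr0n ?mulr_ge0//; first by rewrite sumr_ge0// => j _; exact: sqr_ge0.
by move=> j _; rewrite x0 mul0r.
Qed.

(** Here [a +i* b] is a square root of [L2 - z ^+ 2], with [X = |x|^2],
    [Y = |y|^2] and [m = x . y] for [z = x +i* y].  If the conclusion failed, the
    lower bound for [b ^+ 2] given by the first hypothesis would make
    [(a * b) ^+ 2] larger than [X * Y]. *)
Lemma sqrt_real_part_le (a b m L2 X Y : R) : a ^+ 2 - b ^+ 2 = L2 - X + Y ->
  a * b = - m -> m ^+ 2 <= X * Y -> 0 <= X -> 0 <= Y -> 0 <= L2 ->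
  a ^+ 2 <= L2 + Y.
Proof.
move=> h1 h2 h3 X0 Y0 L0; rewrite leNgt; apply/negP => h.
have hb : b ^+ 2 = a ^+ 2 - L2 + X - Y by lra.
have : a ^+ 2 * b ^+ 2 <= X * Y by rewrite -exprMn h2 sqrrN.
rewrite hb; move: (a ^+ 2) h => A h.
by nra.
Qed.

Lemma sqrt_real_part_le_far (a b m L2 X Y : R) : a ^+ 2 - b ^+ 2 = L2 - X + Y ->
  a * b = - m -> m ^+ 2 <= X * Y -> 0 <= X -> 0 <= Y -> 0 <= L2 ->
  4 * L2 <= X -> a ^+ 2 <= 4 * Y.
Proof.
move=> h1 h2 h3 X0 Y0 L0 LX; rewrite leNgt; apply/negP => h.
have hb : b ^+ 2 = a ^+ 2 - L2 + X - Y by lra.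
have : a ^+ 2 * b ^+ 2 <= X * Y by rewrite -exprMn h2 sqrrN.
rewrite hb; move: (a ^+ 2) h => A h.
have A0 : 0 < A by lra.
have : 0 < A * (A - Y) by rewrite mulr_gt0//; lra.
have : 4 * Y * X <= A * X by rewrite ler_wpM2r// ltW.
have : A * (4 * L2) <= A * X by rewrite ler_wpM2l// ltW.
by nra.
Qed.

Definition norm1 x := \sum_j `|x ord0 j|.
Definition sqr2 x := \sum_j (x ord0 j) ^+ 2.
Definition polyw x := \prod_j (1 + `|x ord0 j|).

Lemma norm1_ge0 x : 0 <= norm1 x.
Proof. by rewrite sumr_ge0. Qed.

Lemma sqr2_ge0 x : 0 <= sqr2 x.
Proof. by rewrite sumr_ge0// => j _; exact: sqr_ge0. Qed.

Lemma polyw_ge1 x : 1 <= polyw x.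
Proof.
rewrite /polyw; elim/big_ind: _ => // [a b a1 b1|j _]; last by rewrite lerDl.
by rewrite -[1]mulr1 ler_pM.
Qed.

Lemma sqr2_le_norm1 x : sqr2 x <= norm1 x ^+ 2.
Proof.
rewrite /sqr2 /norm1 expr2 mulr_suml ler_sum// => j _.
rewrite -real_normK ?num_real// expr2 ler_wpM2l// (bigD1 j)//= lerDl.
exact: sumr_ge0.
Qed.

(** The second bound is uniform in [L] only because the sphere of radius [2 * L]
    keeps away from the zero set of [L ^+ 2 - x ^+ 2]: at [|x| = L] the growth in
    [y] is of order [sqrt (L * |y|)]. *)
Lemma normc_coshsqrt_sqr2 L x y : 0 <= L ->
  nc (coshsqrt ((real_complex R L) ^+ 2 - \sum_j (zvec x y ord0 j) ^+ 2))
    <= expR (L + norm1 y) /\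
  (4 * L ^+ 2 <= sqr2 x ->
   nc (coshsqrt ((real_complex R L) ^+ 2 - \sum_j (zvec x y ord0 j) ^+ 2))
    <= expR (2 * norm1 y)).
Proof.
move=> L0; set w := (X in coshsqrt X).
have [a [b zw]] : exists a b, (a +i* b : C) ^+ 2 = w.
  by exists (Re (sqrtC w)), (Im (sqrtC w)); rewrite -[RHS]sqrtCK; case: (sqrtC w).
have sumE : \sum_j (zvec x y ord0 j) ^+ 2 =
    (sqr2 x - sqr2 y) +i* (2 * \sum_j x ord0 j * y ord0 j) :> C.
  rewrite /sqr2 -sumrB mulr_sumr.
  elim/big_ind3: _ => [//|u1 u2 u3 v1 v2 v3 -> ->//|j _].
  rewrite mxE expr2 -[LHS]/((_ - _) +i* (_ + _)) !expr2 mulr_natl mulr2n.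
  by rewrite [y ord0 j * x ord0 j]mulrC.
have wE : w = (L ^+ 2 - sqr2 x + sqr2 y) +i* (- (2 * \sum_j x ord0 j * y ord0 j)).
  rewrite /w sumE -rmorphXn -[LHS]/((_ - _) +i* (0 - _)) sub0r.
  by congr (_ +i* _); ring.
have [h1 h2] : a ^+ 2 - b ^+ 2 = L ^+ 2 - sqr2 x + sqr2 y /\
    a * b = - \sum_j x ord0 j * y ord0 j.
  move: zw; rewrite wE expr2 -[LHS]/((_ - _) +i* (_ + _)) => -[<- h]; split.
    by rewrite !expr2.
  by move: h; set m := (\sum_j _) => h; lra.
have CS := sum_Cauchy_Schwarz (x ord0) (y ord0).
have cw : nc (coshsqrt w) <= expR `|a|.
  by rewrite (coshsqrtE zw) (le_trans (normc_ccosh _)).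
have X0 := sqr2_ge0 x; have Y0 := sqr2_ge0 y; have L20 := sqr_ge0 L.
have n0 := norm1_ge0 y; have n2 := sqr2_le_norm1 y.
split=> [|LX]; rewrite (le_trans cw)// ler_expR -ler_sqr ?nnegrE ?addr_ge0 ?mulr_ge0//
  real_normK ?num_real//.
- have := sqrt_real_part_le h1 h2 CS X0 Y0 L20; nra.
- have := sqrt_real_part_le_far h1 h2 CS X0 Y0 L20 LX; nra.
Qed.

Lemma coshsqrt_near (L : R) (q : C) : 1 <= L -> nc q <= 1 / 16 ->
  nc (coshsqrt ((real_complex R L) ^+ 2 - q) - ccosh (real_complex R L))
    <= 1 / 10 * expR L.
Proof.
move=> L1 q1; set w := (X in coshsqrt X); set l := real_complex R L.
have [z zw z0] : exists2 z : C, z ^+ 2 = w & 0 <= Re z.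
  have [h|/ltW h] := leP 0 (Re (sqrtC w)); first by exists (sqrtC w); rewrite ?sqrtCK.
  exists (- sqrtC w); first by rewrite sqrrN sqrtCK.
  by move: h; case: (sqrtC w) => u v /= h; rewrite oppr_ge0.
have zl : nc (z - l) <= nc q.
  have : (z - l) * (z + l) = - q.
    by rewrite -subr_sqr zw /w /l addrAC subrr sub0r.
  move/(congr1 nc); rewrite normcCM normcCN => <-.
  rewrite ler_peMr ?normcC_ge0// (le_trans L1)// (le_trans _ (normc_ge_absRe _))//.
  rewrite (le_trans _ (ler_norm _))//; move: z0; case: (z) => u v /=.
  by rewrite lerDr.
pose k := nc (z - l) + 3 * nc (z - l) ^+ 2 * expR (nc (z - l)).
have e1 : expR (nc (z - l)) <= 2.
  rewrite -[leLHS]invrK -expRN; have := expR_ge1Dx (- nc (z - l)) => h.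
  rewrite -[leRHS]invrK lef_pV2 ?posrE ?expR_gt0 ?invr_gt0//.
  by apply: le_trans h; lra.
have hk : k <= 1 / 10.
  have h0 := normcC_ge0 (z - l).
  have : 3 * nc (z - l) ^+ 2 * expR (nc (z - l)) <= 3 * (1 / 16) ^+ 2 * 2.
    rewrite ler_pM ?expR_ge0 ?mulr_ge0 ?sqr_ge0// ler_wpM2l//.
    by rewrite lerXn2r ?nnegrE//; lra.
  by rewrite /k; move: zl q1; lra.
have k1 : nc (cexp (z - l) - 1) <= k by exact: cexp_sub1.
have k2 : nc (cexp (- (z - l)) - 1) <= k by rewrite (le_trans (cexp_sub1 _))// normcCN.
rewrite (coshsqrtE zw) /ccosh.
have -> : (cexp z + cexp (- z)) / 2 - (cexp l + cexp (- l)) / 2 =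
  (cexp l * (cexp (z - l) - 1) + cexp (- l) * (cexp (- (z - l)) - 1)) / 2.
  rewrite !mulrBr -!cexpD !mulr1 (_ : l + (z - l) = z); last by ring.
  have -> : - l - (z - l) = - z by ring.
  by ring.
rewrite normcCM normcCV normc_natr ler_pdivrMr// (le_trans (normcCD _ _))//.
rewrite !normcCM !normc_cexp /=.
have eN : expR (- L) <= expR L by rewrite ler_expR; lra.
have h1 : expR L * nc (cexp (z - l) - 1) <= expR L * (1 / 10).
  by rewrite ler_wpM2l ?expR_ge0// (le_trans k1).
have h2 : expR (- L) * nc (cexp (- (z - l)) - 1) <= expR L * (1 / 10).
  by rewrite ler_pM ?expR_ge0 ?normcC_ge0// (le_trans k2).
by rewrite (le_trans (lerD h1 h2))// -mulrDr mulrAC mulrC ler_wpM2r ?expR_ge0//; lra.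
Qed.

Lemma ccosh_real L : ccosh (real_complex R L) = real_complex R ((expR L + expR (- L)) / 2).
Proof.
rewrite /ccosh /cexp /= !oppr0 cos0 sin0 !mulr1 !mulr0 rmorphM rmorphD fmorphV.
by rewrite rmorph_nat.
Qed.

Definition bump (s : C -> C) L p (z : 'rV[C]_d) : C :=
  (\prod_j s (z ord0 j - real_complex R (p ord0 j))) *
  coshsqrt ((real_complex R L) ^+ 2 -
    \sum_j (z ord0 j - real_complex R (p ord0 j)) ^+ 2).

Lemma polyfun_shift p j :
  polyfun (@coordv R d) (fun z => z ord0 j - real_complex R (p ord0 j)).
Proof. by apply: polyfun_add (polyfun_cst _ _); exact: polyfun_crd. Qed.

Lemma bump_approx s L p : approx (@coord1 R) s -> approx (@coordv R d) (bump s L p).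
Proof.
move=> hs; apply: approx_mul.
  apply: approx_prod => j.
  exact: (approx_comp hs (polyfun_shift p j)).
apply: (@approx_comp R _ _ (@coordv R d) (@coshsqrt R)); first exact: coshsqrt_approx.
apply: polyfun_add (polyfun_cst _ _) _; apply: polyfun_opp; apply: polyfun_sum => j.
by apply: polyfun_mul; exact: polyfun_shift.
Qed.

Lemma zvec_shift p x y j :
  zvec x y ord0 j - real_complex R (p ord0 j) = zvec (x - p) y ord0 j.
Proof. by rewrite !mxE /=; congr (_ +i* _); rewrite subr0. Qed.

Lemma bump_shift s L p x y : bump s L p (zvec x y) =
  (\prod_j s (zvec (x - p) y ord0 j)) *
  coshsqrt ((real_complex R L) ^+ 2 - \sum_j (zvec (x - p) y ord0 j) ^+ 2).
Proof.
by rewrite /bump; congr (_ * coshsqrt (_ - _)); apply: eq_bigr => j _; rewrite zvec_shift.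
Qed.

Lemma prod_decay (s : C -> C) N K : 0 <= K -> (forall w, nc (s w) * (1 + `|Re w|) ^+ N <= K * expR (2 * `|Im w|)) ->
  forall x y, nc (\prod_j s (zvec x y ord0 j)) * polyw x ^+ N <= K ^+ d * expR (2 * norm1 y).
Proof.
move=> K0 hK x y; rewrite normcC_prod /polyw -prodrXl -big_split.
rewrite /norm1 mulr_sumr expR_sum -[X in K ^+ X]card_ord -prodr_const -big_split.
apply: ler_prod => j _; rewrite mulr_ge0 ?normcC_ge0 ?exprn_ge0 ?addr_ge0//=.
by have := hK (zvec x y ord0 j); rewrite mxE.
Qed.

Lemma bump_le s N K L p x y : 0 <= L -> 0 <= K ->
  (forall w, nc (s w) * (1 + `|Re w|) ^+ N <= K * expR (2 * `|Im w|)) ->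
  nc (bump s L p (zvec x y)) * polyw (x - p) ^+ N <= K ^+ d * expR (L + 4 * norm1 y) /\
  (4 * L ^+ 2 <= sqr2 (x - p) ->
   nc (bump s L p (zvec x y)) * polyw (x - p) ^+ N <= K ^+ d * expR (4 * norm1 y)).
Proof.
move=> L0 K0 hK; rewrite bump_shift normcCM.
have h1 := prod_decay K0 hK (x - p) y.
have [h2 h3] := normc_coshsqrt_sqr2 (x - p) y L0.
have p0 : 0 <= polyw (x - p) ^+ N by rewrite exprn_ge0// (le_trans _ (polyw_ge1 _)).
have n0 := norm1_ge0 y.
have key B : nc (coshsqrt ((real_complex R L) ^+ 2 - \sum_j (zvec (x - p) y ord0 j) ^+ 2)) <= expR B ->
  nc (\prod_j s (zvec (x - p) y ord0 j)) *
  nc (coshsqrt ((real_complex R L) ^+ 2 - \sum_j (zvec (x - p) y ord0 j) ^+ 2)) *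
  polyw (x - p) ^+ N <= K ^+ d * expR (2 * norm1 y + B).
  by move=> hB; rewrite expRD mulrAC mulrA ler_pM ?mulr_ge0 ?normcC_ge0.
split=> [|LX].
  by rewrite (le_trans (key _ h2))// ler_wpM2l ?exprn_ge0// ler_expR; lra.
by rewrite (le_trans (key _ (h3 LX)))// ler_wpM2l ?exprn_ge0// ler_expR; lra.
Qed.

End Bump.

Section BumpCenter.
Variables (R : realType) (d : nat).
Local Notation C := (CC R).
Local Notation nc := (@Normc.normc R).
Local Notation Re := (@complex.Re R).
Implicit Types (x y p : 'rV[R]_d) (L : R).

Lemma rnorm_le (v : 'rV[C]_d) (e : R) : 0 <= e -> (forall j, nc (v ord0 j) <= e) ->
  rnorm v <= e.
Proof.
move=> e0 h; have [v0|] := eqVneq (mx_norm v) 0.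
  by rewrite -lecR -rnormE [leLHS]v0 -[0]/(real_complex R 0) lecR.
move=> /mx_norm_neq0[[i j] /= hv]; rewrite -lecR -rnormE [leLHS]hv ord1.
by rewrite [leLHS]normC_normc lecR h.
Qed.

Lemma approx_continuous_at0 (g : 'rV[C]_d -> C) (e : R) : approx (@coordv R d) g ->
  0 < e -> exists2 del : R, 0 < del & forall v : 'rV[C]_d, (forall j, nc (v ord0 j) <= del) ->
    nc (g v - g 0) <= e.
Proof.
move=> hg e0.
have /cvgrPdist_le/(_ (real_complex R e)) := differentiable_continuous (approx_entire hg 0).
rewrite -[0 < _]/((0 : R[i]) < _) -[0]/(real_complex R 0) ltcR => /(_ e0).
move=> /nbhs_ballP[r /= r0 h].
have [a rE a0] : exists2 a : R, r = real_complex R a & 0 < a.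
  by move: r0; case: r {h} => a b; rewrite ltcE /= => /andP[/eqP -> a0]; exists a.
exists (a / 2); first by rewrite divr_gt0.
move=> v hv; have := h v; rewrite mx_norm_ball /ball_ /= => hh.
rewrite normcC_distC -lecR -[leLHS]normC_normc; apply: hh.
rewrite sub0r normrN rnormE rE ltcR.
have hv2 : rnorm v <= a / 2 by apply: rnorm_le => //; rewrite divr_ge0// ltW.
by rewrite (le_lt_trans hv2)// ltr_pdivrMr// mulr_natr mulr2n ltrDl.
Qed.

(** The value at the center is [cosh L], and it varies little on a ball whose
    radius does not depend on [L]. *)
Lemma bump_center (s : C -> C) : approx (@coord1 R) s -> s 0 = 1 ->
  exists2 del : R, 0 < del & forall L p x y, 1 <= L ->
    (forall j, `|x ord0 j - p ord0 j| <= del) -> (forall j, `|y ord0 j| <= del) ->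
    expR L / 4 <= Re (bump s L p (zvec x y)).
Proof.
move=> sa s0; pose g := fun z : 'rV[C]_d => \prod_j s (z ord0 j).
have ga : approx (@coordv R d) g.
  by apply: approx_prod => j; exact: (approx_comp sa (polyfun_crd (@coordv R d) j)).
have g0 : g 0 = 1 by rewrite /g big1// => j _; rewrite mxE.
have [e1 e10 he1] := approx_continuous_at0 (e := 1 / 8) ga (divr_gt0 ltr01 (ltr0Sn _ _)).
pose del := Num.min (e1 / 2) (1 / (8 * (d%:R + 1))).
have d1 : 0 < 8 * (d%:R + 1) :> R by rewrite mulr_gt0// ltr_wpDl.
have del0 : 0 < del by rewrite lt_min !divr_gt0.
exists del => // L p x y L1 hx hy; rewrite bump_shift.
have hz j : nc (zvec (x - p) y ord0 j) <= 2 * del.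
  rewrite (le_trans (normc_le_ReIm _))// !mxE /= mulr_natl mulr2n.
  by rewrite lerD ?hx ?hy.
have hd : d%:R * (2 * del) ^+ 2 <= 1 / 16.
  have h8 : del * (8 * (d%:R + 1)) <= 1.
    by rewrite -ler_pdivlMr// ge_min lexx orbT.
  have d0 : 0 <= d%:R :> R by [].
  by rewrite expr2; nra.
have hq : nc (\sum_j (zvec (x - p) y ord0 j) ^+ 2) <= 1 / 16.
  apply: le_trans hd; rewrite (le_trans (normcC_sum _ _ _))//.
  rewrite mulr_natl -[X in _ *+ X]card_ord -sumr_const ler_sum// => j _.
  by rewrite normcCX lerXn2r ?nnegrE ?normcC_ge0 ?mulr_ge0// ltW.
have hG : nc (g (zvec (x - p) y) - 1) <= 1 / 8.
  rewrite -g0; apply: he1 => j; rewrite (le_trans (hz j))//.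
  by rewrite mulrC -ler_pdivlMr// ge_min lexx.
have hD := coshsqrt_near L1 hq.
rewrite -[\prod_j _]/(g (zvec (x - p) y)).
move: (g _) hG (coshsqrt _) hD => G hG D; rewrite ccosh_real => hD.
set c := (expR L + expR (- L)) / 2; have eL := expR_gt0 L; have eNL := expR_gt0 (- L).
have eN : expR (- L) <= expR L by rewrite ler_expR; lra.
have nD : nc D <= 11 / 10 * expR L.
  rewrite -[D](subrK (real_complex R c)) (le_trans (normcCD _ _))//.
  by rewrite normc_real ger0_norm /c; lra.
have hGD : nc (G * D - real_complex R c) <= (1 / 8 * (11 / 10) + 1 / 10) * expR L.
  rewrite (_ : _ - _ = (G - 1) * D + (D - real_complex R c)); last by ring.
  rewrite (le_trans (normcCD _ _))// [leRHS]mulrDl lerD// normcCM -mulrA.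
  by rewrite ler_pM ?normcC_ge0.
have := le_trans (normc_ge_absRe _) hGD.
have -> : Re (G * D - real_complex R c) = Re (G * D) - c by case: (G * D).
rewrite ler_norml => /andP[h _]; move: h; rewrite /c; lra.
Qed.

End BumpCenter.

(** * Integration over C^d *)

Section NonnegativeIntegral.
Context d (T : measurableType d) (R : realType).
Variable mu : {measure set T -> \bar R}.

(** The integral of a nonnegative function is a supremum over simple functions,
    hence monotone without any measurability. *)
Lemma ge0_le_integral_sup (f g : T -> \bar R) :
  (forall x, (0 <= f x)%E) -> (forall x, (f x <= g x)%E) ->
  (\int[mu]_x f x <= \int[mu]_x g x)%E.
Proof.
move=> f0 fg; have g0 x : (0 <= g x)%E := le_trans (f0 x) (fg x).
rewrite !ge0_integralTE//; apply: le_ereal_sup => _ [h hf <-].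
by exists h => // x; exact: le_trans (hf x) (fg x).
Qed.

End NonnegativeIntegral.

Section TupleIntegral.
Context d (T : measurableType d) (R : realType).
Variable m : {sigma_finite_measure set T -> \bar R}.

Lemma measurable_tuple_prod n (psi : 'I_n -> T -> R) :
  (forall j, measurable_fun setT (psi j)) ->
  measurable_fun setT (fun t : n.-tuple T => \prod_j psi j (tnth t j)).
Proof.
move=> mpsi; apply: measurable_prod => j _.
by apply: measurableT_comp (mpsi j) _; exact: measurable_tnth.
Qed.

(** The only multiple integrals computed are those of products of functions of
    one variable, by induction on the number of variables. *)
Lemma integral_tuple_prod n (psi : 'I_n -> T -> R) (J : 'I_n -> R) :
  (forall j x, 0 <= psi j x) -> (forall j, measurable_fun setT (psi j)) ->
  (forall j, (\int[m]_x (psi j x)%:E = (J j)%:E)%E) ->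
  (\int[tuple_measure m n]_t (\prod_j psi j (tnth t j))%:E = (\prod_j J j)%:E)%E.
Proof.
elim: n psi J => [|n IH] psi J psi0 mpsi hJ.
  rewrite [LHS]integral_dirac//; last first.
    by apply/measurable_EFinP; exact: measurable_tuple_prod.
  by rewrite diracT mul1e !big_ord0.
have mP : measurable_fun setT (fun t : n.+1.-tuple T => (\prod_j psi j (tnth t j))%:E).
  by apply/measurable_EFinP; exact: measurable_tuple_prod.
have P0 (t : n.+1.-tuple T) : (0 <= (\prod_j psi j (tnth t j))%:E)%E.
  by rewrite lee_fin prodr_ge0.
have mPc := measurableT_comp mP (measurable_cons_pair (n := n)).
transitivity (\int[(m \x tuple_measure m n)%E]_u
    (\prod_j psi j (tnth (cons_pair u) j))%:E)%E.
  by rewrite [LHS](ge0_integral_pushforward (measurable_cons_pair (n := n))).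
rewrite fubini_tonelli1//.
have IHs := IH (fun j => psi (lift ord0 j)) (fun j => J (lift ord0 j))
  (fun j => psi0 _) (fun j => mpsi _) (fun j => hJ _).
have inner x : fubini_F (tuple_measure m n)
    (fun u => (\prod_j psi j (tnth (cons_pair u) j))%:E) x =
    ((\prod_(j < n) J (lift ord0 j)) * psi ord0 x)%:E.
  rewrite /fubini_F.
  under eq_integral => t _.
    rewrite big_ord_recl /cons_pair tnth0 EFinM /=.
    under eq_bigr do rewrite tnthS.
    over.
  rewrite ge0_integralZl//; last 3 first.
  - apply/measurable_EFinP. exact: (@measurable_tuple_prod n (fun j => psi (lift ord0 j))) => j.
  - by move=> t _; rewrite lee_fin prodr_ge0.
  - by rewrite lee_fin.
  by rewrite IHs muleC EFinM.
under eq_integral do rewrite inner EFinM.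
rewrite ge0_integralZl//; last 3 first.
- exact/measurable_EFinP.
- by move=> x _; rewrite lee_fin.
- by rewrite lee_fin prodr_ge0// => j _; rewrite -lee_fin -hJ integral_ge0// => x _; rewrite lee_fin.
by rewrite hJ -EFinM big_ord_recl mulrC.
Qed.

Lemma integral_pair_prod n (psi phi : 'I_n -> T -> R) (J K : 'I_n -> R) :
  (forall j t, 0 <= psi j t) -> (forall j, measurable_fun setT (psi j)) ->
  (forall j, (\int[m]_t (psi j t)%:E = (J j)%:E)%E) ->
  (forall j t, 0 <= phi j t) -> (forall j, measurable_fun setT (phi j)) ->
  (forall j, (\int[m]_t (phi j t)%:E = (K j)%:E)%E) ->
  (\int[tuple_measure m n \x tuple_measure m n]_u ((\prod_j psi j (tnth u.1 j)) * \prod_j phi j (tnth u.2 j))%:E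
   = ((\prod_j J j) * \prod_j K j)%:E)%E.
Proof.
move=> psi0 mpsi hJ phi0 mphi hK.
have mp := measurable_tuple_prod mpsi; have mf := measurable_tuple_prod mphi.
rewrite fubini_tonelli1; last 2 first.
- apply/measurable_EFinP; apply: measurable_funM.
    exact: (measurableT_comp mp measurable_fst).
  exact: (measurableT_comp mf measurable_snd).
- by move=> u; rewrite lee_fin mulr_ge0// prodr_ge0.
rewrite /fubini_F /=.
under eq_integral => t _.
  under eq_integral do rewrite EFinM.
  rewrite ge0_integralZl//; last 3 first.
  - exact/measurable_EFinP.
  - by move=> s _; rewrite lee_fin prodr_ge0.
  - by rewrite lee_fin prodr_ge0.
  rewrite (integral_tuple_prod phi0 mphi hK) muleC.
  over.
rewrite ge0_integralZl//; last 3 first.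
- exact/measurable_EFinP.
- by move=> s _; rewrite lee_fin prodr_ge0.
- rewrite lee_fin prodr_ge0// => j _.
  by rewrite -lee_fin -hK integral_ge0// => t _; rewrite lee_fin.
by rewrite (integral_tuple_prod psi0 mpsi hJ) -EFinM mulrC.
Qed.

End TupleIntegral.

Section CauchyWeight.
Variable R : realType.
Local Notation leb := (@lebesgue_measure R).

Lemma measurable_oneDsqrV : measurable_fun setT (fun x : measurableTypeR R => (1 + x ^+ 2)^-1).
Proof.
apply: continuous_measurable_fun; exact: continuous_oneDsqrV.
Qed.

Lemma integral_oneDsqrV : (\int[leb]_x ((1 + x ^+ 2)^-1)%:E = pi%:E)%E.
Proof.
rewrite (@ge0_symfun_integralT R (fun x => (1 + x ^+ 2)^-1)).
- have := @integral0y_oneDsqr R; rewrite set_itvE /oneDsqr => ->.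
  by rewrite -EFinM mulrC divfK// pnatr_eq0.
- by move=> x; rewrite invr_ge0 addr_ge0// sqr_ge0.
- exact: continuous_oneDsqrV.
- by move=> x /=; rewrite sqrrN.
Qed.

Lemma integral_box (a del : R) : 0 <= del ->
  (\int[leb]_x ((\1_(`[a - del, a + del]) x : R)%:E) = (2 * del)%:E)%E.
Proof.
move=> d0; rewrite integral_indic//= setIT lebesgue_measure_itv/= lte_fin.
rewrite -EFinD; case: ltP => h; first by congr (_%:E); ring.
by congr (_%:E); lra.
Qed.

End CauchyWeight.

(** * Measurability of continuous functions on C^d *)

Section MeasurableContinuous.
Variables (R : realType) (d : nat).
Local Notation C := (CC R).
Local Notation nc := (@Normc.normc R).
Local Notation Re := (@complex.Re R).
Local Notation Im := (@complex.Im R).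
Local Notation TT := (d.-tuple (measurableTypeR R) * d.-tuple (measurableTypeR R))%type.

Definition tuple_zvec (u : TT) : 'rV[C]_d := zvec (rvec u.1) (rvec u.2).

Lemma open_real_ball (O : set 'rV[C]_d) z : open O -> O z ->
  exists2 a : R, 0 < a & forall v, rnorm (z - v) < a -> O v.
Proof.
rewrite openE => oO /oO /nbhs_ballP[r /= r0 h].
have [a rE a0] : exists2 a : R, r = real_complex R a & 0 < a.
  by move: r0; case: r {h} => a b; rewrite ltcE /= => /andP[/eqP -> a0]; exists a.
exists a => // v zv; apply: h; rewrite mx_norm_ball /ball_ /=.
by rewrite rnormE rE ltcR.
Qed.

Lemma measurable_tnth_near (F : TT -> d.-tuple (measurableTypeR R)) (q : 'I_d -> rat) (r : R) j :
  measurable_fun setT F ->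
  measurable [set u | `|tnth (F u) j - ratr (q j)| < r].
Proof.
move=> mF; pose h u := `|tnth (F u) j - ratr (q j)|.
have mh : measurable_fun setT h.
  apply: measurableT_comp => //; apply: measurable_funB => //.
  exact: (measurableT_comp (@measurable_tnth _ _ d j) mF).
rewrite (_ : [set u | _] = setT `&` h @^-1` `]-oo, r[%classic); first exact: mh.
by rewrite setTI; apply/seteqP; split => u; rewrite /= in_itv.
Qed.

(** Product sigma-algebra and topology agree because rational boxes form a
    countable base. *)
Lemma measurable_open_preimage (O : set 'rV[C]_d) : open O ->
  measurable (tuple_zvec @^-1` O).
Proof.
move=> oO.
pose I := ({ffun 'I_d -> rat} * {ffun 'I_d -> rat} * nat)%type.
pose box (i : I) : set TT := [set u | forall j,
  `|tnth u.1 j - ratr (i.1.1 j)| < i.2.+1%:R^-1 /\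
  `|tnth u.2 j - ratr (i.1.2 j)| < i.2.+1%:R^-1].
pose F (i : I) : set TT := if `[< box i `<=` tuple_zvec @^-1` O >] then box i else set0.
have mbox i : measurable (box i).
  rewrite (_ : box i = \bigcap_(j in [set: 'I_d])
    ([set u | `|tnth u.1 j - ratr (i.1.1 j)| < i.2.+1%:R^-1] `&`
     [set u | `|tnth u.2 j - ratr (i.1.2 j)| < i.2.+1%:R^-1])).
    apply: fin_bigcap_measurable; first exact: finite_finset.
    move=> j _; apply: measurableI; apply: measurable_tnth_near.
      exact: measurable_fst.
    exact: measurable_snd.
  by apply/seteqP; split=> u h j; [move=> _; exact: h|exact: h].
rewrite (_ : _ @^-1` _ = \bigcup_i F i).
  apply: countable_bigcupT_measurable; first exact: countableP.
  by move=> i; rewrite /F; case: asboolP => // _; exact: measurable0.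
apply/seteqP; split=> [u Ou|u [i _]]; last first.
  by rewrite /F; case: asboolP => // h; exact: h.
have [a a0 ha] := open_real_ball oO Ou.
pose n := Num.truncn (8 / a).
have hn : n.+1%:R^-1 < a / 8.
  rewrite -[ltRHS]invrK ltf_pV2 ?posrE ?invr_gt0 ?divr_gt0// invf_div.
  exact: truncnS_gt.
have n0 : 0 < n.+1%:R^-1 :> R by rewrite invr_gt0.
pose r := n.+1%:R^-1 : R.
have rat_near (x : R) : exists q : rat, `|x - ratr q| < r.
  have r0 : 0 < r by [].
  have /rat_in_itvoo[q] : x - r < x + r by lra.
  rewrite in_itv /= => /andP[h1 h2]; exists q.
  by rewrite ltr_norml; apply/andP; split; lra.
pose q1 := [ffun j => sval (cid (rat_near (tnth u.1 j)))].
pose q2 := [ffun j => sval (cid (rat_near (tnth u.2 j)))].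
exists (q1, q2, n) => //; rewrite /F asboolT.
  by move=> j /=; rewrite !ffunE; split; exact: (svalP (cid (rat_near _))).
move=> v hv /=; apply: ha.
apply: (@le_lt_trans _ _ (a / 2)); last by lra.
apply: rnorm_le => [|j]; first by lra.
rewrite (le_trans (normc_le_ReIm _))// !mxE /=.
have [/= h1 h2] := hv j; rewrite !ffunE /= -/r in h1 h2; rewrite -/r in hn.
have h3 := svalP (cid (rat_near (tnth u.1 j))).
have h4 := svalP (cid (rat_near (tnth u.2 j))).
move: h1 h2 h3 h4; set r1 := ratr _; set r2 := ratr _.
rewrite !ltr_norml => /andP[? ?] /andP[? ?] /andP[? ?] /andP[? ?].
have -> : a / 2 = a / 4 + a / 4 by field.
by rewrite lerD// ler_norml; apply/andP; split; lra.
Qed.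

Lemma measurable_continuous (phi : C -> R) (f : 'rV[C]_d -> C) :
  (forall z w, `|phi z - phi w| <= nc (z - w)) ->
  (forall z, {for z, continuous f}) ->
  measurable_fun setT (fun u : TT => phi (f (tuple_zvec u))).
Proof.
move=> hphi cf; apply: (measurability _ (RGenOInfty.measurableE R)) => // _ [_ [x ->] <-].
rewrite setTI; pose O := [set z | x < phi (f z)].
rewrite (_ : _ @^-1` _ = tuple_zvec @^-1` O); last first.
  by apply/seteqP; split => u; rewrite /O /= in_itv /= andbT.
apply: measurable_open_preimage; rewrite openE => z Oz.
have e0 : 0 < phi (f z) - x by rewrite subr_gt0.
have /cvgrPdist_lt/(_ (real_complex R (phi (f z) - x))) := cf z.
rewrite -[0 < _]/((0 : R[i]) < _) -[0]/(real_complex R 0) ltcR => /(_ e0).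
apply: filterS => w; rewrite [X in X < _]normC_normc ltcR => h.
have := le_lt_trans (hphi _ _) h; rewrite /O /= ltr_norml => /andP[]; lra.
Qed.

Lemma dist_Re (z w : C) : `|Re z - Re w| <= nc (z - w).
Proof. by apply: le_trans (normc_ge_absRe _); case: z w => a b [a' b']. Qed.

Lemma dist_Im (z w : C) : `|Im z - Im w| <= nc (z - w).
Proof. by apply: le_trans (normc_ge_absIm _); case: z w => a b [a' b']. Qed.

Lemma dist_normc (z w : C) : `|nc z - nc w| <= nc (z - w).
Proof.
have h1 := normcCD (z - w) w; have h2 := normcCD (w - z) z.
rewrite !subrK in h1 h2; rewrite normcC_distC in h2.
by rewrite ler_norml; apply/andP; split; lra.
Qed.

End MeasurableContinuous.

(** * Equivalence of norms *)

Section NormEquivalence.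
Variables (R : realType) (n : nat) (nrm : 'rV[R]_n -> R).
Hypothesis hnrm : is_norm nrm.
Implicit Types x y : 'rV[R]_n.

Lemma is_norm0 : nrm 0 = 0.
Proof. by have [_ h _] := hnrm; rewrite -(scale0r 0) h normr0 mul0r. Qed.

Lemma is_normN x : nrm (- x) = nrm x.
Proof. by have [_ h _] := hnrm; rewrite -scaleN1r h normrN1 mul1r. Qed.

Lemma is_norm_triangle x y : nrm (x + y) <= nrm x + nrm y.
Proof. by have [_ _ h] := hnrm; exact: h. Qed.

Lemma is_normZ a x : nrm (a *: x) = `|a| * nrm x.
Proof. by have [_ h _] := hnrm; exact: h. Qed.

Lemma is_norm_ge0 x : 0 <= nrm x.
Proof.
have := is_norm_triangle x (- x); rewrite subrr is_norm0 is_normN -mulr2n.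
by rewrite pmulrn_lge0.
Qed.

Lemma is_norm_le_norm1 : exists2 M, 0 < M & forall x, nrm x <= M * norm1 x.
Proof.
pose M := 1 + \sum_j nrm (delta_mx ord0 j).
have hM j : nrm (delta_mx ord0 j) <= M.
  rewrite /M (bigD1 j)//= addrCA lerDl addr_ge0// sumr_ge0// => i _.
  exact: is_norm_ge0.
exists M => [|x].
  by rewrite ltr_wpDr// sumr_ge0// => i _; exact: is_norm_ge0.
rewrite {1}(row_sum_delta x) /norm1 mulr_sumr.
elim/big_ind2: _ => [|x1 x2 y1 y2 h1 h2|j _]; first by rewrite is_norm0.
  by rewrite (le_trans (is_norm_triangle _ _))// lerD.
by rewrite is_normZ mulrC ler_wpM2r.
Qed.

Lemma coord_le_norm x j : `|x ord0 j| <= `|x|.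
Proof.
rewrite [leRHS]/Num.norm/= mx_normrE.
exact: (le_bigmax _ (fun i : 'I_1 * 'I_n => `|x i.1 i.2|) (ord0, j)).
Qed.

Lemma norm_le_coord x e : 0 <= e -> (forall j, `|x ord0 j| <= e) -> `|x| <= e.
Proof.
move=> e0 h; rewrite [leLHS]/Num.norm/= mx_normrE; apply/bigmax_leP; split=> //.
by move=> [i j] _ /=; rewrite ord1.
Qed.

Lemma norm_le_norm1 x : `|x| <= norm1 x.
Proof.
apply: norm_le_coord => [|j]; first exact: norm1_ge0.
by rewrite /norm1 (bigD1 j)//= lerDl sumr_ge0.
Qed.

Lemma norm1_le_norm x : norm1 x <= n%:R * `|x|.
Proof.
rewrite mulr_natl -[X in _ *+ X]card_ord -sumr_const ler_sum// => j _.
exact: coord_le_norm.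
Qed.

(** By compactness of the unit sphere of the sup norm, where [nrm] has a positive
    minimum. *)
Lemma is_norm_ge_norm1 : exists2 m, 0 < m & forall x, m * norm1 x <= nrm x.
Proof.
have [M M0 hM] := is_norm_le_norm1.
pose S := [set x : 'rV[R]_n | `|x| = 1].
have [S0|/set0P/negP/negPn/eqP S0] := pselect (S !=set0); last first.
  exists 1 => // x; have [->|x0] := eqVneq x 0.
    by rewrite is_norm0 /norm1 big1 ?mulr0// => j _; rewrite mxE normr0.
  have : S (`|x|^-1 *: x).
    by rewrite /S /= normrZ normfV normr_id mulVf// normr_eq0.
  by rewrite S0.
have cS : compact S.
  apply: bounded_closed_compact.
    by exists 1; split; rewrite ?num_real// => a a1 x /= ->; exact: ltW.
  rewrite (_ : S = Num.norm @^-1` [set 1]).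
    by apply: preimage_closed; [move=> ? _; exact: norm_continuous|exact: closed_eq].
  by [].
have Mn : 0 < M * (n%:R + 1) by rewrite mulr_gt0// ltr_wpDl.
have cn : continuous nrm.
  move=> x; apply: (proj2 (@cvgrPdist_le _ _ _ (nbhs x) _ _ _)) => e e0; near=> y.
  have hxy a b : nrm a - nrm b <= nrm (a - b).
    by rewrite lerBlDr -{1}[a](subrK b) is_norm_triangle.
  apply: (@le_trans _ _ (nrm (x - y))).
    rewrite ler_norml hxy andbT lerNl opprB (le_trans (hxy _ _))//.
    by rewrite -is_normN opprB.
  apply: (le_trans (hM _)); apply: (le_trans (ler_wpM2l (ltW M0) (norm1_le_norm _))).
  apply: (@le_trans _ _ (M * (n%:R + 1) * `|x - y|)).
    by rewrite -mulrA ler_wpM2l ?(ltW M0)// ler_wpM2r// lerDl.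
  rewrite -ler_pdivlMl//; near: y; apply/nbhs_ballP.
  exists ((M * (n%:R + 1))^-1 * e); first by rewrite /= mulr_gt0// invr_gt0.
  by move=> z; rewrite mx_norm_ball => /ltW.
have [c cS1 hc] := EVT_min_rV S0 cS (continuous_subspaceT cn).
have c1 : `|c| = 1 by move: cS1; rewrite inE.
have c0 : 0 < nrm c.
  rewrite lt_def is_norm_ge0 andbT; apply/eqP => nc0.
  have [h _ _] := hnrm; have := c1; rewrite (h _ nc0) normr0 => /eqP.
  by rewrite eq_sym oner_eq0.
have m0 : 0 < nrm c / (n%:R + 1) by rewrite divr_gt0// ltr_wpDl.
exists (nrm c / (n%:R + 1)) => // x.
have [->|x0] := eqVneq x 0.
  by rewrite is_norm0 /norm1 big1 ?mulr0// => j _; rewrite mxE normr0.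
have nx : 0 < `|x| by rewrite normr_gt0.
have := hc (`|x|^-1 *: x); rewrite inE /S /= normrZ normfV normr_id mulVf ?gt_eqF//.
move=> /(_ erefl); rewrite is_normZ normfV normr_id ler_pdivlMl// => h.
have n1 : 0 < n%:R + 1 :> R by rewrite ltr_wpDl.
apply: le_trans h; rewrite mulrAC ler_pdivrMr// [`|x| * _]mulrC -mulrA.
rewrite ler_wpM2l ?(ltW c0)// (le_trans (norm1_le_norm x))//.
by rewrite mulrC ler_wpM2l// lerDl.
Unshelve. all: by end_near. Qed.

End NormEquivalence.

(** * Weights, and functions bounded by an exponential *)

Section DistWeight.
Variables (R : realType) (d : nat) (beta : R) (nrm : 'rV[R]_d -> R).
Hypotheses (hbeta : 0 <= beta < 1) (hnrm : is_norm nrm).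
Local Notation C := (CC R).
Local Notation nc := (@Normc.normc R).
Local Notation leb := (tuple_measure (@lebesgue_measure R) d).
Implicit Types (x y : 'rV[R]_d) (U : set 'rV[R]_d).

Lemma powR_ge_sub1 (t p : R) : 0 <= t -> 1 <= p -> t - 1 <= t `^ p.
Proof.
move=> t0 p1; have [t1|t1] := leP t 1.
  by rewrite (le_trans _ (powR_ge0 _ _))// subr_le0.
have h : t `^ 1 <= t `^ p by apply: ler_powR => //; exact: ltW.
by rewrite powRr1// in h; lra.
Qed.

Lemma exponent_ge1 : 1 <= (1 - beta)^-1.
Proof.
by move: hbeta => /andP[b0 b1]; rewrite invf_ge1; lra.
Qed.

Lemma dist_set_ge0 x U : 0 <= dist_set nrm x U.
Proof.
have [[u Uu]|/set0P/negP/negPn/eqP ->] := pselect (U !=set0).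
  apply: lb_le_inf; first by exists (nrm (x - u)), u.
  by move=> _ [v _ <-]; exact: is_norm_ge0.
by rewrite /dist_set image_set0 inf0.
Qed.

Lemma dist_set_le x U u : U u -> dist_set nrm x U <= nrm (x - u).
Proof.
move=> Uu; apply: ge_inf; last by exists u.
by exists 0 => _ [v _ <-]; exact: is_norm_ge0.
Qed.

Lemma le_dist_set x U a : U !=set0 -> (forall u, U u -> a <= nrm (x - u)) ->
  a <= dist_set nrm x U.
Proof.
move=> [u Uu] h; apply: lb_le_inf; first by exists (nrm (x - u)), u.
by move=> _ [v Uv <-]; exact: h.
Qed.

Lemma dist_set_in x U : U x -> dist_set nrm x U = 0.
Proof.
move=> Ux; apply/eqP; rewrite eq_le dist_set_ge0 andbT.
by rewrite (le_trans (dist_set_le x Ux))// subrr is_norm0.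
Qed.

Lemma dist_setZ x U B : cone U -> 0 < B ->
  B * dist_set nrm x U <= dist_set nrm (B *: x) U.
Proof.
move=> [U0 cU] B0; apply: le_dist_set => // u Uu.
have -> : nrm (B *: x - u) = B * nrm (x - B^-1 *: u).
  transitivity (nrm (B *: (x - B^-1 *: u))).
    by rewrite scalerBr scalerA divff ?gt_eqF// scale1r.
  by rewrite (is_normZ hnrm) gtr0_norm.
by rewrite ler_wpM2l ?(ltW B0)// dist_set_le//; apply: cU => //; rewrite invr_gt0.
Qed.

Lemma weight_ge0 U B N x y : 0 <= weight beta nrm U B N x y.
Proof.
by rewrite /weight mulr_ge0 ?expR_ge0// prodr_ge0//.
Qed.

Lemma prod_polyw N x : \prod_(j < d) (1 + `|x ord0 j|) ^+ (2 * N) = (polyw x ^+ N) ^+ 2.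
Proof. by rewrite -exprM mulnC /polyw prodrXl. Qed.

(** The constant [4] pays for [t - 1 <= t `^ p], used for each of the two terms of
    the exponent. *)
Lemma weight_le U B N x y : cone U -> 0 < B ->
  weight beta nrm U B N x y <=
  (polyw x ^+ N) ^+ 2 * expR (4 - 2 * (B * dist_set nrm x U) - 2 * (B * nrm y)).
Proof.
move=> cU B0; rewrite /weight prod_polyw ler_wpM2l ?sqr_ge0// ler_expR.
have h1 := powR_ge_sub1 (dist_set_ge0 (B *: x) U) exponent_ge1.
have h2 := powR_ge_sub1 (is_norm_ge0 hnrm (B *: y)) exponent_ge1.
have h3 := dist_setZ x cU B0.
rewrite (is_normZ hnrm) (gtr0_norm B0) in h2 *.
rewrite mulNr; lra.
Qed.

Lemma weight_ge U B N x y A : dist_set nrm (B *: x) U <= A -> nrm (B *: y) <= A ->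
  (polyw x ^+ N) ^+ 2 * expR (- 4 * A `^ (1 - beta)^-1) <= weight beta nrm U B N x y.
Proof.
move=> h1 h2; rewrite /weight prod_polyw ler_wpM2l ?sqr_ge0// ler_expR.
have p0 : 0 <= (1 - beta)^-1 by rewrite (le_trans _ exponent_ge1).
have A0 : 0 <= A := le_trans (dist_set_ge0 _ _) h1.
have k1 := ge0_ler_powR p0 (dist_set_ge0 (B *: x) U) A0 h1.
have k2 := ge0_ler_powR p0 (is_norm_ge0 hnrm (B *: y)) A0 h2.
rewrite !mulNr; lra.
Qed.

Lemma sqr_le_expR (m : R) : 0 < m -> exists2 c, 0 < c &
  forall t, expR (- (2 * (m * `|t|))) <= c * (1 + t ^+ 2)^-1.
Proof.
move=> m0; pose c := 1 + (2 * m ^+ 2)^-1.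
have m2 : 0 < 2 * m ^+ 2 by rewrite mulr_gt0// exprn_gt0.
have c0 : 0 < c by rewrite ltr_wpDr// invr_ge0 ltW.
exists c => // t; have t1 : 0 < 1 + t ^+ 2 by rewrite ltr_wpDr// sqr_ge0.
rewrite ler_pdivlMr// expRN mulrC ler_pdivrMr ?expR_gt0//.
have mt : 0 <= 2 * (m * `|t|) by rewrite mulr_ge0// mulr_ge0// ltW.
have := expR_ge1Dxn 1 mt; rewrite (_ : 2`! = 2)// => h.
apply: (@le_trans _ _ (c * (1 + 2 * m ^+ 2 * t ^+ 2))).
  rewrite (_ : c * _ = 1 + t ^+ 2 + (2 * m ^+ 2 * t ^+ 2 + (2 * m ^+ 2)^-1)).
    by rewrite lerDl addr_ge0 ?invr_ge0 ?(ltW m2)// mulr_ge0 ?(ltW m2)// sqr_ge0.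
  by rewrite /c; field; rewrite gt_eqF.
rewrite ler_wpM2l ?(ltW c0)//; apply: le_trans h.
rewrite !exprMn real_normK ?num_real// lerD2l.
have : 0 <= m ^+ 2 * t ^+ 2 by rewrite mulr_ge0// sqr_ge0.
by lra.
Qed.

(** A product of Cauchy densities, the common majorant of all the integrands. *)
Definition cauchyV x : R := \prod_j (1 + (x ord0 j) ^+ 2)^-1.

Lemma cauchyV_gt0 x : 0 < cauchyV x.
Proof. by rewrite prodr_gt0// => j _; rewrite invr_gt0 ltr_pwDl// sqr_ge0. Qed.

Lemma polyw_cauchyV x : (polyw x ^+ 2)^-1 <= cauchyV x.
Proof.
rewrite /polyw /cauchyV -prodrXl -prodfV; apply: ler_prod => j _.
have x0 : 0 <= `|x ord0 j| by [].
have x2 : (x ord0 j) ^+ 2 = `|x ord0 j| ^+ 2 by rewrite real_normK ?num_real.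
rewrite invr_ge0 sqr_ge0 /= lef_pV2 ?posrE ?exprn_gt0 ?ltr_pwDl ?sqr_ge0//.
by rewrite x2 sqrrD expr1n mul1r lerD2r lerDl mulrn_wge0.
Qed.

Lemma integral_cauchyV : (\int[leb \x leb]_u
  ((cauchyV (rvec u.1)) * cauchyV (rvec u.2))%:E = (pi ^+ d * pi ^+ d)%:E)%E.
Proof.
have := @integral_pair_prod _ _ R (@lebesgue_measure R) d (fun=> fun t => (1 + t ^+ 2)^-1)
  (fun=> fun t => (1 + t ^+ 2)^-1) (fun=> pi) (fun=> pi).
rewrite prodr_const card_ord => <-.
- apply: eq_integral => u _; rewrite /cauchyV; congr ((_ * _)%:E).
    by apply: eq_bigr => j _; rewrite mxE.
  by apply: eq_bigr => j _; rewrite mxE.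
- by move=> _ t; rewrite invr_ge0 addr_ge0// sqr_ge0.
- by move=> _; exact: measurable_oneDsqrV.
- by move=> _; exact: integral_oneDsqrV.
- by move=> _ t; rewrite invr_ge0 addr_ge0// sqr_ge0.
- by move=> _; exact: measurable_oneDsqrV.
- by move=> _; exact: integral_oneDsqrV.
Qed.

Lemma measurable_cauchyV : measurable_fun setT
  (fun u : d.-tuple (measurableTypeR R) * d.-tuple (measurableTypeR R) =>
    cauchyV (rvec u.1) * cauchyV (rvec u.2)).
Proof.
have h := @measurable_tuple_prod _ _ R d (fun=> fun x : measurableTypeR R => (1 + x ^+ 2)^-1)
  (fun=> @measurable_oneDsqrV R).
have h' : measurable_fun setT (fun t : d.-tuple (measurableTypeR R) => cauchyV (rvec t)).
  rewrite (_ : (fun t => _) = fun t : d.-tuple (measurableTypeR R) => \prod_(j < d) (1 + tnth t j ^+ 2)^-1)//.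
  by apply/funext => t; apply: eq_bigr => j _; rewrite mxE.
apply: measurable_funM.
  exact: (measurableT_comp h' measurable_fst).
exact: (measurableT_comp h' measurable_snd).
Qed.

(** Any pointwise bound of type 1 is enough for all [beta], since
    [t <= 1 + t `^ p] for [p >= 1]; the constant [k] only depends on the norm. *)
Lemma sqnorm_bound : exists2 k, 0 < k & forall U B N (f : 'rV[C]_d -> C) K B0,
  cone U -> 0 < B -> B0 + 1 <= B -> 0 <= K ->
  (forall x y, nc (f (zvec x y)) * polyw x ^+ N.+1 <=
     K * expR (B0 * (dist_set nrm x U + nrm y))) ->
  (sqnorm beta nrm U B N f <= (K ^+ 2 * k)%:E)%E.
Proof.
have [m m0 hm] := is_norm_ge_norm1 hnrm.
have [c c0 hc] := sqr_le_expR m0.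
pose k := expR 4 * c ^+ d * (pi ^+ d * pi ^+ d).
have k0 : 0 < k by rewrite !mulr_gt0 ?expR_gt0 ?exprn_gt0 ?pi_gt0.
exists k => // U B N f K B0 cU Bp BB K0 hf.
have yb y : expR (- (2 * nrm y)) <= c ^+ d * cauchyV y.
  apply: (@le_trans _ _ (expR (- (2 * (m * norm1 y))))).
    by rewrite ler_expR lerN2 ler_wpM2l// hm.
  rewrite /norm1 !mulr_sumr -sumrN expR_sum /cauchyV -[X in c ^+ X]card_ord.
  by rewrite -prodr_const -big_split; apply: ler_prod => j _; rewrite expR_ge0 hc.
pose A := K ^+ 2 * expR 4 * c ^+ d.
have A0 : 0 <= A by rewrite !mulr_ge0 ?sqr_ge0 ?expR_ge0// exprn_ge0// ltW.
apply: (@le_trans _ _ (\int[leb \x leb]_u (A * (cauchyV (rvec u.1) * cauchyV (rvec u.2)))%:E)%E).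
  apply: ge0_le_integral_sup => u; rewrite lee_fin.
    by rewrite mulr_ge0 ?sqr_ge0 ?weight_ge0.
  set x := rvec u.1; set y := rvec u.2.
  have P0 : 0 < polyw x by rewrite (lt_le_trans ltr01)// polyw_ge1.
  rewrite (le_trans (ler_wpM2l (sqr_ge0 _) (weight_le _ _ _ cU Bp)))//.
  set D := dist_set nrm x U; have D0 : 0 <= D := dist_set_ge0 _ _.
  have n0 := is_norm_ge0 hnrm y.
  have -> : nc (f (zvec x y)) ^+ 2 * ((polyw x ^+ N) ^+ 2 * expR (4 - 2 * (B * D) - 2 * (B * nrm y))) =
     (nc (f (zvec x y)) * polyw x ^+ N.+1) ^+ 2 * (polyw x ^+ 2)^-1 * expR (4 - 2 * (B * D) - 2 * (B * nrm y)).
    by rewrite [polyw x ^+ N.+1]exprSr; field; rewrite gt_eqF.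
  have h1 : (nc (f (zvec x y)) * polyw x ^+ N.+1) ^+ 2 <= (K * expR (B0 * (D + nrm y))) ^+ 2.
    by rewrite lerXn2r ?nnegrE ?mulr_ge0 ?normcC_ge0 ?exprn_ge0 ?expR_ge0 ?(ltW P0)// hf.
  apply: (@le_trans _ _ ((K * expR (B0 * (D + nrm y))) ^+ 2 * cauchyV x * expR (4 - 2 * (B * D) - 2 * (B * nrm y)))).
    rewrite ler_wpM2r ?expR_ge0// ler_pM ?sqr_ge0 ?invr_ge0 ?sqr_ge0//.
    exact: polyw_cauchyV.
  have -> : A * (cauchyV x * cauchyV y) = K ^+ 2 * cauchyV x * (expR 4 * (c ^+ d * cauchyV y)).
    by rewrite /A; ring.
  have -> : (K * expR (B0 * (D + nrm y))) ^+ 2 * cauchyV x * expR (4 - 2 * (B * D) - 2 * (B * nrm y)) =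
     K ^+ 2 * cauchyV x * expR (2 * (B0 * (D + nrm y)) + (4 - 2 * (B * D) - 2 * (B * nrm y))).
    by rewrite exprMn -expRM_natl [in RHS]expRD; ring.
  rewrite ler_wpM2l ?mulr_ge0 ?sqr_ge0 ?(ltW (cauchyV_gt0 _))//.
  apply: (@le_trans _ _ (expR 4 * expR (- (2 * nrm y)))); last first.
    by rewrite ler_wpM2l ?expR_ge0.
  rewrite -expRD ler_expR.
  have : (B0 + 1) * D <= B * D by rewrite ler_wpM2r.
  have : (B0 + 1) * nrm y <= B * nrm y by rewrite ler_wpM2r.
  by lra.
under eq_integral do rewrite EFinM.
rewrite ge0_integralZl//; last 2 first.
- by apply/measurable_EFinP; exact: measurable_cauchyV.
- by move=> u _; rewrite lee_fin mulr_ge0// ltW// cauchyV_gt0.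
rewrite integral_cauchyV -EFinM lee_fin /A /k le_eqVlt; apply/orP; left.
by apply/eqP; ring.
Qed.

End DistWeight.

(** * The functional integrating over a set *)

Section BoxFunctional.
Variables (R : realType) (d : nat) (beta : R) (nrm : 'rV[R]_d -> R).
Hypotheses (hbeta : 0 <= beta < 1) (hnrm : is_norm nrm).
Local Notation C := (CC R).
Local Notation nc := (@Normc.normc R).
Local Notation Re := (@complex.Re R).
Local Notation Im := (@complex.Im R).
Local Notation leb := (tuple_measure (@lebesgue_measure R) d).
Local Notation mu := (leb \x leb)%E.
Local Notation TT := (d.-tuple (measurableTypeR R) * d.-tuple (measurableTypeR R))%type.

Variables (Q : set TT) (Y : R).
Hypotheses (mQ : measurable Q) (Y0 : 0 <= Y).
Hypothesis QY : forall u, Q u -> forall j, `|tnth u.2 j| <= Y.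

Definition Qfun (f : 'rV[C]_d -> C) : C :=
  (\int[mu]_u (Re (f (tuple_zvec u)) * \1_Q u)) +i*
  (\int[mu]_u (Im (f (tuple_zvec u)) * \1_Q u)).

Definition Qintegrable (f : 'rV[C]_d -> C) : Prop :=
  [/\ forall z, {for z, continuous f},
      mu.-integrable setT (EFin \o (fun u => Re (f (tuple_zvec u)) * \1_Q u)) &
      mu.-integrable setT (EFin \o (fun u => Im (f (tuple_zvec u)) * \1_Q u))].

Definition Qalmost_in (U : set 'rV[R]_d) := exists X0, forall u, Q u ->
  norm1 (rvec u.1) <= X0 \/ U (rvec u.1).

Lemma Qfun_linear (a b : C) f g : Qintegrable f -> Qintegrable g ->
  Qintegrable (a *: f + b *: g) /\ Qfun (a *: f + b *: g) = a * Qfun f + b * Qfun g.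
Proof.
move=> [cf rf jf] [cg rg jg].
case: a b => [a1 a2] [b1 b2].
pose comb (s1 s2 s3 s4 : R) u :=
  s1 * (Re (f (tuple_zvec u)) * \1_Q u) + s2 * (Im (f (tuple_zvec u)) * \1_Q u) +
  (s3 * (Re (g (tuple_zvec u)) * \1_Q u) + s4 * (Im (g (tuple_zvec u)) * \1_Q u)).
have icomb s1 s2 s3 s4 : mu.-integrable setT (EFin \o comb s1 s2 s3 s4) /\
    \int[mu]_u comb s1 s2 s3 s4 u =
    s1 * (\int[mu]_u (Re (f (tuple_zvec u)) * \1_Q u)) +
    s2 * (\int[mu]_u (Im (f (tuple_zvec u)) * \1_Q u)) +
    (s3 * (\int[mu]_u (Re (g (tuple_zvec u)) * \1_Q u)) +
     s4 * (\int[mu]_u (Im (g (tuple_zvec u)) * \1_Q u))).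
  have Z s (h : TT -> R) : mu.-integrable setT (EFin \o h) ->
      mu.-integrable setT (EFin \o (fun u => s * h u)).
    move=> ih; rewrite (_ : _ \o _ = fun u => s%:E * (EFin \o h) u)%E.
      exact: integrableZl.
    by apply/funext => u; rewrite /= EFinM.
  have D (h k : TT -> R) : mu.-integrable setT (EFin \o h) ->
      mu.-integrable setT (EFin \o k) ->
      mu.-integrable setT (EFin \o (fun u => h u + k u)).
    move=> ih ik; rewrite (_ : _ \o _ = ((EFin \o h) \+ (EFin \o k))%E).
      exact: integrableD.
    by apply/funext => u; rewrite /= EFinD.
  split; first by apply: (D _ _ (D _ _ (Z _ _ _) (Z _ _ _)) (D _ _ (Z _ _ _) (Z _ _ _))).
  rewrite /comb RintegralD//; last 2 first.
  - exact: D _ _ (Z _ _ _) (Z _ _ _).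
  - exact: D _ _ (Z _ _ _) (Z _ _ _).
  rewrite RintegralD//; [|exact: Z|exact: Z].
  rewrite [X in _ + X = _]RintegralD//; [|exact: Z|exact: Z].
  by rewrite !RintegralZl.
have ReE u : Re (((a1 +i* a2) *: f + (b1 +i* b2) *: g) (tuple_zvec u)) * \1_Q u =
    comb a1 (- a2) b1 (- b2) u.
  rewrite -[(_ + _) _]/((a1 +i* a2 : C) * f (tuple_zvec u) + (b1 +i* b2 : C) * g (tuple_zvec u)).
  by rewrite /comb; case: (f _) (g _) => [f1 f2] [g1 g2] /=; ring.
have ImE u : Im (((a1 +i* a2) *: f + (b1 +i* b2) *: g) (tuple_zvec u)) * \1_Q u =
    comb a2 a1 b2 b1 u.
  rewrite -[(_ + _) _]/((a1 +i* a2 : C) * f (tuple_zvec u) + (b1 +i* b2 : C) * g (tuple_zvec u)).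
  by rewrite /comb; case: (f _) (g _) => [f1 f2] [g1 g2] /=; ring.
have [i1 e1] := icomb a1 (- a2) b1 (- b2); have [i2 e2] := icomb a2 a1 b2 b1.
split; first split.
- move=> z; have cst c : {for z, continuous (fun _ : 'rV[C]_d => c : C)}.
    exact: cst_continuous.
  exact: (@continuousD C _ _ _ _ z (continuousM (cst _) (cf z)) (continuousM (cst _) (cg z))).
- by under [_ \o _]funext => u do rewrite /= ReE.
- by under [_ \o _]funext => u do rewrite /= ImE.
rewrite /Qfun; under eq_Rintegral do rewrite ReE.
under [X in _ +i* X]eq_Rintegral do rewrite ImE.
rewrite e1 e2 -[RHS]/(((a1 * _ - a2 * _) + (b1 * _ - b2 * _)) +i*
  ((a1 * _ + a2 * _) + (b1 * _ + b2 * _))).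
by congr (_ +i* _); ring.
Qed.

Lemma measurable_polyw : measurable_fun setT (fun u : TT => polyw (rvec u.1)).
Proof.
have h : measurable_fun setT (fun t : d.-tuple (measurableTypeR R) => polyw (rvec t)).
  have := @measurable_tuple_prod _ (measurableTypeR R) R d (fun=> fun s => 1 + `|s|).
  rewrite (_ : (fun t : d.-tuple _ => _) = fun t : d.-tuple (measurableTypeR R) => polyw (rvec t)).
    by apply => _; apply: measurable_funD => //; exact: measurableT_comp.
  by apply/funext => t; apply: eq_bigr => j _; rewrite mxE.
exact: (measurableT_comp h measurable_fst).
Qed.

Lemma Q_cauchyV u : \1_Q u <= (1 + Y ^+ 2) ^+ d * cauchyV (rvec u.2).
Proof.
have Y1 : 0 < 1 + Y ^+ 2 by rewrite ltr_pwDl// sqr_ge0.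
rewrite indicE; case: (boolP (u \in Q)) => [|_]; last first.
  by rewrite mulr_ge0 ?exprn_ge0 ?(ltW Y1)// ltW// cauchyV_gt0.
rewrite inE => Qu; rewrite /cauchyV -[X in _ ^+ X]card_ord -prodr_const -big_split.
rewrite [leLHS](_ : _ = \prod_(j < d) 1); last by rewrite big1.
apply: ler_prod => j _; rewrite ler01 /= ler_pdivlMr ?mul1r ?ltr_pwDl ?sqr_ge0//.
rewrite mxE lerD2l -[leLHS]real_normK ?num_real// lerXn2r ?nnegrE//.
exact: QY.
Qed.

Lemma Qweight_ge U B : cone U -> Qalmost_in U -> 0 < B ->
  exists2 k, 0 < k & forall u, Q u ->
    k * polyw (rvec u.1) ^+ 2 <= weight beta nrm U B 1 (rvec u.1) (rvec u.2).
Proof.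
move=> [[u0 Uu0] cU] [X0 hX] B0.
have [M M0 hM] := is_norm_le_norm1 hnrm.
pose A := Num.max (B * (M * X0) + nrm u0) (B * (M * (d%:R * Y))).
exists (expR (- 4 * A `^ (1 - beta)^-1)); first exact: expR_gt0.
move=> u Qu; rewrite mulrC -[polyw _ ^+ 2](_ : (polyw (rvec u.1) ^+ 1) ^+ 2 = _); last by rewrite expr1.
have yA : nrm (B *: rvec u.2) <= A.
  rewrite le_max; apply/orP; right; rewrite (is_normZ hnrm) gtr0_norm//.
  rewrite ler_wpM2l ?(ltW B0)// (le_trans (hM _))// ler_wpM2l ?(ltW M0)//.
  rewrite mulr_natl -[X in _ *+ X]card_ord -sumr_const ler_sum// => j _.
  by rewrite mxE QY.
apply: weight_ge => //; have [h|h] := hX u Qu.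
  rewrite le_max; apply/orP; left.
  rewrite (le_trans (dist_set_le hnrm _ Uu0))// (le_trans (is_norm_triangle hnrm _ _))//.
  rewrite (is_normN hnrm) lerD2r (is_normZ hnrm) gtr0_norm//.
  by rewrite ler_wpM2l ?(ltW B0)// (le_trans (hM _))// ler_wpM2l ?(ltW M0).
rewrite dist_set_in//; last exact: cU.
exact: le_trans (is_norm_ge0 hnrm _) yA.
Qed.

(** The inequality [2 * a * b <= t * a ^+ 2 + b ^+ 2 / t], applied with
    [a ^+ 2] the integrand of [sqnorm] and [b ^+ 2] its inverse weight on [Q], has
    the effect of Cauchy-Schwarz without square roots of integrals. *)
Lemma Qfun_abs_bound U (B : R) : cone U -> Qalmost_in U -> 0 < B ->
  exists2 k : R, 0 < k & forall (t : R) (f : 'rV[C]_d -> C), 0 < t ->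
    (forall z, {for z, continuous f}) ->
  (\int[mu]_u (nc (f (tuple_zvec u)) * \1_Q u)%:E <=
    (k * t)%:E * sqnorm beta nrm U B 1 f + (k / t)%:E)%E.
Proof.
move=> cU QU B0; have [w w0 hw] := Qweight_ge cU QU B0.
pose P : R := (1 + Y ^+ 2) ^+ d * (pi ^+ d * pi ^+ d).
have Y1 : 0 < 1 + Y ^+ 2 by rewrite ltr_pwDl// sqr_ge0.
have P0 : 0 < P by rewrite !mulr_gt0 ?exprn_gt0 ?pi_gt0.
exists (w^-1 + P); first by rewrite addr_gt0 ?invr_gt0.
move=> t f t0 cf.
have mf : measurable_fun setT (fun u : TT => nc (f (tuple_zvec u))).
  exact: (measurable_continuous (@dist_normc R) cf).
have m1 : measurable_fun setT (fun u : TT => \1_Q u : R).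
  exact: measurable_indic.
pose g u := nc (f (tuple_zvec u)) ^+ 2 * polyw (rvec u.1) ^+ 2 * \1_Q u.
pose h (u : TT) := cauchyV (rvec u.1) * cauchyV (rvec u.2).
have g0 u : 0 <= g u by rewrite mulr_ge0// mulr_ge0// sqr_ge0.
have h0 u : 0 <= h u by rewrite mulr_ge0//; exact: ltW (cauchyV_gt0 _).
have mg : measurable_fun setT g.
  apply: measurable_funM => //; apply: measurable_funM; apply: measurable_funX => //.
  exact: measurable_polyw.
have mh : measurable_fun setT h by exact: measurable_cauchyV.
have gS : (\int[mu]_u (g u)%:E <= w^-1%:E * sqnorm beta nrm U B 1 f)%E.
  rewrite -[leLHS]mul1e -(mulVf (lt0r_neq0 w0)) EFinM -muleA.
  rewrite lee_wpmul2l ?lee_fin ?invr_ge0 ?(ltW w0)//.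
  rewrite -ge0_integralZl//; last 3 first.
  - exact/measurable_EFinP.
  - by move=> u _; rewrite lee_fin.
  - by rewrite lee_fin ltW.
  apply: ge0_le_integral_sup => u; first by rewrite -EFinM lee_fin mulr_ge0// ltW.
  rewrite -EFinM lee_fin /g indicE; case: (boolP (u \in Q)) => [|_]; last first.
    by rewrite !mulr0 mulr_ge0 ?sqr_ge0 ?weight_ge0.
  rewrite inE => Qu; rewrite mulr1 mulrCA ler_wpM2l ?sqr_ge0//.
  exact: hw.
apply: (@le_trans _ _ (\int[mu]_u ((t * g u)%:E + ((1 + Y ^+ 2) ^+ d / t * h u)%:E))%E).
  apply: ge0_le_integral_sup => u; first by rewrite lee_fin mulr_ge0 ?normcC_ge0.
  rewrite -EFinD lee_fin.
  have hQ := Q_cauchyV u.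
  have polyw0 : 0 < polyw (rvec u.1) by rewrite (lt_le_trans ltr01)// polyw_ge1.
  have hX := polyw_cauchyV (rvec u.1).
  apply: (@le_trans _ _ (t * g u + t^-1 * ((polyw (rvec u.1) ^+ 2)^-1 * \1_Q u))); last first.
    rewrite lerD2l [_ / t]mulrC -mulrA ler_wpM2l ?invr_ge0 ?(ltW t0)// /h.
    rewrite mulrCA ler_pM ?invr_ge0 ?sqr_ge0//.
  rewrite /g; move: (nc _) (normcC_ge0 (f (tuple_zvec u))) => a a0.
  have i0 : 0 <= \1_Q u :> R by [].
  have -> : t * (a ^+ 2 * polyw (rvec u.1) ^+ 2 * \1_Q u) + t^-1 * ((polyw (rvec u.1) ^+ 2)^-1 * \1_Q u) =
     (t * (a ^+ 2 * polyw (rvec u.1) ^+ 2) + t^-1 * (polyw (rvec u.1) ^+ 2)^-1) * \1_Q u by ring.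
  rewrite ler_wpM2r//.
  have tP : 0 < t * polyw (rvec u.1) ^+ 2 by rewrite mulr_gt0// exprn_gt0.
  have -> : t * (a ^+ 2 * polyw (rvec u.1) ^+ 2) + t^-1 * (polyw (rvec u.1) ^+ 2)^-1 =
    (t * polyw (rvec u.1) ^+ 2) * a ^+ 2 + (t * polyw (rvec u.1) ^+ 2)^-1.
    by rewrite (invfM t (polyw (rvec u.1) ^+ 2)); congr (_ + _); rewrite mulrA mulrAC.
  move: (t * _) tP => q q0.
  have qq : q * q^-1 = 1 by rewrite divff// gt_eqF.
  have qi : 0 < q^-1 by rewrite invr_gt0.
  have := sqr_ge0 (q * a - 1); have := ltW qi; move: (q^-1) qq qi => r qq r0 r1 hh.
  have : 0 <= r * (q * a - 1) ^+ 2 by rewrite mulr_ge0.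
  have -> : r * (q * a - 1) ^+ 2 = (q * r) * q * a ^+ 2 - 2 * (q * r) * a + r by ring.
  by rewrite qq; lra.
rewrite ge0_integralD//; last 4 first.
- by move=> u _; rewrite lee_fin mulr_ge0// ltW.
- by apply/measurable_EFinP; apply: measurable_funM.
- by move=> u _; rewrite lee_fin mulr_ge0// divr_ge0 ?exprn_ge0// ltW.
- by apply/measurable_EFinP; apply: measurable_funM.
have S0 : (0 <= sqnorm beta nrm U B 1 f)%E.
  by apply: integral_ge0 => u _; rewrite lee_fin mulr_ge0 ?sqr_ge0 ?weight_ge0.
apply: leeD.
  under eq_integral do rewrite EFinM.
  rewrite ge0_integralZl//; last 3 first.
  - exact/measurable_EFinP.
  - by move=> u _; rewrite lee_fin.
  - by rewrite lee_fin ltW.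
  rewrite [(_ * t)%R]mulrC EFinM -muleA lee_wpmul2l ?lee_fin ?(ltW t0)//.
  rewrite (le_trans gS)// lee_wpmul2r// lee_fin lerDl ltW//.
under eq_integral do rewrite EFinM.
rewrite ge0_integralZl//; last 3 first.
- exact/measurable_EFinP.
- by move=> u _; rewrite lee_fin.
- by rewrite lee_fin divr_ge0 ?exprn_ge0// ltW.
rewrite integral_cauchyV -EFinM lee_fin.
rewrite (_ : _ / t * _ = P / t); last by rewrite /P; ring.
by rewrite ler_wpM2r ?invr_ge0 ?(ltW t0)// lerDr invr_ge0 ltW.
Qed.

(** In [Qfun_abs_bound] one first chooses [t] large, to make the second term
    small, and then the norm small. *)
Lemma Qfun_continuous_at0 U (B : R) : cone U -> Qalmost_in U -> 0 < B ->
  (forall f : 'rV[C]_d -> C, (forall z, {for z, continuous f}) ->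
    (sqnorm beta nrm U B 1 f < +oo)%E -> Qintegrable f) /\
  forall e : R, 0 < e -> exists2 e' : R, 0 < e' &
    forall f : 'rV[C]_d -> C, (forall z, {for z, continuous f}) ->
    (sqnorm beta nrm U B 1 f < +oo)%E -> Hnorm beta nrm U B 1 f < e' ->
    nc (Qfun f) < e.
Proof.
move=> cU QU B0; have [k k0 hk] := Qfun_abs_bound cU QU B0.
have S0 f : (0 <= sqnorm beta nrm U B 1 f)%E.
  by apply: integral_ge0 => u _; rewrite lee_fin mulr_ge0 ?sqr_ge0 ?weight_ge0.
have part (phi : C -> R) (f : 'rV[C]_d -> C) : (forall z w, `|phi z - phi w| <= nc (z - w)) ->
    (forall z, `|phi z| <= nc z) -> (forall z, {for z, continuous f}) ->
    (sqnorm beta nrm U B 1 f < +oo)%E ->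
    mu.-integrable setT (EFin \o (fun u => phi (f (tuple_zvec u)) * \1_Q u)) /\
    (forall t, 0 < t -> `|\int[mu]_u (phi (f (tuple_zvec u)) * \1_Q u)| <=
      k * t * fine (sqnorm beta nrm U B 1 f) + k / t).
  move=> hphi phi1 cf fS.
  have fE : sqnorm beta nrm U B 1 f = (fine (sqnorm beta nrm U B 1 f))%:E.
    by rewrite fineK// ge0_fin_numE.
  have mphi : measurable_fun setT (fun u : TT => phi (f (tuple_zvec u)) * \1_Q u).
    apply: measurable_funM; last exact: measurable_indic.
    exact: (measurable_continuous hphi cf).
  have bnd t : 0 < t -> (\int[mu]_u `|(phi (f (tuple_zvec u)) * \1_Q u)%:E| <=
      (k * t * fine (sqnorm beta nrm U B 1 f) + k / t)%:E)%E.
    move=> t0; rewrite EFinD EFinM -fE; apply: le_trans (hk t f t0 cf).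
    apply: ge0_le_integral_sup => u; first exact: abse_ge0.
    by rewrite lee_fin normrM [`|\1_Q u|]ger0_norm// ler_wpM2r.
  have ii : mu.-integrable setT (EFin \o (fun u => phi (f (tuple_zvec u)) * \1_Q u)).
    apply/integrableP; split; first exact/measurable_EFinP.
    by rewrite (le_lt_trans (bnd 1 ltr01))// ltry.
  split=> // t t0; rewrite -lee_fin; apply: le_trans (bnd t t0).
  rewrite (le_trans (_ : _ <= `|\int[mu]_u (phi (f (tuple_zvec u)) * \1_Q u)%:E|)%E)//.
    by rewrite -[X in (_ <= `|X|)%E](fineK (integrable_fin_num measurableT ii)).
  apply: le_abse_integral => //.
  exact/measurable_EFinP.
split=> [f cf fS|e e0].
  by split=> //; [have [] := part Re f (@dist_Re R) (@normc_ge_absRe R) cf fS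
                 |have [] := part Im f (@dist_Im R) (@normc_ge_absIm R) cf fS].
have kn0 : k != 0 by rewrite gt_eqF.
have en0 : e != 0 by rewrite gt_eqF.
pose t := 8 * k / e; have t0 : 0 < t by rewrite !mulr_gt0 ?invr_gt0.
have kt : k / t = e / 8 by rewrite /t; field; rewrite kn0 en0.
have tn0 : t != 0 by rewrite gt_eqF.
pose q := e / (8 * (k * t)); have q0 : 0 < q by rewrite divr_gt0// mulr_gt0// mulr_gt0.
exists (Num.sqrt q); first by rewrite sqrtr_gt0.
move=> f cf fS; rewrite /Hnorm ltr_sqrt// => hq.
have hb : k * t * fine (sqnorm beta nrm U B 1 f) + k / t <= e / 4.
  have : k * t * fine (sqnorm beta nrm U B 1 f) <= k * t * q.
    by rewrite ler_wpM2l ?(ltW hq)// mulr_ge0// ltW.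
  have -> : k * t * q = e / 8 by rewrite /q; field; rewrite ?kn0 ?tn0.
  by rewrite kt; lra.
have [_ h1] := part Re f (@dist_Re R) (@normc_ge_absRe R) cf fS.
have [_ h2] := part Im f (@dist_Im R) (@normc_ge_absIm R) cf fS.
have h1' := le_trans (h1 t t0) hb; have h2' := le_trans (h2 t t0) hb.
apply: (le_lt_trans (normc_le_ReIm _)); rewrite /=.
by apply: (le_lt_trans (lerD h1' h2')); lra.
Qed.

End BoxFunctional.

(** * Bumps running away to infinity *)

Section RunawayBumps.
Variables (R : realType) (d : nat) (nrm : 'rV[R]_d -> R).
Hypothesis hnrm : is_norm nrm.
Local Notation C := (CC R).
Local Notation nc := (@Normc.normc R).
Local Notation Re := (@complex.Re R).
Local Notation Im := (@complex.Im R).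
Local Notation leb := (tuple_measure (@lebesgue_measure R) d).
Local Notation mu := (leb \x leb)%E.
Local Notation TT := (d.-tuple (measurableTypeR R) * d.-tuple (measurableTypeR R))%type.
Implicit Types x y p : 'rV[R]_d.

Variables (s : C -> C) (del : R).
Hypothesis s_approx : approx (@coord1 R) s.
Hypothesis s_decay : forall N, exists2 K, 0 <= K & forall w,
  nc (s w) * (1 + `|Re w|) ^+ N <= K * expR (2 * `|Im w|).
Hypothesis del01 : 0 < del <= 1.
Hypothesis s_center : forall L p x y, 1 <= L ->
  (forall j, `|x ord0 j - p ord0 j| <= del) -> (forall j, `|y ord0 j| <= del) ->
  expR L / 4 <= Re (bump s L p (zvec x y)).

Variables (v w : 'rV[R]_d) (eps : R) (i0 : 'I_d).
Hypotheses (v0 : v ord0 i0 != 0) (eps0 : 0 < eps).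

(** The factor [spread] puts the centers at distance [3 * radius k] of [Us], which
    leaves [radius k] for the points of the balls of radius [2 * radius k]; the
    factor [stride] makes the coordinate [i0] of the centers grow by more than that,
    in spite of the drift along [w]. *)
Definition spread : R := 3 / eps.
Definition stride : R := (4 * spread * `|w ord0 i0| + 10) / `|v ord0 i0|.

Lemma spread_gt0 : 0 < spread. Proof. by rewrite divr_gt0. Qed.

Lemma stride_gt0 : 0 < stride.
Proof.
by rewrite divr_gt0 ?normr_gt0// ltr_wpDl// mulr_ge0// mulr_ge0// ltW// spread_gt0.
Qed.

Definition radius (k : nat) : R := 4 * k.+1%:R.

(** The quadratic growth along [v] beats the linear drift along [w]: the centers
    tend to infinity in the direction of [v], at distances from the ray that
    tend to infinity. *)
Definition center (k : nat) : 'rV[R]_d :=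
  (stride * k.+1%:R ^+ 2) *: v + (spread * radius k) *: w.

Definition runaway (k : nat) (z : 'rV[C]_d) : C :=
  real_complex R (expR (- (2 * k.+1%:R))) * bump s (radius k) (center k) z.

Lemma runaway_approx k : approx (@coordv R d) (runaway k).
Proof.
by apply: approx_mul; [exact/approx_polyfun/polyfun_cst|exact: bump_approx].
Qed.

Lemma normc_runaway k z :
  nc (runaway k z) = expR (- (2 * k.+1%:R)) * nc (bump s (radius k) (center k) z).
Proof. by rewrite normcCM normc_real ger0_norm// expR_ge0. Qed.

Lemma radius_ge0 k : 0 <= radius k. Proof. by rewrite mulr_ge0. Qed.

Lemma succ_ge1 k : 1 <= k.+1%:R :> R. Proof. by rewrite ler1n. Qed.

Lemma polywD x y : polyw (x + y) <= polyw x * polyw y.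
Proof.
rewrite /polyw -big_split; apply: ler_prod => j _; rewrite addr_ge0//= mxE.
rewrite mulrDl mul1r mulrDr mulr1 -addrA lerD2l.
have := ler_normD (x ord0 j) (y ord0 j).
have : 0 <= `|x ord0 j| * `|y ord0 j| by rewrite mulr_ge0.
by lra.
Qed.

Lemma pow_le_expR (n : nat) : exists2 c : R, 0 <= c & forall k : nat,
  k.+1%:R ^+ n <= c * expR k.+1%:R.
Proof.
exists n.+1`!%:R => // k.
have h := expR_ge1Dxn n (ler0n R k.+1).
have f0 : 0 < n.+1`!%:R :> R by rewrite ltr0n fact_gt0.
have : k.+1%:R ^+ n.+1 / n.+1`!%:R <= expR k.+1%:R :> R.
  by apply: le_trans h; rewrite lerDr.
rewrite ler_pdivrMr// mulrC => /(le_trans _); apply.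
by rewrite exprS ler_peMl ?exprn_ge0// succ_ge1.
Qed.

(** Translating a rapidly decreasing function by [center k] costs powers of [k],
    absorbed by half of the exponential factor. *)
Lemma polyw_center N : exists2 c : R, 0 <= c & forall k,
  expR (- (2 * k.+1%:R)) * polyw (center k) ^+ N <= c * expR (- k.+1%:R).
Proof.
pose A := \prod_(j < d) (1 + (stride * `|v ord0 j| + 4 * spread * `|w ord0 j|)).
have nn j : 0 <= stride * `|v ord0 j| + 4 * spread * `|w ord0 j|.
  have h1 := ltW stride_gt0; have h2 := ltW spread_gt0.
  by rewrite addr_ge0// mulr_ge0// mulr_ge0.
have A0 : 0 <= A by rewrite prodr_ge0// => j _; rewrite addr_ge0.
have hA k : polyw (center k) <= A * (k.+1%:R ^+ 2) ^+ d.
  rewrite /polyw /A -[X in _ ^+ X]card_ord -prodr_const -big_split.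
  apply: ler_prod => j _; rewrite addr_ge0//= !mxE.
  rewrite (le_trans (lerD (lexx 1) (ler_normD _ _)))//.
  have k1 := succ_ge1 k; have h1 := stride_gt0; have h2 := spread_gt0.
  have q1 : 1 <= k.+1%:R ^+ 2 :> R by rewrite exprn_ege1.
  have q2 : k.+1%:R <= k.+1%:R ^+ 2 :> R by rewrite expr2 ler_peMl.
  have n1 : `|stride * k.+1%:R ^+ 2 * v ord0 j| = stride * `|v ord0 j| * k.+1%:R ^+ 2.
    have h : 0 <= stride * k.+1%:R ^+ 2 by apply: mulr_ge0; [exact: ltW|exact: sqr_ge0].
    by rewrite normrM (ger0_norm h) mulrAC.
  have n2 : `|spread * radius k * w ord0 j| = 4 * spread * `|w ord0 j| * k.+1%:R.
    have h : 0 <= spread * radius k by apply: mulr_ge0; [exact: ltW|exact: radius_ge0].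
    rewrite normrM (ger0_norm h).
    by rewrite /radius; ring.
  rewrite n1 n2 [leRHS]mulrDl mul1r lerD// [leRHS]mulrDl lerD2l.
  by rewrite ler_wpM2l// mulr_ge0// mulr_ge0// ltW.
have [c c0 hc] := pow_le_expR (2 * (d * N)).
exists (A ^+ N * c) => [|k]; first by rewrite mulr_ge0// exprn_ge0.
have P0 : 0 <= polyw (center k) by rewrite (le_trans _ (polyw_ge1 _)).
have h : polyw (center k) ^+ N <= A ^+ N * c * expR k.+1%:R.
  rewrite (le_trans (_ : _ <= (A * (k.+1%:R ^+ 2) ^+ d) ^+ N))//.
    by rewrite lerXn2r ?nnegrE ?mulr_ge0 ?exprn_ge0.
  by rewrite exprMn -!exprM -mulnA -[leRHS]mulrA ler_wpM2l ?exprn_ge0.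
rewrite mulrC (le_trans (ler_wpM2r (expR_ge0 _) h))// -[leLHS]mulrA -expRD.
by rewrite le_eqVlt; apply/orP; left; apply/eqP; congr (_ * expR _); ring.
Qed.

(** The exponential type of the bumps, measured with [nrm]. *)
Definition exp_type : R := 4 / sval (cid2 (is_norm_ge_norm1 hnrm)).

Lemma exp_type_gt0 : 0 < exp_type.
Proof. by rewrite /exp_type; case: cid2 => m m0 h /=; rewrite divr_gt0. Qed.

Lemma exp_type_norm1 x : 4 * norm1 x <= exp_type * nrm x.
Proof.
rewrite /exp_type; case: cid2 => m m0 h /=; rewrite -mulrA ler_wpM2l//.
by rewrite mulrC ler_pdivlMr// mulrC.
Qed.

Lemma runaway_recenter k N x y (A : R) :
  nc (bump s (radius k) (center k) (zvec x y)) * polyw (x - center k) ^+ N <= A ->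
  nc (runaway k (zvec x y)) * polyw x ^+ N <=
    expR (- (2 * k.+1%:R)) * polyw (center k) ^+ N * A.
Proof.
move=> hA; have polyw0 u : 0 <= polyw u by rewrite (le_trans _ (polyw_ge1 _)).
have hP : polyw x ^+ N <= polyw (x - center k) ^+ N * polyw (center k) ^+ N.
  rewrite -exprMn lerXn2r ?nnegrE ?mulr_ge0// -{1}[x](subrK (center k)).
  exact: polywD.
rewrite normc_runaway [leRHS]mulrC.
apply: (@le_trans _ _ ((nc (bump s (radius k) (center k) (zvec x y)) *
   polyw (x - center k) ^+ N) * (expR (- (2 * k.+1%:R)) * polyw (center k) ^+ N))).
  rewrite mulrACA [nc _ * expR _]mulrC; apply: ler_wpM2l hP.
  by rewrite mulr_ge0 ?expR_ge0 ?normcC_ge0.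
apply: ler_wpM2r hA; apply: mulr_ge0; [exact: expR_ge0|exact/exprn_ge0/polyw0].
Qed.

Lemma runaway_far N : exists2 c, 0 <= c & forall k x y,
  4 * radius k ^+ 2 <= sqr2 (x - center k) ->
  nc (runaway k (zvec x y)) * polyw x ^+ N <=
    c * expR (- k.+1%:R) * expR (exp_type * nrm y).
Proof.
have [K K0 hK] := s_decay N; have [c c0 hc] := polyw_center N.
exists (c * K ^+ d) => [|k x y far]; first by rewrite mulr_ge0// exprn_ge0.
have [_ /(_ far)/runaway_recenter h] := bump_le (center k) x y (radius_ge0 k) K0 hK.
have A0 t : 0 <= K ^+ d * expR t by rewrite mulr_ge0 ?exprn_ge0 ?expR_ge0.
apply: (le_trans h); apply: (le_trans (ler_wpM2r (A0 _) (hc k))).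
rewrite (_ : c * _ * (_ * _) = c * K ^+ d * expR (- k.+1%:R) * expR (4 * norm1 y)); last by ring.
by rewrite ler_wpM2l ?mulr_ge0 ?exprn_ge0 ?expR_ge0// ler_expR exp_type_norm1.
Qed.

Lemma runaway_le_all k N : exists2 c, 0 <= c & forall x y,
  nc (runaway k (zvec x y)) * polyw x ^+ N <= c * expR (exp_type * nrm y).
Proof.
have [K K0 hK] := s_decay N; have [c c0 hc] := polyw_center N.
exists (c * expR (- k.+1%:R) * (K ^+ d * expR (radius k))) => [|x y].
  by rewrite !mulr_ge0 ?exprn_ge0 ?expR_ge0.
have [/runaway_recenter h _] := bump_le (center k) x y (radius_ge0 k) K0 hK.
have A0 t : 0 <= K ^+ d * expR t by rewrite mulr_ge0 ?exprn_ge0 ?expR_ge0.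
apply: (le_trans h); apply: (le_trans (ler_wpM2r (A0 _) (hc k))).
rewrite expRD [X in _ * X <= _]mulrA [leLHS]mulrA; apply: ler_wpM2l; last by rewrite ler_expR exp_type_norm1.
by rewrite !mulr_ge0 ?exprn_ge0 ?expR_ge0.
Qed.

Variable Us : set 'rV[R]_d.
Hypothesis cUs : cone Us.
Hypothesis Us_far : forall u a t, Us u -> 0 <= t -> eps * t <= `|u - (a *: v + t *: w)|.

(** The ball of radius [2 * radius k] around [center k] is at distance at least
    [radius k] of [Us] in the sup norm, by the choice of [spread]; so the exponential growth of
    the bump on that ball is paid for by the distance to [Us]. *)
Lemma radius_le_dist k x : sqr2 (x - center k) < 4 * radius k ^+ 2 ->
  radius k <= exp_type * dist_set nrm x Us.
Proof.
move=> near_; rewrite mulrC -ler_pdivrMr ?exp_type_gt0//; apply: le_dist_set; first by case: cUs.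
move=> u Uu; rewrite ler_pdivrMr ?exp_type_gt0// mulrC.
apply: (le_trans _ (exp_type_norm1 _)).
have r0 := radius_ge0 k.
have xp : `|x - center k| <= 2 * radius k.
  apply: norm_le_coord => [|j]; first by rewrite mulr_ge0.
  rewrite -ler_sqr ?nnegrE ?mulr_ge0// real_normK ?num_real// exprMn.
  rewrite (_ : 2 ^+ 2 = 4); last by rewrite -natrX.
  rewrite (le_trans _ (ltW near_))// /sqr2 (bigD1 j)//= lerDl sumr_ge0// => i _.
  exact: sqr_ge0.
have up : eps * (spread * radius k) <= `|u - center k|.
  by apply: Us_far => //; rewrite mulr_ge0// ltW// spread_gt0.
have e3 : eps * (spread * radius k) = 3 * radius k.
  by rewrite /spread; field; rewrite gt_eqF.
have : `|u - center k| <= `|x - center k| + `|x - u|.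
  rewrite (_ : u - center k = (x - center k) - (x - u)) ?ler_normB//.
  by rewrite opprB [RHS]addrC addrA subrK.
have := norm_le_norm1 (x - u).
by have := norm1_ge0 (x - u); move: up xp; rewrite e3; lra.
Qed.

Lemma runaway_le N : exists2 c, 0 <= c & forall k x y,
  nc (runaway k (zvec x y)) * polyw x ^+ N <=
    c * expR (- k.+1%:R) * expR (exp_type * (dist_set nrm x Us + nrm y)).
Proof.
have [c1 c10 h1] := runaway_far N.
have [K K0 hK] := s_decay N; have [c c0 hc] := polyw_center N.
exists (c1 + c * K ^+ d) => [|k x y]; first by rewrite addr_ge0// mulr_ge0// exprn_ge0.
have D0 := dist_set_ge0 hnrm x Us.
have [far|near_] := leP (4 * radius k ^+ 2) (sqr2 (x - center k)).
  rewrite (le_trans (h1 _ _ _ far))//; apply: ler_pM.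
  - by rewrite mulr_ge0 ?expR_ge0.
  - exact: expR_ge0.
  - by rewrite ler_wpM2r ?expR_ge0// lerDl mulr_ge0// exprn_ge0.
  - by rewrite ler_expR ler_wpM2l ?(ltW exp_type_gt0)// lerDr.
have [/runaway_recenter h _] := bump_le (center k) x y (radius_ge0 k) K0 hK.
have A0 t : 0 <= K ^+ d * expR t by rewrite mulr_ge0 ?exprn_ge0 ?expR_ge0.
apply: (le_trans h); apply: (le_trans (ler_wpM2r (A0 _) (hc k))).
rewrite (_ : c * _ * (_ * _) =
  c * K ^+ d * expR (- k.+1%:R) * expR (radius k + 4 * norm1 y)); last by ring.
apply: ler_pM.
- by rewrite !mulr_ge0 ?exprn_ge0 ?expR_ge0.
- exact: expR_ge0.
- by rewrite ler_wpM2r ?expR_ge0// lerDr.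
- by rewrite ler_expR mulrDr lerD ?exp_type_norm1// radius_le_dist.
Qed.

Definition box (k : nat) : set TT := [set u | forall j,
  `|tnth u.1 j - center k ord0 j| <= del /\ `|tnth u.2 j| <= del].

Definition boxes : set TT := \bigcup_k box k.

Definition boxfun (k : nat) (u : TT) : R :=
  (\prod_j \1_(`[center k ord0 j - del, center k ord0 j + del]%classic) (tnth u.1 j)) *
  \prod_(j < d) \1_(`[0 - del, 0 + del]%classic) (tnth u.2 j).

Lemma in_itv_dist (a t : R) : (t \in `[a - del, a + del]%classic) = (`|t - a| <= del).
Proof.
apply/idP/idP; rewrite inE /= in_itv /= ler_norml => /andP[h1 h2]; apply/andP; split; lra.
Qed.

Lemma boxfun_in k u : box k u -> boxfun k u = 1.
Proof.
move=> h; rewrite /boxfun !big1 ?mulr1// => j _; rewrite indicE in_itv_dist.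
  by have [_ h2] := h j; rewrite subr0 h2.
by have [-> _] := h j.
Qed.

Lemma boxfun_notin k u : ~ box k u -> boxfun k u = 0.
Proof.
move=> /existsNP[j /not_andP[h|h]]; rewrite /boxfun.
  by rewrite (bigD1 j)//= indicE in_itv_dist (introF idP h) !mul0r.
by rewrite [X in _ * X](bigD1 j)//= indicE in_itv_dist subr0 (introF idP h) mul0r mulr0.
Qed.

Lemma measurable_boxfun k : measurable_fun setT (boxfun k).
Proof.
have h (a : 'I_d -> R) : measurable_fun setT (fun t : d.-tuple (measurableTypeR R) =>
    \prod_j (\1_(`[a j - del, a j + del]%classic) (tnth t j) : R)).
  apply: (@measurable_tuple_prod _ (measurableTypeR R) R d
    (fun j => \1_(`[a j - del, a j + del]%classic))) => j.
  exact: measurable_indic.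
apply: measurable_funM.
  exact: (measurableT_comp (h _) measurable_fst).
exact: (measurableT_comp (h _) measurable_snd).
Qed.

Lemma integral_boxfun k :
  (\int[mu]_u (boxfun k u)%:E = ((2 * del) ^+ d * (2 * del) ^+ d)%:E)%E.
Proof.
have d0 : 0 <= del by move: del01 => /andP[/ltW].
have := @integral_pair_prod _ _ R (@lebesgue_measure R) d
  (fun j => \1_(`[center k ord0 j - del, center k ord0 j + del]%classic))
  (fun j => \1_(`[0 - del, 0 + del]%classic)) (fun=> 2 * del) (fun=> 2 * del).
rewrite prodr_const card_ord; apply => // j; try exact: measurable_indic;
  exact: integral_box.
Qed.

Lemma measurable_box k : measurable (box k).
Proof.
rewrite (_ : box k = setT `&` boxfun k @^-1` `]0, +oo[%classic).
  exact: measurable_boxfun.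
rewrite setTI; apply/seteqP; split => u; rewrite /= in_itv /= andbT.
  by move=> /boxfun_in ->.
by have [//|/boxfun_notin ->] := pselect (box k u); rewrite ltxx.
Qed.

Lemma measurable_boxes : measurable boxes.
Proof. by apply: bigcupT_measurable => k; exact: measurable_box. Qed.

Lemma boxes_bounded u : boxes u -> forall j, `|tnth u.2 j| <= 1.
Proof.
move=> [k _ h] j; have [_ /le_trans] := h j; apply.
by move: del01 => /andP[].
Qed.

(** The centers are so sparse that each box lies outside the balls of radius
    [2 * radius k] around the other centers. *)
Lemma box_separation j k u : box j u -> j != k ->
  4 * radius k ^+ 2 <= sqr2 (rvec u.1 - center k).
Proof.
move=> hu jk; set x := rvec u.1.
suff h : 2 * radius k <= `|x ord0 i0 - center k ord0 i0|.
  rewrite /sqr2 (bigD1 i0)//= !mxE.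
  apply: (@le_trans _ _ ((x ord0 i0 - center k ord0 i0) ^+ 2)); last first.
    by rewrite !mxE lerDl sumr_ge0// => i _; exact: sqr_ge0.
  rewrite -[leRHS]real_normK ?num_real//.
  have -> : 4 * radius k ^+ 2 = (2 * radius k) ^+ 2 by ring.
  by rewrite lerXn2r ?nnegrE// mulr_ge0// radius_ge0.
have [h1 _] := hu i0; move: del01 => /andP[_ d1].
have hx : `|x ord0 i0 - center j ord0 i0| <= 1 by rewrite mxE (le_trans h1).
have hc : 10 * (k.+1%:R + 1) - 1 + 1 <= `|center j ord0 i0 - center k ord0 i0|.
  pose J := j.+1%:R : R; pose K := k.+1%:R : R.
  have JK : 1 <= `|J - K|.
    rewrite /J /K; have [jk'|kj|] := ltngtP j k; last by move/eqP: jk.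
      rewrite distrC ger0_norm ?subr_ge0 ?ler_nat; last exact: ltnW.
      by rewrite -natrB ?ler1n ?subn_gt0// ltnW.
    rewrite ger0_norm ?subr_ge0 ?ler_nat; last exact: ltnW.
    by rewrite -natrB ?ler1n ?subn_gt0// ltnW.
  have J1 : 1 <= J by exact: succ_ge1.
  have KK1 : 1 <= K by exact: succ_ge1.
  have sp := spread_gt0; have st := stride_gt0.
  have sv : stride * `|v ord0 i0| = 4 * spread * `|w ord0 i0| + 10.
    by rewrite /stride divfK// normr_eq0.
  have w0 : 0 <= 4 * spread * `|w ord0 i0|.
    by rewrite mulr_ge0// mulr_ge0// ltW.
  rewrite !mxE -/J -/K /radius -/J -/K.
  have -> : stride * J ^+ 2 * v ord0 i0 + spread * (4 * J) * w ord0 i0 -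
      (stride * K ^+ 2 * v ord0 i0 + spread * (4 * K) * w ord0 i0) =
      (J - K) * ((J + K) * (stride * v ord0 i0) + 4 * spread * w ord0 i0) by ring.
  rewrite normrM.
  have h2 : 10 * (K + 1) <= `|(J + K) * (stride * v ord0 i0) + 4 * spread * w ord0 i0|.
    have := lerB_normD ((J + K) * (stride * v ord0 i0)) (4 * spread * w ord0 i0).
    have -> : `|(J + K) * (stride * v ord0 i0)| = (J + K) * (4 * spread * `|w ord0 i0| + 10).
      by rewrite -sv normrM ger0_norm ?addr_ge0 ?ler0n// normrM (gtr0_norm st).
    have -> : `|4 * spread * w ord0 i0| = 4 * spread * `|w ord0 i0|.
      by rewrite normrM ger0_norm// mulr_ge0// ltW.
    move: w0; set W := 4 * spread * _ => w0; nra.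
  rewrite subrK; have : 0 <= 10 * (K + 1) by lra.
  by nra.
have : `|center j ord0 i0 - center k ord0 i0| <=
   `|x ord0 i0 - center k ord0 i0| + `|x ord0 i0 - center j ord0 i0|.
  rewrite (_ : center j ord0 i0 - _ = (x ord0 i0 - center k ord0 i0) - (x ord0 i0 - center j ord0 i0)).
    exact: ler_normB.
  by ring.
have := succ_ge1 k; rewrite /radius; lra.
Qed.

(** Rescaled to the size of [v], the boxes shrink to [v]. *)
Lemma boxes_almost_in U : open U -> cone U -> U v -> Qalmost_in boxes U.
Proof.
rewrite openE => oU [_ cU] Uv.
have /nbhs_ballP[r /= r0 hr] := oU v Uv.
pose a := (4 * spread * `|w| + 1) / (stride * r).
have sr : 0 < stride * r by rewrite mulr_gt0// stride_gt0.
have a0 : 0 <= a.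
  by rewrite divr_ge0 ?(ltW sr)// addr_ge0// mulr_ge0// mulr_ge0// ltW// spread_gt0.
exists (stride * a ^+ 2 * norm1 v + spread * (4 * a) * norm1 w + d%:R) => u [k _ hu].
have [d0 d1] : 0 < del /\ del <= 1 by move: del01 => /andP.
have [Ka|aK] := leP k.+1%:R a; [left|right].
  rewrite /norm1 !mulr_sumr.
  have -> : d%:R = \sum_(j < d) 1 :> R by rewrite sumr_const card_ord.
  rewrite -!big_split; apply: ler_sum => j _ /=.
  have [h1 _] := hu j; rewrite mxE -[tnth _ _](subrK (center k ord0 j)).
  rewrite (le_trans (ler_normD _ _))// [leLHS]addrC lerD//; last exact: le_trans h1 d1.
  rewrite !mxE (le_trans (ler_normD _ _))// lerD//.
    rewrite normrM ler_wpM2r// ger0_norm; last first.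
      by apply: mulr_ge0; [exact: ltW stride_gt0|exact: sqr_ge0].
    by rewrite ler_wpM2l ?(ltW stride_gt0)// lerXn2r ?nnegrE.
  rewrite normrM ler_wpM2r// ger0_norm; last first.
    by apply: mulr_ge0; [exact: ltW spread_gt0|exact: radius_ge0].
  by rewrite ler_wpM2l ?(ltW spread_gt0)// ler_wpM2l.
pose K := k.+1%:R : R; have KK1 : 1 <= K := succ_ge1 k.
have q0 : 0 < stride * K ^+ 2.
  by rewrite mulr_gt0 ?stride_gt0// exprn_gt0// (lt_le_trans ltr01).
rewrite -[rvec u.1](scalerKV (lt0r_neq0 q0)); apply: cU => //.
apply: hr; rewrite mx_norm_ball /ball_ /=.
have -> : v - (stride * K ^+ 2)^-1 *: rvec u.1 =
   (stride * K ^+ 2)^-1 *: ((stride * K ^+ 2) *: v - rvec u.1).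
  by rewrite scalerBr scalerA mulVf ?gt_eqF// scale1r.
rewrite normrZ gtr0_norm ?invr_gt0// ltr_pdivrMl//.
apply: (@le_lt_trans _ _ (4 * spread * K * `|w| + 1)).
  have -> : (stride * K ^+ 2) *: v - rvec u.1 =
     (center k - rvec u.1) - (spread * radius k) *: w.
    by rewrite /center addrAC addrK.
  rewrite (le_trans (ler_normB _ _))// addrC lerD//.
    rewrite normrZ ger0_norm; last by apply: mulr_ge0; [exact: ltW spread_gt0|exact: radius_ge0].
    by rewrite /radius -/K [spread * _]mulrCA mulrA.
  apply: norm_le_coord => // j; have [h1 _] := hu j.
  have -> : (center k - rvec u.1) ord0 j = - (tnth u.1 j - center k ord0 j).
    by rewrite !mxE opprB.
  by rewrite normrN (le_trans h1).
have : (4 * spread * `|w| + 1) < K * (stride * r) by rewrite -ltr_pdivrMr.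
have w0 : 0 <= 4 * spread * `|w|.
  by rewrite mulr_ge0// mulr_ge0// ltW// spread_gt0.
have -> : 4 * spread * K * `|w| = K * (4 * spread * `|w|) by ring.
have -> : stride * K ^+ 2 * r = K * (K * (stride * r)) by ring.
move: (4 * _ * _) (stride * r) w0 sr => W S W0 S0 h.
have : K * (W + 1) < K * (K * S) by rewrite ltr_pM2l// (lt_le_trans ltr01).
by lra.
Qed.

Lemma runaway_center k u : box k u ->
  expR (2 * k.+1%:R) / 4 <= Re (runaway k (tuple_zvec u)).
Proof.
move=> hu; have L1 : 1 <= radius k by have := succ_ge1 k; rewrite /radius; lra.
have hx j : `|rvec u.1 ord0 j - center k ord0 j| <= del by rewrite mxE; have [] := hu j.
have hy j : `|rvec u.2 ord0 j| <= del by rewrite mxE; have [] := hu j.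
have h := s_center L1 hx hy.
rewrite /runaway ReZ (_ : expR (2 * k.+1%:R) / 4 = expR (- (2 * k.+1%:R)) * (expR (radius k) / 4)).
  by rewrite ler_wpM2l ?expR_ge0.
by rewrite mulrA -expRD /radius; congr (expR _ / 4); ring.
Qed.

(** Away from its center a bump is only controlled by an exponential of the
    imaginary part, which is bounded on the boxes. *)
Lemma box_far_bound N : exists2 c, 0 <= c & forall k j u, box j u -> j != k ->
  nc (runaway k (tuple_zvec u)) * polyw (rvec u.1) ^+ N <= c * expR (- k.+1%:R).
Proof.
have [c c0 hc] := runaway_far N; have [M M0 hM] := is_norm_le_norm1 hnrm.
exists (c * expR (exp_type * (M * d%:R))) => [|k j u hu jk]; first by rewrite mulr_ge0 ?expR_ge0.
rewrite (le_trans (hc _ _ _ (box_separation hu jk)))// mulrAC.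
rewrite ler_wpM2r ?expR_ge0// ler_wpM2l// ler_expR ler_wpM2l ?(ltW exp_type_gt0)//.
rewrite (le_trans (hM _))// ler_wpM2l ?(ltW M0)// -[X in X%:R]card_ord -sumr_const.
rewrite ler_sum// => i _; rewrite mxE; apply: (@boxes_bounded u); by exists j.
Qed.

(** The box around the center of [runaway k] contributes a multiple of
    [expR (2 * k)]; the other boxes together contribute a bounded quantity,
    thanks to the decay of the bump. *)
Lemma Re_Qfun_runaway : exists2 c : R, 0 <= c & forall k,
  Qintegrable boxes (runaway k) ->
  expR (2 * k.+1%:R) / 4 * ((2 * del) ^+ d * (2 * del) ^+ d) - c <=
  Re (Qfun boxes (runaway k)).
Proof.
have [c c0 hc] := box_far_bound 2.
pose h (u : TT) := cauchyV (rvec u.1) * cauchyV (rvec u.2).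
pose A : R := c * (1 + 1 ^+ 2) ^+ d.
have A0 : 0 <= A by rewrite mulr_ge0// exprn_ge0// addr_ge0// sqr_ge0.
have h0 u : 0 <= h u by rewrite mulr_ge0//; exact: ltW (cauchyV_gt0 _).
have ih : mu.-integrable setT (EFin \o h).
  apply/integrableP; split; first by apply/measurable_EFinP; exact: measurable_cauchyV.
  rewrite (_ : (fun u => _) = fun u => (h u)%:E).
    by rewrite integral_cauchyV ltry.
  by apply/funext => u /=; rewrite ger0_norm.
have b0 k u : 0 <= boxfun k u.
  by have [/boxfun_in ->|/boxfun_notin ->] := pselect (box k u).
have ib k : mu.-integrable setT (EFin \o boxfun k).
  apply/integrableP; split; first by apply/measurable_EFinP; exact: measurable_boxfun.
  rewrite (_ : (fun u => _) = fun u => (boxfun k u)%:E).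
    by rewrite integral_boxfun ltry.
  by apply/funext => u /=; rewrite ger0_norm.
exists (A * (pi ^+ d * pi ^+ d)) => [|k [_ iR _]].
  by rewrite mulr_ge0// mulr_ge0// exprn_ge0// pi_ge0.
pose e := expR (2 * k.+1%:R) / 4 : R; have e0 : 0 <= e by rewrite divr_ge0 ?expR_ge0.
have iZ a (g : TT -> R) : mu.-integrable setT (EFin \o g) ->
    mu.-integrable setT (EFin \o (fun u => a * g u)).
  move=> ig; rewrite (_ : _ \o _ = fun u => a%:E * (EFin \o g) u)%E.
    exact: integrableZl.
  by apply/funext => u; rewrite /= EFinM.
have iG : mu.-integrable setT (EFin \o (fun u => e * boxfun k u - A * h u)).
  rewrite (_ : _ \o _ = ((EFin \o (fun u => e * boxfun k u)%R) \- (EFin \o (fun u => A * h u)%R))%E).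
    by apply: integrableB => //; exact: iZ.
  by apply/funext => u; rewrite /= EFinB.
have -> : expR (2 * k.+1%:R) / 4 * ((2 * del) ^+ d * (2 * del) ^+ d) - A * (pi ^+ d * pi ^+ d) =
   \int[mu]_u (e * boxfun k u - A * h u).
  rewrite RintegralB//; [|exact: iZ|exact: iZ].
  rewrite !RintegralZl// /Rintegral integral_boxfun.
  by rewrite (_ : (\int[mu]_u (h u)%:E)%E = (pi ^+ d * pi ^+ d)%:E)//; exact: integral_cauchyV.
apply: le_Rintegral => // u _ /=.
have [hu|hu] := pselect (box k u).
  have Qu : u \in boxes by rewrite inE; exists k.
  rewrite boxfun_in// indicE Qu !mulr1 (le_trans _ (runaway_center hu))//.
  by rewrite lerBlDr lerDl mulr_ge0.
rewrite boxfun_notin// mulr0 sub0r indicE; have [Qu|Qu] := boolP (u \in boxes); last first.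
  by rewrite mulr0 oppr_le0 mulr_ge0.
rewrite mulr1 lerNl; move: (Qu); rewrite inE => -[j _ hj].
have jk : j != k by apply/eqP => jk; apply: hu; rewrite -jk.
rewrite (le_trans (ler_norm _))// normrN (le_trans (normc_ge_absRe _))//.
have polyw0 : 0 < polyw (rvec u.1) by rewrite (lt_le_trans ltr01)// polyw_ge1.
have hb : nc (runaway k (tuple_zvec u)) * polyw (rvec u.1) ^+ 2 <= c.
  by rewrite (le_trans (hc _ _ _ hj jk))// ler_piMr// -expR0 ler_expR oppr_le0.
have := @Q_cauchyV R d boxes 1 ler01 boxes_bounded u; rewrite indicE Qu => hy.
rewrite /A /h.
apply: (@le_trans _ _ (c * cauchyV (rvec u.1))).
  rewrite -ler_pdivlMr ?exprn_gt0// in hb; rewrite (le_trans hb)//.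
  by rewrite ler_wpM2l// polyw_cauchyV.
rewrite -mulrA ler_wpM2l// mulrCA ler_peMr//; exact: ltW (cauchyV_gt0 _).
Qed.

Lemma expRN_le_half k : expR (- k.+1%:R) <= 2 ^- k :> R.
Proof.
have h1 : expR (-1) <= 2^-1 :> R.
  rewrite expRN lef_pV2 ?posrE ?expR_gt0//.
  by apply: le_trans (expR_ge1Dx 1); rewrite -natr1.
have -> : - k.+1%:R = k.+1%:R * (-1) :> R by rewrite mulrN1.
rewrite expRM_natl (le_trans (_ : _ <= 2^-1 ^+ k.+1))//.
  by rewrite lerXn2r ?nnegrE ?expR_ge0// invr_ge0.
rewrite exprVn lef_pV2 ?posrE ?exprn_gt0// exprS ler_peMl// ?exprn_ge0//.
exact: ler1n.
Qed.

Lemma sum_expRN_le n : \sum_(k < n) expR (- k.+1%:R) <= 2 :> R.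
Proof.
apply: (@le_trans _ _ (\sum_(k < n) 2 ^- k)).
  by apply: ler_sum => k _; exact: expRN_le_half.
by rewrite sum_half gerBl mulr_ge0// invr_ge0 exprn_ge0.
Qed.

Definition partial n z := \sum_(k < n) runaway k z.

Lemma zvec_ReIm (z : 'rV[C]_d) :
  z = zvec (\row_j Re (z ord0 j)) (\row_j Im (z ord0 j)).
Proof. by apply/rowP => j; rewrite !mxE; case: (z ord0 j). Qed.

Lemma runaway_polydisc (r : R) : exists M, forall z n, polydisc (@coordv R d) r z ->
  nc (runaway n z) <= M / 2 ^+ n.
Proof.
have [c c0 hc] := runaway_le 0; have [M M0 hM] := is_norm_le_norm1 hnrm.
have [[u0 Uu0] _] := cUs.
pose B := exp_type * ((M * (d%:R * r) + nrm u0) + M * (d%:R * r)).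
exists (c * expR B) => z n hz; rewrite [z]zvec_ReIm.
set x := (X in zvec X _); set y := (X in zvec _ X).
have n1 (t : 'rV[R]_d) : (forall j, `|t ord0 j| <= r) -> nrm t <= M * (d%:R * r).
  move=> ht; rewrite (le_trans (hM _))// ler_wpM2l ?(ltW M0)//.
  rewrite mulr_natl -[X in _ *+ X]card_ord -sumr_const ler_sum// => j _.
have hx : nrm x <= M * (d%:R * r).
  by apply: n1 => j; rewrite mxE (le_trans (normc_ge_absRe _))//; exact: hz.
have hy : nrm y <= M * (d%:R * r).
  by apply: n1 => j; rewrite mxE (le_trans (normc_ge_absIm _))//; exact: hz.
have := hc n x y; rewrite expr0 mulr1 => /le_trans; apply.
rewrite mulrAC ler_pM ?mulr_ge0 ?expR_ge0 ?expRN_le_half//.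
rewrite ler_wpM2l// ler_expR ler_wpM2l ?(ltW exp_type_gt0)// lerD//.
rewrite (le_trans (dist_set_le hnrm x Uu0))// (le_trans (is_norm_triangle hnrm _ _))//.
by rewrite (is_normN hnrm) lerD2r.
Qed.

Lemma runaway_sum : exists2 f, approx (@coordv R d) f &
  forall z (e : R) m, 0 < e -> exists2 n, (m <= n)%N & nc (f z - partial n z) <= e.
Proof.
have ap n : approx (@coordv R d) (partial n).
  by apply: approx_sum => k; exact: runaway_approx.
have diff n z : partial n.+1 z - partial n z = runaway n z.
  by rewrite /partial big_ord_recr /= addrAC subrr add0r.
have geo z : exists M, forall n, nc (partial n.+1 z - partial n z) <= M / 2 ^+ n.
  have [M hM] := runaway_polydisc (rnorm z); exists M => n; rewrite diff.
  by apply: hM => j; exact: rnorm_coord.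
have [//|r|f fa hf] := @approx_geometric_limit R _ _ (@coordv R d) partial ap.
  by have [M hM] := runaway_polydisc r; exists M => z n zr; rewrite diff; exact: hM.
exists f => // z e m e0; have [M hM] := geo z.
pose n := maxn m (Num.truncn (4 * M / e)).+1.
exists n; first exact: leq_maxl.
rewrite (le_trans (hf z M hM n))// ler_pdivrMr ?exprn_gt0// [leRHS]mulrC -ler_pdivrMr//.
apply: (le_trans (ltW (truncnS_gt _))); apply: (le_trans _ (exp2_ge R n)).
by rewrite ler_nat leq_maxr.
Qed.

Section Sum.
Variable f : 'rV[C]_d -> C.
Hypothesis f_lim : forall z (e : R) m, 0 < e ->
  exists2 n, (m <= n)%N & nc (f z - partial n z) <= e.

Lemma runaway_sum_le N : exists2 c, 0 <= c & forall x y,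
  nc (f (zvec x y)) * polyw x ^+ N <= c * expR (exp_type * (dist_set nrm x Us + nrm y)).
Proof.
have [c c0 hc] := runaway_le N; exists (c * 2) => [|x y]; first by rewrite mulr_ge0.
have P0 : 0 < polyw x ^+ N by rewrite exprn_gt0// (lt_le_trans ltr01)// polyw_ge1.
apply/ler_addgt0Pr => e e0.
have [n _ hn] := f_lim (zvec x y) 0 (divr_gt0 e0 P0).
rewrite -[f _](subrK (partial n (zvec x y))).
rewrite (le_trans (ler_wpM2r (ltW P0) (normcCD _ _)))// mulrDl addrC lerD//; last first.
  by rewrite -ler_pdivlMr.
apply: (@le_trans _ _ (\sum_(k < n) nc (runaway k (zvec x y)) * polyw x ^+ N)).
  by rewrite -mulr_suml ler_wpM2r ?(ltW P0)// normcC_sum.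
apply: (@le_trans _ _ (\sum_(k < n) c * expR (exp_type * (dist_set nrm x Us + nrm y)) * expR (- k.+1%:R))).
  by apply: ler_sum => k _; rewrite (le_trans (hc _ _ _))// mulrAC.
rewrite -mulr_sumr [leRHS]mulrAC ler_wpM2l ?mulr_ge0 ?expR_ge0//.
exact: sum_expRN_le.
Qed.

Lemma runaway_sum_center : exists c : R, forall k u, box k u ->
  expR (2 * k.+1%:R) / 4 - c <= nc (f (tuple_zvec u)).
Proof.
have [c c0 hc] := box_far_bound 0; exists (c * 2) => k u hu.
apply/ler_addgt0Pr => e e0.
have [n kn hn] := f_lim (tuple_zvec u) k.+1 e0.
rewrite (le_trans _ (lerD (normc_ge_absRe _) (lexx e)))//.
have hp : expR (2 * k.+1%:R) / 4 - c * 2 <= Re (partial n (tuple_zvec u)).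
  rewrite /partial (bigD1 (Ordinal kn))//=.
  set rest := (X in Re (_ + X)).
  have hr : nc rest <= c * 2.
    rewrite (le_trans (normcC_sum _ _ _))//.
    apply: (@le_trans _ _ (\sum_(i < n) c * expR (- i.+1%:R))).
      rewrite [leRHS](bigID (fun i => i != Ordinal kn))/=.
      rewrite (le_trans (_ : _ <= \sum_(i < n | i != Ordinal kn) c * expR (- i.+1%:R)))//.
        apply: ler_sum => i ik; have := hc i k u hu; rewrite expr0 mulr1; apply.
        by apply: contra ik => /eqP ki; apply/eqP/val_inj.
      by rewrite lerDl sumr_ge0// => i _; rewrite mulr_ge0 ?expR_ge0.
    by rewrite -mulr_sumr ler_wpM2l// sum_expRN_le.
  have -> : Re (runaway k (tuple_zvec u) + rest) = Re (runaway k (tuple_zvec u)) + Re rest.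
    by case: (runaway _ _) rest {hr} => [? ?] [? ?].
  rewrite lerD ?runaway_center// lerNl (le_trans _ hr)//.
  by rewrite (le_trans (ler_norm _))// normrN normc_ge_absRe.
have := le_trans (normc_ge_absRe _) hn.
have -> : Re (f (tuple_zvec u) - partial n (tuple_zvec u)) =
    Re (f (tuple_zvec u)) - Re (partial n (tuple_zvec u)).
  by case: (f _) (partial _ _) => [? ?] [? ?].
rewrite ler_norml => /andP[h _].
have := ler_norm (Re (f (tuple_zvec u))).
by move: hp h; lra.
Qed.

Lemma runaway_sum_integral : exists c : R, forall k,
  (((expR (2 * k.+1%:R) / 4 - c) * ((2 * del) ^+ d * (2 * del) ^+ d))%:E <=
   \int[mu]_u (nc (f (tuple_zvec u)) * \1_boxes u)%:E)%E.
Proof.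
have [c hc] := runaway_sum_center; exists c => k.
set e := (_ - c); have [e0|e0] := leP 0 e; last first.
  apply: (@le_trans _ _ 0%E).
    rewrite lee_fin mulr_le0_ge0 ?(ltW e0)// mulr_ge0// exprn_ge0// mulr_ge0// ltW//;
    by move: del01 => /andP[].
  by apply: integral_ge0 => u _; rewrite lee_fin mulr_ge0// normcC_ge0.
have b0 u : 0 <= boxfun k u.
  by have [/boxfun_in ->|/boxfun_notin ->] := pselect (box k u).
rewrite EFinM -(integral_boxfun k) -ge0_integralZl//; last 2 first.
- by apply/measurable_EFinP; exact: measurable_boxfun.
- by move=> u _; rewrite lee_fin.
apply: ge0_le_integral_sup => u; first by rewrite -EFinM lee_fin mulr_ge0.
rewrite -EFinM lee_fin; have [hu|hu] := pselect (box k u).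
  rewrite boxfun_in// indicE (_ : u \in boxes); last by rewrite inE; exists k.
  by rewrite !mulr1; exact: hc.
by rewrite boxfun_notin// mulr0 mulr_ge0// normcC_ge0.
Qed.

End Sum.

End RunawayBumps.

(** * Separation of the spaces and of their duals *)

Section Separation.
Variables (R : realType) (d : nat) (beta : R) (nrm : 'rV[R]_d -> R).
Hypotheses (hbeta : 0 <= beta < 1) (hnrm : is_norm nrm).
Local Notation C := (CC R).
Local Notation nc := (@Normc.normc R).
Local Notation Re := (@complex.Re R).
Local Notation leb := (tuple_measure (@lebesgue_measure R) d).
Local Notation mu := (leb \x leb)%E.
Local Notation TT := (d.-tuple (measurableTypeR R) * d.-tuple (measurableTypeR R))%type.
Local Notation F := ('rV[C]_d -> C).

Lemma entire_continuous (f : F) : entire f -> forall z, {for z, continuous f}.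
Proof. by move=> ef z; apply: differentiable_continuous; exact: ef. Qed.

Section Functional.
Variables (Q : set TT) (Y : R).
Hypotheses (mQ : measurable Q) (Y0 : 0 <= Y).
Hypothesis QY : forall u, Q u -> forall j, `|tnth u.2 j| <= Y.

Definition Qball (e : R) : set F := [set g | Qintegrable Q g /\ nc (Qfun Q g) < e].

Lemma Qball_absconvex e : absconvex (Qball e).
Proof.
move=> a b f g [fi fe] [gi ge] ab.
have [i h] := Qfun_linear a b fi gi; split=> //; rewrite h.
have ab1 : nc a + nc b <= 1.
  move: ab; rewrite [X in X + _]normC_normc [X in _ + X]normC_normc.
  by rewrite -rmorphD -[1]/(real_complex R 1) lecR.
rewrite (le_lt_trans (normcCD _ _))// !normcCM.
pose m := Num.max (nc (Qfun Q f)) (nc (Qfun Q g)).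
have me : m < e by rewrite gt_max fe ge.
have m0 : 0 <= m by rewrite le_max normcC_ge0.
apply: le_lt_trans me; rewrite (le_trans (_ : _ <= (nc a + nc b) * m))//.
  by rewrite mulrDl lerD// ler_wpM2l ?normcC_ge0// le_max lexx ?orbT.
by rewrite ler_piMl.
Qed.

Definition Qgood U := cone U /\ Qalmost_in Q U.

Lemma S_U_Qintegrable U f : Qgood U -> lcs_car (S_U beta nrm U) f -> Qintegrable Q f.
Proof.
move=> [cU QU] [b /= b0 fb].
have b1 : b < b + 1 by rewrite ltrDl.
have [ef fS] := fb (b + 1) 1%N b1.
have B0 : 0 < b + 1 by rewrite addr_gt0.
have [h _] := Qfun_continuous_at0 hbeta hnrm mQ Y0 QY cU QU B0.
by apply: h => //; exact: entire_continuous.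
Qed.

Lemma Qball_S_U U e : Qgood U -> 0 < e -> lcs_nbhs0 (S_U beta nrm U) (Qball e).
Proof.
move=> [cU QU] e0; exists (Qball e); split => //; first exact: Qball_absconvex.
move=> _ [b /= b0 <-].
have B0 : 0 < b + 1 by rewrite addr_gt0.
have b1 : b < b + 1 by rewrite ltrDl.
have [h1 h2] := Qfun_continuous_at0 hbeta hnrm mQ Y0 QY cU QU B0.
have [e' e'0 he'] := h2 e e0.
exists [:: (b + 1, 1%N)], e'; split => //.
  by move=> i; rewrite inE => /eqP ->.
move=> f Df hf; have [ef fS] := Df (b + 1) 1%N b1.
have cf := entire_continuous ef.
split; first exact: h1.
by apply: he' => //; apply: (hf (b + 1, 1%N)); rewrite inE.
Qed.

(** [Qball e] is the inverse image of a ball under the functional, so that one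
    and the same absolutely convex set serves in all the spaces. *)
Lemma Qfun_dual (E : lcs F) : (forall f, lcs_car E f -> Qintegrable Q f) ->
  (forall e, 0 < e -> lcs_nbhs0 E (Qball e)) ->
  dual E (fun f => Qfun Q (val f)).
Proof.
move=> Ei Eb; split=> [a b f g h ->|e e0].
  have fi := Ei _ (set_valP f); have gi := Ei _ (set_valP g).
  by have [_ ->] := Qfun_linear a b fi gi.
by exists (Qball e); [exact: Eb|move=> f []].
Qed.

End Functional.

Lemma S_U_dual (Q : set TT) (Y : R) U (mQ : measurable Q) (Y0 : 0 <= Y)
    (QY : forall u, Q u -> forall j, `|tnth u.2 j| <= Y) : Qgood Q U ->
  dual (S_U beta nrm U) (fun f => Qfun Q (val f)).
Proof.
move=> QU; apply: Qfun_dual => [f|e e0]; first exact: (S_U_Qintegrable mQ Y0 QY).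
exact: (Qball_S_U mQ Y0 QY).
Qed.

Lemma ind_lim_dual (Q : set TT) (Y : R) (UU : set (set 'rV[R]_d)) (mQ : measurable Q) (Y0 : 0 <= Y)
    (QY : forall u, Q u -> forall j, `|tnth u.2 j| <= Y) :
  (forall U, UU U -> Qgood Q U) ->
  dual (ind_lim (\bigcup_(U in UU) lcs_car (S_U beta nrm U))
    [set S_U beta nrm U | U in UU]) (fun f => Qfun Q (val f)).
Proof.
move=> hUU; apply: Qfun_dual => [f [U /hUU QU]|e e0].
  exact: (S_U_Qintegrable mQ Y0 QY).
exists (Qball Q e); split => //; first exact: Qball_absconvex.
by move=> _ [U /hUU QU <-]; exact: (Qball_S_U mQ Y0 QY).
Qed.

(** The bound on the norms shows both membership in [S_b] and, for a sequence of
    functions with [K] tending to [0], convergence to [0]. *)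
Lemma S_b_type1 : exists2 k, 0 < k & forall U N (f : F) K B0,
  cone U -> 0 < B0 -> 0 <= K -> entire f ->
  (forall x y, nc (f (zvec x y)) * polyw x ^+ N.+1 <=
     K * expR (B0 * (dist_set nrm x U + nrm y))) ->
  forall B, B0 + 1 < B -> Hspace beta nrm U B N f /\ Hnorm beta nrm U B N f <= K * k.
Proof.
have [k k0 hk] := sqnorm_bound hbeta hnrm.
exists (Num.sqrt k) => [|U N f K B0 cU B00 K0 ef hf B hB]; first by rewrite sqrtr_gt0.
have Bp : 0 < B by rewrite (lt_trans _ hB)// addr_gt0.
have h := hk U B N f K B0 cU Bp (ltW hB) K0 hf.
have S0 : (0 <= sqnorm beta nrm U B N f)%E.
  by apply: integral_ge0 => u _; rewrite lee_fin mulr_ge0 ?sqr_ge0 ?weight_ge0.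
have Soo : (sqnorm beta nrm U B N f < +oo)%E by rewrite (le_lt_trans h)// ltry.
split; first by split.
apply: (@le_trans _ _ (Num.sqrt (K ^+ 2 * k))); last first.
  by rewrite sqrtrM ?sqr_ge0// sqrtr_sqr ger0_norm.
by rewrite ler_wsqrtr// -lee_fin fineK// ge0_fin_numE.
Qed.

Lemma expR_archimedean (A B : R) : 0 < A -> exists k0, forall k, (k0 <= k)%N ->
  B < expR (2 * k.+1%:R) * A.
Proof.
move=> A0; exists (Num.truncn (B / A)) => k hk.
rewrite -ltr_pdivrMr//; apply: (lt_le_trans (truncnS_gt _)).
apply: (@le_trans _ _ (2 * k.+1%:R)).
  by rewrite (@le_trans _ _ k.+1%:R) ?ler_nat ?ltnS// ler_peMl// ler1n.
by rewrite (le_trans _ (expR_ge1Dx _))// lerDr.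
Qed.

(** The two spaces are told apart by functions that explode on boxes running away
    in the direction of [v] while receding from its ray: every open cone
    containing [v] contains all but finitely many of the boxes, but their distance
    to [Us] tends to infinity. *)
Lemma separation (v w : 'rV[R]_d) (eps : R) (i0 : 'I_d) (Us : set 'rV[R]_d)
    (UU : set (set 'rV[R]_d)) (D : set F) (T : set (lcs F)) :
  v ord0 i0 != 0 -> 0 < eps -> cone Us ->
  (forall u a t, Us u -> 0 <= t -> eps * t <= `|u - (a *: v + t *: w)|) ->
  (forall U, UU U -> [/\ open U, cone U & U v]) ->
  T (S_U beta nrm Us) -> lcs_car (S_U beta nrm Us) `<=` D ->
  let E1 := ind_lim (\bigcup_(U in UU) lcs_car (S_U beta nrm U))
    [set S_U beta nrm U | U in UU] in
  let E2 := ind_lim D T in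
  lcs_car E1 <> lcs_car E2 /\
  dual_restr (S_U beta nrm setT) E1 <> dual_restr (S_U beta nrm setT) E2.
Proof.
move=> v0 eps0 cUs far hUU TUs DUs E1 E2.
have [s [sa s0 sdec]] := rapidly_decreasing_exponential_type R.
have [del1 del10 cen1] := @bump_center R d s sa s0.
pose del := Num.min del1 1.
have del01 : 0 < del <= 1 by rewrite lt_min del10 ltr01 ge_min lexx orbT.
have cen L (p x y : 'rV[R]_d) : 1 <= L -> (forall j, `|x ord0 j - p ord0 j| <= del) ->
    (forall j, `|y ord0 j| <= del) -> expR L / 4 <= Re (bump s L p (zvec x y)).
  move=> L1 hx hy; apply: cen1 => // j.
    by rewrite (le_trans (hx j))// ge_min lexx.
  by rewrite (le_trans (hy j))// ge_min lexx.
pose Q := boxes del v w eps i0.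
pose f_ k := runaway s v w eps i0 k.
have mQ : measurable Q by exact: measurable_boxes.
have QY u : Q u -> forall j, `|tnth u.2 j| <= 1 by exact: (boxes_bounded del01).
have QU U : UU U -> Qgood Q U.
  by move=> /hUU[oU cU Uv]; split => //; exact: boxes_almost_in.
have coneT : cone (setT : set 'rV[R]_d) by split; [exists 0|].
have QT : Qgood Q setT by split=> //; exists 0 => u _; right.
have typ0 := exp_type_gt0 hnrm; set b0 := exp_type hnrm in typ0.
have [kap kap0 hkap] := S_b_type1.
have fent k : entire (f_ k) by apply: approx_entire; exact: runaway_approx.
have f_T k : lcs_car (S_U beta nrm setT) (f_ k).
  exists (b0 + 1); first by rewrite /= addr_gt0.
  move=> B N hB.
  have [c c0 hc] := runaway_le_all hnrm sdec w v0 eps0 k N.+1.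
  have [] := hkap setT N (f_ k) c b0 coneT typ0 c0 (fent k) _ B hB => // x y.
  by rewrite dist_set_in// add0r; exact: hc.
have f_Us k : lcs_car (S_b beta nrm Us (b0 + 1)) (f_ k).
  move=> B N hB.
  have [c c0 hc] := runaway_le hnrm sdec v0 eps0 cUs far N.+1.
  have [] := hkap Us N (f_ k) (c * expR (- k.+1%:R)) b0 cUs typ0 _ (fent k) _ B hB => //.
  by rewrite mulr_ge0 ?expR_ge0.
have f_small B N e : b0 + 1 < B -> 0 < e -> exists k0, forall k, (k0 <= k)%N ->
    Hnorm beta nrm Us B N (f_ k) < e.
  move=> hB e0.
  have [c c0 hc] := runaway_le hnrm sdec v0 eps0 cUs far N.+1.
  exists (Num.truncn (c * kap / e)) => k hk.
  have [||_ h] := hkap Us N (f_ k) (c * expR (- k.+1%:R)) b0 cUs typ0 _ (fent k) _ B hB => //.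
    by rewrite mulr_ge0 ?expR_ge0.
  apply: (le_lt_trans h); rewrite mulrAC expRN ltr_pdivrMr ?expR_gt0//.
  rewrite [ltRHS]mulrC -ltr_pdivrMr//; apply: (lt_le_trans (truncnS_gt _)).
  rewrite (@le_trans _ _ k.+1%:R) ?ler_nat ?ltnS//.
  by rewrite (le_trans _ (expR_ge1Dx _))// lerDr.
pose vol := (2 * del) ^+ d * (2 * del) ^+ d.
have vol0 : 0 < vol.
  by move: del01 => /andP[d0 _]; rewrite mulr_gt0// exprn_gt0// mulr_gt0.
have unbounded c A : exists k0, forall k, (k0 <= k)%N -> A < expR (2 * k.+1%:R) / 4 * vol - c.
  have [k0 hk0] := @expR_archimedean (vol / 4) (A + c) (divr_gt0 vol0 (ltr0Sn _ _)).
  by exists k0 => k /hk0; lra.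
split.
(* The sum of the runaway bumps is not integrable over the boxes. *)
- have [f fa flim] := runaway_sum hnrm sa sdec v0 eps0 cUs far.
  have fE2 : lcs_car E2 f.
    apply: DUs; exists (b0 + 1); first by rewrite /= addr_gt0.
    move=> B N hB; have [c c0 hc] := runaway_sum_le hnrm sdec v0 eps0 cUs far flim N.+1.
    by have [] := hkap Us N f c b0 cUs typ0 c0 (approx_entire fa) hc B hB.
  move=> E12; move: fE2; rewrite -E12 => -[U UUU [b /= b_gt0 fb]].
  have b1 : b < b + 1 by rewrite ltrDl.
  have B0 : 0 < b + 1 by rewrite addr_gt0.
  have [ef fS] := fb (b + 1) 1%N b1; have [cU QUU] := QU U UUU.
  have [k k0 hk] := Qfun_abs_bound hbeta hnrm mQ ler01 QY cU QUU B0.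
  have := hk 1 f ltr01 (entire_continuous ef).
  have S0 : (0 <= sqnorm beta nrm U (b + 1) 1 f)%E.
    by apply: integral_ge0 => u _; rewrite lee_fin mulr_ge0 ?sqr_ge0 ?weight_ge0.
  rewrite -(@fineK _ (sqnorm _ _ _ _ _ _)) ?ge0_fin_numE// -EFinM -EFinD => hA.
  have [c hc] := runaway_sum_integral hnrm sdec del01 cen v0 eps0 flim.
  have [n hn] := unbounded (c * vol) (k * 1 * fine (sqnorm beta nrm U (b + 1) 1 f) + k / 1).
  have := le_trans (hc n) hA; rewrite lee_fin mulrBl leNgt.
  by rewrite hn.
(* The runaway bumps tend to [0] in [E2], but the functional is unbounded on them. *)
- move=> D12; pose l (g : S_U beta nrm setT) := Qfun Q (val g).
  have l1 : dual_restr (S_U beta nrm setT) E1 l.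
    split; first exact: (S_U_dual mQ ler01 QY QT).
    exists (fun g : E1 => Qfun Q (val g)); first exact: (ind_lim_dual mQ ler01 QY QU).
    by move=> g h; rewrite /l => ->.
  move: l1; rewrite D12 => -[_ [L [_ Lcont] lL]].
  have [W [A [_ AW AT]] hW] := Lcont 1 ltr01.
  have [A' [_ A'A /(_ (S_b beta nrm Us (b0 + 1)))]] := AT _ TUs.
  case=> [|sn [e [e0 hs he]]]; first by exists (b0 + 1) => //=; rewrite addr_gt0.
  have [k1 hk1] : exists k1, forall k, (k1 <= k)%N ->
      forall i, i \in sn -> Hnorm beta nrm Us i.1 i.2 (f_ k) < e.
    elim: sn hs {he} => [|i sn IH] hs; first by exists 0%N.
    have [k2 h2] := IH (fun j js => hs j (mem_behead (s := i :: sn) js)).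
    have [k3 h3] := f_small i.1 i.2 e (hs i (mem_head _ _)) e0.
    exists (maxn k2 k3) => k; rewrite geq_max => /andP[k2k k3k] j.
    by rewrite inE => /orP[/eqP ->|js]; [exact: h3|exact: h2].
  have small k : (k1 <= k)%N -> nc (Qfun Q (f_ k)) < 1.
    move=> kk1; have fE2 : lcs_car E2 (f_ k).
      by apply: DUs; exists (b0 + 1); [rewrite /= addr_gt0|exact: f_Us].
    pose g1 : S_U beta nrm setT := SigSub (mem_set (f_T k)).
    pose g2 : E2 := SigSub (mem_set fE2).
    rewrite -[Qfun Q (f_ k)]/(l g1) (lL g1 g2 erefl); apply: hW.
    by apply: AW; apply: A'A; apply: he; [exact: f_Us|exact: hk1].
  have [c c0 hc] := Re_Qfun_runaway hnrm sdec del01 cen w v0 eps0.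
  have [k2 hk2] := unbounded c 1; pose k := maxn k1 k2.
  have := small k (leq_maxl _ _); apply/negP; rewrite -leNgt.
  rewrite (le_trans _ (normc_ge_absRe _))// (le_trans _ (ler_norm _))//.
  rewrite (le_trans (ltW (hk2 k (leq_maxr _ _))))// hc//.
  exact: (S_U_Qintegrable mQ ler01 QY QT).
Qed.

End Separation.

(** * Geometry of cones *)

Section AvoidingCone.
Variables (R : realType) (n : nat).
Implicit Types (K U : set 'rV[R]_n) (x : 'rV[R]_n).

Lemma closed_cone0 K : cone K -> closed K -> K 0.
Proof.
move=> [[x Kx] cK] clK; apply: clK => B /nbhs_ballP[r /= r0 hr].
have x1 : 0 < `|x| + 1 by rewrite ltr_wpDl.
pose t := r / (`|x| + 1) / 2.
have t0 : 0 < t by rewrite !divr_gt0.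
exists (t *: x); split; first exact: cK.
apply: hr; rewrite mx_norm_ball /ball_ /= sub0r normrN normrZ gtr0_norm//.
apply: (@le_lt_trans _ _ (r / 2)).
  rewrite /t mulrAC ler_pM2r// mulrAC ler_pdivrMr// ler_wpM2l ?(ltW r0)//.
  by rewrite lerDl.
by lra.
Qed.

(** A closed cone missing the direction [xs] is surrounded by an open cone whose
    distance to the points of the ray of [xs] grows linearly. *)
Lemma avoiding_cone K xs : cone K -> closed K -> ~ K xs ->
  exists2 eps : R, 0 < eps & exists2 U, open_cone_nbhd K U &
    forall u t, U u -> 0 <= t -> eps * t <= `|u - t *: xs|.
Proof.
move=> cK clK nKx; have K0 := closed_cone0 cK clK.
have : open (~` K) by exact: closed_openC.
rewrite openE => /(_ xs nKx)/nbhs_ballP[rho /= rho0 hrho].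
have far x : K x -> rho <= `|xs - x|.
  move=> Kx; rewrite leNgt; apply/negP => h.
  by apply: (hrho x) => //; rewrite mx_norm_ball.
have xsr : rho <= `|xs| by have := far 0 K0; rewrite subr0.
have farZ x t : K x -> 0 <= t -> rho * t <= `|x - t *: xs|.
  move=> Kx; rewrite le_eqVlt => /predU1P[<-|t0]; first by rewrite mulr0.
  have -> : x - t *: xs = - (t *: (xs - t^-1 *: x)).
    by rewrite scalerBr scalerA divff ?gt_eqF// scale1r opprB.
  rewrite normrN normrZ gtr0_norm// mulrC ler_wpM2l ?(ltW t0)// far//.
  by have [_ h] := cK; apply: h => //; rewrite invr_gt0.
pose eps := rho / 2; have eps0 : 0 < eps by rewrite divr_gt0.
exists eps => //.
(* The slack [a] makes this cone open; at the points of [K] it exists because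
   [t *: xs] is far from [x] when [t] is small. *)
exists [set u | exists2 a : R, 0 < a & forall t, 0 <= t -> eps * t + a <= `|u - t *: xs|].
  split.
  - rewrite openE => u [a a0 ha]; apply/nbhs_ballP; exists (a / 2).
      by rewrite /= divr_gt0.
    move=> u'; rewrite mx_norm_ball /ball_ /= => uu'; exists (a / 2); first by rewrite divr_gt0.
    move=> t t0; have := ha t t0.
    have : `|u - t *: xs| <= `|u - u'| + `|u' - t *: xs|.
      by rewrite -[u - t *: xs](subrKA u') ler_normD.
    by lra.
  - split.
      exists (- xs); exists rho => // t t0.
      have -> : - xs - t *: xs = - ((1 + t) *: xs) by rewrite scalerDl scale1r opprD.
      rewrite normrN normrZ ger0_norm ?addr_ge0//.
      apply: (@le_trans _ _ ((1 + t) * rho)); last by rewrite ler_wpM2l ?addr_ge0.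
      have : 0 <= rho * t by rewrite mulr_ge0// ltW.
      by rewrite /eps; lra.
    move=> q u q0 [a a0 ha]; exists (q * a); first by rewrite mulr_gt0.
    move=> t t0; have -> : q *: u - t *: xs = q *: (u - (t / q) *: xs).
      by rewrite scalerBr scalerA mulrCA divff ?gt_eqF// mulr1.
    rewrite normrZ gtr0_norm//.
    have -> : eps * t + q * a = q * (eps * (t / q) + a) by field; rewrite gt_eqF.
    by rewrite ler_wpM2l ?(ltW q0)// ha// divr_ge0// ltW.
  - move=> x [clx x0]; have Kx : K x by rewrite -(closure_id K).1 in clx.
    have nx : 0 < `|x| by rewrite normr_gt0; apply/eqP.
    pose c := 2 + `|xs| / eps.
    have c0 : 0 < c by rewrite ltr_pwDl// divr_ge0// ltW.
    pose a := `|x| / c; have a0 : 0 < a by rewrite divr_gt0.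
    have ac : a * 2 + a * (`|xs| / eps) = `|x|.
      by rewrite -mulrDr /a divfK// gt_eqF.
    exists a => // t t0; have h := farZ x t Kx t0.
    have [ta|ta] := leP a (eps * t).
      by have e2 : rho * t = eps * t + eps * t by [rewrite /eps; field]; lra.
    have : `|x| <= `|x - t *: xs| + t * `|xs|.
      rewrite -[X in _ <= _ + X * _](ger0_norm t0) -normrZ -{1}[x](subrK (t *: xs)).
      exact: ler_normD.
    have : t * `|xs| <= a * (`|xs| / eps).
      have tae : t <= a / eps by rewrite ler_pdivlMr// mulrC ltW.
      by rewrite [leRHS]mulrA [leRHS]mulrAC ler_wpM2r.
    by lra.
move=> u t [a a0 ha] t0; rewrite (le_trans _ (ha t t0))// lerDl.
exact: ltW.
Qed.

Lemma open_cone_nbhdT K : open_cone_nbhd K setT.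
Proof. by split; [exact: openT|split; [exists 0|]|]. Qed.

End AvoidingCone.

Section ProductCones.
Variables (R : realType) (d1 d2 : nat).

Lemma norm_lsubmx (x : 'rV[R]_(d1 + d2)) : `|lsubmx x| <= `|x|.
Proof. by apply: norm_le_coord => // j; rewrite mxE coord_le_norm. Qed.

Lemma norm_rsubmx (x : 'rV[R]_(d1 + d2)) : `|rsubmx x| <= `|x|.
Proof. by apply: norm_le_coord => // j; rewrite mxE coord_le_norm. Qed.

Lemma cone_prod_set (U1 : set 'rV[R]_d1) (U2 : set 'rV[R]_d2) :
  cone U1 -> cone U2 -> cone (prod_set U1 U2).
Proof.
move=> [[x1 U1x] c1] [[x2 U2x] c2]; split.
  by exists (row_mx x1 x2); rewrite /prod_set /= row_mxKl row_mxKr.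
move=> t x t0 [h1 h2]; rewrite /prod_set /= !linearZ /=.
by split; [exact: c1|exact: c2].
Qed.

Lemma exists_coord_neq0 (n : nat) (x : 'rV[R]_n) : x <> 0 -> exists i, x ord0 i != 0.
Proof.
move=> x0; apply: contrapT => /forallNP h; apply: x0; apply/rowP => i.
by rewrite mxE; apply/eqP/negPn/negP; exact: h.
Qed.

Lemma lin_span_sub (V : lmodType (CC R)) (A : set V) : A `<=` lin_span A.
Proof.
move=> f Af; exists 1%N, (fun=> 1), (fun=> f); split => //.
by rewrite big_ord1 scale1r.
Qed.

End ProductCones.

Theorem theorem9 (R : realType) (d1 d2 : nat) (beta : R)
    (nrm : 'rV[R]_(d1 + d2) -> R)
    (K1 : set 'rV[R]_d1) (K2 : set 'rV[R]_d2)
    (hd1 : (1 <= d1)%N) (hd2 : (1 <= d2)%N)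
    (hbeta : 0 <= beta < 1) (hnrm : is_norm nrm)
    (hK1 : cone K1) (cK1 : closed K1) (hK2 : cone K2) (cK2 : closed K2) :
  let SK := S_K beta nrm (prod_set K1 K2) in
  let SKK := S_KK beta nrm K1 K2 in
  let SR := S_U beta nrm setT in
  let exceptional := (K1 = setT /\ K2 = setT) \/
                     (K1 = [set 0] /\ K2 = [set 0]) in
  (lcs_car SK = lcs_car SKK -> exceptional) /\
  (~ exceptional ->
     lcs_car SK <> lcs_car SKK /\ dual_restr SR SK <> dual_restr SR SKK).
Proof.
move=> SK SKK SR exc.
suff main : ~ exc -> lcs_car SK <> lcs_car SKK /\ dual_restr SR SK <> dual_restr SR SKK.
  by split=> // eqS; apply: contrapT => /main[].
move=> nexc.
have K10 := closed_cone0 hK1 cK1; have K20 := closed_cone0 hK2 cK2.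
have key (v w : 'rV[R]_(d1 + d2)) i0 eps U1 U2 : v ord0 i0 != 0 ->
    prod_set K1 K2 v -> 0 < eps -> open_cone_nbhd K1 U1 -> open_cone_nbhd K2 U2 ->
    (forall u a t, prod_set U1 U2 u -> 0 <= t -> eps * t <= `|u - (a *: v + t *: w)|) ->
    lcs_car SK <> lcs_car SKK /\ dual_restr SR SK <> dual_restr SR SKK.
  move=> vi0 Kv eps0 U1n U2n far.
  have vN0 : v <> 0 by move=> v0; move: vi0; rewrite v0 mxE eqxx.
  have KN0 : prod_set K1 K2 <> [set 0] by move=> K0; move: Kv; rewrite K0.
  rewrite /SK /S_K asboolF//.
  have [_ c1 _] := U1n; have [_ c2 _] := U2n.
  apply: (@separation R _ beta nrm hbeta hnrm v w eps i0 (prod_set U1 U2)) => //.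
  - exact: cone_prod_set.
  - move=> U [oU cU KU]; split=> //; apply: KU; split=> //; exact: subset_closure.
  - by exists U1, U2.
  - move=> f hf; apply: lin_span_sub; exists (S_U beta nrm (prod_set U1 U2)) => //.
    by exists U1, U2.
have n0 (n : nat) (K : set 'rV[R]_n) : K 0 -> K <> [set 0] -> exists2 x, K x & x <> 0.
  move=> K0 KN0; apply: contrapT => h; apply: KN0; apply/seteqP; split=> [x Kx /=|x ->//].
  by apply: contrapT => x0; apply: h; exists x.
have nT (n : nat) (K : set 'rV[R]_n) : K <> setT -> exists x, ~ K x.
  move=> KT; apply: contrapT => /forallNP h; apply: KT; apply/seteqP; split=> // x _.
  by apply: contrapT; exact: h.
have caseA : K1 <> [set 0] -> K2 <> setT ->
    lcs_car SK <> lcs_car SKK /\ dual_restr SR SK <> dual_restr SR SKK.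
  move=> /(n0 _ _ K10)[x1 K1x x1N0] /nT[x2 K2x].
  have [i xi] := exists_coord_neq0 x1N0.
  have [eps eps0 [U2 U2n far]] := avoiding_cone hK2 cK2 K2x.
  apply: (key (row_mx x1 0) (row_mx 0 x2) (lshift d2 i) eps setT U2) => //.
  - by rewrite row_mxEl.
  - by rewrite /prod_set /= row_mxKl row_mxKr.
  - exact: open_cone_nbhdT.
  - move=> u a t [_ U2u] t0; apply: le_trans (norm_rsubmx _).
    rewrite !scale_row_mx add_row_mx !scaler0 addr0 add0r raddfB /= row_mxKr.
    exact: far.
have caseB : K2 <> [set 0] -> K1 <> setT ->
    lcs_car SK <> lcs_car SKK /\ dual_restr SR SK <> dual_restr SR SKK.
  move=> /(n0 _ _ K20)[x2 K2x x2N0] /nT[x1 K1x].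
  have [i xi] := exists_coord_neq0 x2N0.
  have [eps eps0 [U1 U1n far]] := avoiding_cone hK1 cK1 K1x.
  apply: (key (row_mx 0 x2) (row_mx x1 0) (rshift d1 i) eps U1 setT) => //.
  - by rewrite row_mxEr.
  - by rewrite /prod_set /= row_mxKl row_mxKr.
  - exact: open_cone_nbhdT.
  - move=> u a t [U1u _] t0; apply: le_trans (norm_lsubmx _).
    rewrite !scale_row_mx add_row_mx !scaler0 addr0 add0r raddfB /= row_mxKl.
    exact: far.
have TN0 (n : nat) : (1 <= n)%N -> [set: 'rV[R]_n] <> [set 0].
  move=> n1 h; have : [set 0] (const_mx 1 : 'rV[R]_n) by rewrite -h.
  move=> /= /rowP/(_ (Ordinal n1)); rewrite !mxE => /eqP; rewrite oner_eq0//.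
have [E1|E1] := pselect (K1 = [set 0]).
  apply: caseB => [E2|E2]; first by apply: nexc; right.
  by apply: (TN0 d1 hd1); rewrite -E2.
have [E2|E2] := pselect (K2 = setT); last exact: caseA.
apply: caseB => [E3|E3]; last by apply: nexc; left.
by apply: (TN0 d2 hd2); rewrite -E2.
Qed.
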